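(* Let $A$ be a finite dimensional $k$-algebra over a field $k$ with finite strong global dimension $\operatorname{s.gl.dim}A=\nu$. A sequence $\eta$ in $\mathbf{C}^b(\operatorname{proj}A)$ is almost split if and only if $\mathcal{F}_m(\eta)$ is an almost split sequence in $\mathbf{C}_{\equiv m}(\operatorname{proj}A)$, for any $m\ge 2$. Moreover, the additive function can be applied to build the Auslander-Reiten quiver of $\mathbf{C}_{\equiv m}(\operatorname{proj}A)$.
   Context: $\operatorname{proj}A$ is the category of finitely generated projective $A$-modules. $\mathbf{C}^b(\operatorname{proj}A)$ is the category of bounded complexes $X=(X^i,d_X^i:X^i\to X^{i+1})$ and $\mathbf{K}^b(\operatorname{proj}A)$ its homotopy category. The strong global dimension is $\operatorname{s.gl.dim}A=\sup\{\ell(X): X\in\mathbf{K}^b(\operatorname{proj}A)\text{ indecomposable}\}$, where $\ell(X)$ is the least $b-a$ such that $X$ is isomorphic in $\mathbf{K}^b(\operatorname{proj}A)$ to a complex concentrated in degrees $[a,b]$. $\mathbf{C}_{\equiv m}(\operatorname{proj}A)$ is the category of $m$-periodic complexes: complexes $X=(X^i,d_X^i)_{i\in\mathbb{Z}}$ with $X^i=X^j$, $d_X^i=d_X^j$ whenever $i\equiv j\pmod m$; morphisms are morphisms of complexes $(f^i)$ with $f^i=f^j$ whenever $i\equiv j\pmod m$. The compression functor $\mathcal{F}_m:\mathbf{C}^b(\operatorname{proj}A)\to\mathbf{C}_{\equiv m}(\operatorname{proj}A)$ is given by $\mathcal{F}_m(X)^i=\bigoplus_{t\in\mathbb{Z}}X^{i+tm}$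 with diagonal differential with components $d_X^{i+tm}$, and $\mathcal{F}_m(f)^i$ is diagonal with components $f^{i+tm}$. Both categories carry the exact structure whose short exact sequences $X\to Y\to Z$ are those that are split exact in each degree; ''sequence'' means such a short exact sequence. An almost split sequence is such a sequence $X\xrightarrow{f}Y\xrightarrow{g}Z$ with $f$ minimal left almost split and $g$ minimal right almost split. The Auslander-Reiten quiver has as vertices the isomorphism classes of indecomposable objects and its arrows represent irreducible morphisms between them. ''The additive function'' is an informal reference to the additivity along almost split sequences that is used in the knitting technique for constructing Auslander-Reiten quivers. *)

(* Defs.v *)
From HB Require Import structures.
From mathcomp Require Import all_boot all_order all_algebra all_field.
From mathcomp Require Import boolp classical_sets.
From mathcomp Require Import zify.

Set Implicit Arguments.
Unset Strict Implicit.
Unset Printing Implicit Defensive.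

Import Order.TTheory GRing.Theory Num.Theory.
Local Open Scope ring_scope.

Local Obligation Tactic := idtac.

(* The signature of an additive category.  [heq] is the equality of parallel
   morphisms: pointwise equality for categories of complexes, homotopy for
   the homotopy category. *)
Record addcat := AddCat {
  obj :> Type;
  homset : obj -> obj -> Type;
  heq : forall X Y, homset X Y -> homset X Y -> Prop;
  idm : forall X, homset X X;
  compm : forall X Y Z, homset Y Z -> homset X Y -> homset X Z;
  zerom : forall X Y, homset X Y;
  addm : forall X Y, homset X Y -> homset X Y -> homset X Y
}.
Arguments homset {a} X Y.
Arguments heq {a X Y}.
Arguments idm {a} X.
Arguments compm {a X Y Z}.
Arguments zerom {a} X Y.
Arguments addm {a X Y}.

Declare Scope cat_scope.
Delimit Scope cat_scope with cat.
Local Open Scope cat_scope.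
Notation "f =h g" := (heq f g) (at level 70, no associativity) : cat_scope.
Notation "g \oc f" := (compm g f) (at level 50, left associativity) : cat_scope.

Section Category.
Variable C : addcat.
Implicit Types X Y Z W : C.

Definition is_iso X Y (f : homset X Y) : Prop :=
  exists g : homset Y X, g \oc f =h idm X /\ f \oc g =h idm Y.

Definition isomorphic X Y : Prop := exists f : homset X Y, is_iso f.

Definition split_mono X Y (f : homset X Y) : Prop :=
  exists r : homset Y X, r \oc f =h idm X.

Definition split_epi X Y (f : homset X Y) : Prop :=
  exists s : homset Y X, f \oc s =h idm Y.

Definition is_zero X : Prop := idm X =h zerom X X.

Definition is_direct_sum X n (Y : 'I_n -> C) : Prop :=
  exists (inj : forall j, homset (Y j) X) (prj : forall j, homset X (Y j)),
    [/\ forall j, prj j \oc inj j =h idm (Y j),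
        forall j l, j != l -> prj l \oc inj j =h zerom (Y j) (Y l) &
        \big[addm/zerom X X]_(j < n) (inj j \oc prj j) =h idm X].

Definition indecomposable X : Prop :=
  ~ is_zero X /\
  forall Y : 'I_2 -> C, is_direct_sum X Y -> exists j, is_zero (Y j).

Definition left_almost_split X Y (f : homset X Y) : Prop :=
  ~ split_mono f /\
  forall W (h : homset X W), ~ split_mono h -> exists h' : homset Y W, h' \oc f =h h.

Definition right_almost_split Y Z (g : homset Y Z) : Prop :=
  ~ split_epi g /\
  forall W (h : homset W Z), ~ split_epi h -> exists h' : homset W Y, g \oc h' =h h.

Definition left_minimal X Y (f : homset X Y) : Prop :=
  forall u : homset Y Y, u \oc f =h f -> is_iso u.

Definition right_minimal Y Z (g : homset Y Z) : Prop :=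
  forall u : homset Y Y, g \oc u =h g -> is_iso u.

Definition irreducible X Y (f : homset X Y) : Prop :=
  [/\ ~ split_mono f, ~ split_epi f &
      forall W (a : homset X W) (b : homset W Y),
        b \oc a =h f -> split_mono a \/ split_epi b].

(* Arrows of the Auslander-Reiten quiver, whose vertices are the isomorphism
   classes of indecomposable objects. *)
Definition ar_arrow X Y : Prop :=
  [/\ indecomposable X, indecomposable Y & exists f : homset X Y, irreducible f].

End Category.

Record excat := ExCat {
  ecat :> addcat;
  ses : forall X Y Z : ecat, homset X Y -> homset Y Z -> Prop
}.
Arguments ses {e X Y Z}.

Section Exact.
Variable C : excat.
Implicit Types X Y Z W P J : C.

Definition almost_split X Y Z (f : homset X Y) (g : homset Y Z) : Prop :=
  ses f g /\
  [/\ left_almost_split f, left_minimal f, right_almost_split g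
    & right_minimal g].

Definition projective_obj P : Prop :=
  forall X Y Z (f : homset X Y) (g : homset Y Z), ses f g ->
  forall h : homset P Z, exists h' : homset P Y, g \oc h' =h h.

Definition injective_obj J : Prop :=
  forall X Y Z (f : homset X Y) (g : homset Y Z), ses f g ->
  forall h : homset X J, exists h' : homset Y J, h' \oc f =h h.

(* The mesh of the Auslander-Reiten quiver with ends X and Z and with middle
   vertices the [Y j], repeated according to their multiplicity as direct
   summands of the middle term Y of an almost split sequence. *)
Definition ar_mesh X n (Y : 'I_n -> C) Z : Prop :=
  exists (E : C) (f : homset X E) (g : homset E Z),
    [/\ almost_split f g, is_direct_sum E Y & forall j, indecomposable (Y j)].

Definition additive_function (l : C -> nat) : Prop :=
  (forall X Y, isomorphic X Y -> l X = l Y) /\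
  (forall X n (Y : 'I_n -> C) Z, ar_mesh X Y Z ->
     (l X + l Z = \sum_(j < n) l (Y j))%N).

(* What knitting needs: a mesh stops at every vertex which is not projective
   and starts at every vertex which is not injective; the arrows of the quiver
   out of the start of a mesh, and those into its end, are exactly the arrows
   of that mesh; and there is no arrow outside the meshes. *)
Definition knittable : Prop :=
  [/\ forall Z, indecomposable Z -> ~ projective_obj Z ->
        exists X n (Y : 'I_n -> C), ar_mesh X Y Z,
      forall X, indecomposable X -> ~ injective_obj X ->
        exists Z n (Y : 'I_n -> C), ar_mesh X Y Z,
      forall X n (Y : 'I_n -> C) Z, ar_mesh X Y Z ->
        forall W,
          (ar_arrow X W <-> exists j, isomorphic W (Y j)) /\
          (ar_arrow W Z <-> exists j, isomorphic W (Y j)) &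
      forall V W, ar_arrow V W ->
        exists X n (Y : 'I_n -> C) Z, ar_mesh X Y Z /\
          ((isomorphic V X /\ exists j, isomorphic W (Y j)) \/
           (isomorphic W Z /\ exists j, isomorphic V (Y j)))].

End Exact.

Section Modules.
Variable R : nzRingType.

Definition fin_generated (M : lmodType R) : Prop :=
  exists n (g : 'I_n -> M), forall x, exists c : 'I_n -> R,
    x = \sum_(i < n) c i *: g i.

Definition projective_mod (M : lmodType R) : Prop :=
  forall (N L : lmodType R) (p : {linear N -> L}) (f : {linear M -> L}),
    (forall y, exists x, p x = y) ->
    exists h : {linear M -> N}, forall x, p (h x) = f x.

End Modules.

(* The dimension over k of eM, for an idempotent e of A; this is the dimension
   of Hom_A(Ae, M).  The default value 0 is never used on finitely generated
   modules. *)
Definition dim_at (k : fieldType) (A : falgType k) (e : A) (M : lmodType A) :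
    nat :=
  xget 0%N [set d : nat | exists b : 'I_d -> M,
    (forall j, e *: b j = b j) /\
    (forall x : M, e *: x = x ->
       exists! c : 'rV[k]_d, x = \sum_(j < d) (c 0 j)%:A *: b j)].

(* Complexes of finitely generated projective left R-modules indexed by a ring
   I, in practice int or 'Z_m.  The differential is given as a matrix whose
   only possibly nonzero entries are the d i (i + 1), which avoids transport
   between X i and X j when i = j. *)
Section Complexes.
Variables (R : nzRingType) (I : nzRingType).

Record cplx := Cplx {
  cob :> I -> lmodType R;
  diff : forall i j, {linear cob i -> cob j};
  diff_shape : forall i j x, j != i + 1 -> diff i j x = 0;
  diff_comp : forall i j l x, diff j l (diff i j x) = 0;
  cob_fg : forall i, fin_generated (cob i);
  cob_proj : forall i, projective_mod (cob i)
}.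

Record cmor (X Y : cplx) := CMor {
  mor :> forall i, {linear X i -> Y i};
  mor_comm : forall i j x, mor j (diff X i j x) = diff Y i j (mor i x)
}.

Definition cmor_eq X Y (f g : cmor X Y) : Prop := forall i x, f i x = g i x.

Definition homotopic X Y (f g : cmor X Y) : Prop :=
  exists s : forall i j, {linear X i -> Y j}, forall i x,
    f i x - g i x = diff Y (i - 1) i (s i (i - 1) x)
                    + s (i + 1) i (diff X i (i + 1) x).

Program Definition cmor_id X : cmor X X := @CMor X X (fun i => idfun) _.
Next Obligation. by []. Qed.

Program Definition cmor_comp X Y Z (g : cmor Y Z) (f : cmor X Y) : cmor X Z :=
  @CMor X Z (fun i => g i \o f i) _.
Next Obligation. by move=> X Y Z g f i j x /=; rewrite !mor_comm. Qed.

Program Definition cmor_zero X Y : cmor X Y := @CMor X Y (fun i => \0) _.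
Next Obligation. by move=> X Y i j x /=; rewrite linear0. Qed.

Program Definition cmor_add X Y (f g : cmor X Y) : cmor X Y :=
  @CMor X Y (fun i => f i \+ g i) _.
Next Obligation. by move=> X Y f g i j x /=; rewrite !mor_comm linearD. Qed.

Definition degreewise_split X Y Z (f : cmor X Y) (g : cmor Y Z) : Prop :=
  forall i,
    [/\ injective (f i),
        forall y, g i y = 0 <-> exists x, y = f i x &
        exists s : {linear Z i -> Y i}, forall z, g i (s z) = z].

End Complexes.

Arguments diff {R I} c i j.

Definition concentrated (R : nzRingType) (X : cplx R int) (a b : int) : Prop :=
  forall i : int, ~~ (a <= i <= b) -> forall x : X i, x = 0.

Record bcplx (R : nzRingType) := BCplx {
  bcob :> cplx R int;
  bcob_bounded : exists a b, concentrated bcob a b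
}.

Section Categories.
Variable R : nzRingType.

Definition Cb_cat : addcat :=
  @AddCat (bcplx R) (fun X Y => cmor X Y) (fun X Y => @cmor_eq _ _ X Y)
    (fun X => cmor_id X) (fun X Y Z => @cmor_comp _ _ X Y Z)
    (fun X Y => cmor_zero X Y) (fun X Y => @cmor_add _ _ X Y).

Definition Cb : excat :=
  @ExCat Cb_cat (fun X Y Z => @degreewise_split _ _ X Y Z).

Definition Kb : addcat :=
  @AddCat (bcplx R) (fun X Y => cmor X Y) (fun X Y => @homotopic _ _ X Y)
    (fun X => cmor_id X) (fun X Y Z => @cmor_comp _ _ X Y Z)
    (fun X Y => cmor_zero X Y) (fun X Y => @cmor_add _ _ X Y).

(* m-periodic complexes are families indexed by the integers modulo m.  This
   is meant for m >= 2 only: 'Z_0 and 'Z_1 are the integers modulo 2. *)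
Definition Cper_cat (m : nat) : addcat :=
  @AddCat (cplx R 'Z_m) (fun X Y => cmor X Y) (fun X Y => @cmor_eq _ _ X Y)
    (fun X => cmor_id X) (fun X Y Z => @cmor_comp _ _ X Y Z)
    (fun X Y => cmor_zero X Y) (fun X Y => @cmor_add _ _ X Y).

Definition Cper (m : nat) : excat :=
  @ExCat (Cper_cat m) (fun X Y Z => @degreewise_split _ _ X Y Z).

Definition width_le (X : Kb) (n : nat) : Prop :=
  exists (a : int) (Y : Kb), isomorphic X Y /\ concentrated Y a (a + n%:Z).

Definition has_length (X : Kb) (n : nat) : Prop :=
  width_le X n /\ forall n', width_le X n' -> (n <= n')%N.

Definition length_bound (u : nat) : Prop :=
  forall (X : Kb) n, indecomposable X -> has_length X n -> (n <= u)%N.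

(* The strong global dimension of R is finite and equal to nu. *)
Definition sgldim (nu : nat) : Prop :=
  length_bound nu /\ forall u, length_bound u -> (nu <= u)%N.

End Categories.

(* The direct sum of the V j over the integers j congruent to i modulo m, as
   the module of finitely supported families. *)
Section DirectSum.
Variables (R : nzRingType) (m : nat) (V : int -> lmodType R) (i : 'Z_m).

Record dsum := DSum {
  fam :> forall j, V j;
  fam_fin : exists a b : int, forall j : int, ~~ (a <= j <= b) -> fam j = 0;
  fam_res : forall j : int, j%:~R != i -> fam j = 0
}.

Lemma dsumP (x y : dsum) : (forall j, x j = y j) -> x = y.
Proof.
case: x y => [x x1 x2] [y y1 y2] /= exy.
have {}exy : x = y by apply: functional_extensionality_dep.
by case: _ / exy in y1 y2 *; congr DSum; apply: Prop_irrelevance.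
Qed.

HB.instance Definition _ := gen_eqMixin dsum.
HB.instance Definition _ := gen_choiceMixin dsum.

Lemma dsum_fin2 (x y : dsum) : exists a b : int,
  forall j : int, ~~ (a <= j <= b) -> x j = 0 /\ y j = 0.
Proof.
case: x y => [x [a [b x1]] x2] [y [c [d y1]] y2] /=.
exists (Num.min a c), (Num.max b d) => j hj.
by split; [apply: x1|apply: y1]; lia.
Qed.

Program Definition dsum0 := @DSum (fun=> 0) _ _.
Next Obligation. by exists 0, 0. Qed.
Next Obligation. by []. Qed.

Program Definition dsumN (x : dsum) := @DSum (fun j => - x j) _ _.
Next Obligation.
by move=> [x [a [b h]] h2] /=; exists a, b => j /h ->; rewrite oppr0.
Qed.
Next Obligation. by move=> x j hj /=; rewrite fam_res // oppr0. Qed.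

Program Definition dsumD (x y : dsum) := @DSum (fun j => x j + y j) _ _.
Next Obligation.
move=> x y; have [a [b h]] := dsum_fin2 x y.
by exists a, b => j /h [-> ->]; rewrite addr0.
Qed.
Next Obligation. by move=> x y j hj /=; rewrite !fam_res // addr0. Qed.

Program Definition dsumZ (c : R) (x : dsum) := @DSum (fun j => c *: x j) _ _.
Next Obligation.
by move=> c [x [a [b h]] h2] /=; exists a, b => j /h ->; rewrite scaler0.
Qed.
Next Obligation. by move=> c x j hj /=; rewrite fam_res // scaler0. Qed.

Lemma dsumDA : associative dsumD.
Proof. by move=> x y z; apply: dsumP => j /=; rewrite addrA. Qed.
Lemma dsumDC : commutative dsumD.
Proof. by move=> x y; apply: dsumP => j /=; rewrite addrC. Qed.
Lemma dsum0D : left_id dsum0 dsumD.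
Proof. by move=> x; apply: dsumP => j /=; rewrite add0r. Qed.
Lemma dsumND : left_inverse dsum0 dsumN dsumD.
Proof. by move=> x; apply: dsumP => j /=; rewrite addNr. Qed.
HB.instance Definition _ := GRing.isZmodule.Build dsum dsumDA dsumDC dsum0D dsumND.

Lemma dsumZA a b (x : dsum) : dsumZ a (dsumZ b x) = dsumZ (a * b) x.
Proof. by apply: dsumP => j /=; rewrite scalerA. Qed.
Lemma dsum1Z : left_id 1 dsumZ.
Proof. by move=> x; apply: dsumP => j /=; rewrite scale1r. Qed.
Lemma dsumZDr : right_distributive dsumZ +%R.
Proof. by move=> a x y; apply: dsumP => j /=; rewrite scalerDr. Qed.
Lemma dsumZDl (x : dsum) : {morph dsumZ^~ x : a b / a + b}.
Proof. by move=> a b; apply: dsumP => j /=; rewrite scalerDl. Qed.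
HB.instance Definition _ :=
  GRing.Zmodule_isLmodule.Build R dsum dsumZA dsum1Z dsumZDr dsumZDl.

Lemma dsum_sumE T (r : seq T) (P : pred T) (F : T -> dsum) j :
  (\sum_(t <- r | P t) F t) j = \sum_(t <- r | P t) F t j.
Proof.
by elim/big_rec2: _ => // t x y _ <-.
Qed.

Program Definition dsum_inj_fun j (v : V j) : dsum :=
  @DSum (@dfwith _ V (fun=> 0) j (if j%:~R == i then v else 0)) _ _.
Next Obligation.
move=> j v; exists j, j => l hl.
by rewrite dfwith_out //; apply/eqP => ejl; rewrite ejl lexx in hl.
Qed.
Next Obligation.
move=> j v l hl; have [ejl|njl] := eqVneq j l; last by rewrite dfwith_out.
by rewrite -ejl in hl *; rewrite dfwith_in (negPf hl).
Qed.

Lemma dsum_inj_linear j : linear (@dsum_inj_fun j).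
Proof.
move=> c u v; apply: dsumP => l /=.
have [<-|njl] := eqVneq j l; last by rewrite !dfwith_out // scaler0 addr0.
by rewrite !dfwith_in; case: ifP; rewrite // scaler0 addr0.
Qed.
HB.instance Definition _ j := GRing.isLinear.Build R (V j) dsum _
  (@dsum_inj_fun j) (@dsum_inj_linear j).
Definition dsum_inj j : {linear V j -> dsum} := @dsum_inj_fun j.

Lemma dsum_inj_same (x : dsum) j : dsum_inj j (x j) j = x j.
Proof. by rewrite /= dfwith_in; case: ifP => // /negbT /fam_res. Qed.

Lemma dsum_inj_other j (v : V j) l : j != l -> dsum_inj j v l = 0.
Proof. by move=> njl; rewrite /= dfwith_out. Qed.

Hypothesis V_bounded :
  exists a b : int, forall j : int, ~~ (a <= j <= b) -> forall x : V j, x = 0.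

Lemma dsum_decomp : exists (a : int) (N : nat), forall x : dsum,
  x = \sum_(t < N) dsum_inj _ (x (a + t%:Z)).
Proof.
have [a [b hV]] := V_bounded; exists a, `|b - a|.+1%N => x.
apply: dsumP => l; rewrite dsum_sumE.
have [hl|hl] := boolP (a <= l <= b); last first.
  rewrite (hV _ hl (x l)) big1 // => t _; exact: hV.
have ht : (`|l - a| < `|b - a|.+1)%N by lia.
have el : a + (Ordinal ht)%:Z = l by rewrite /=; lia.
rewrite (bigD1 (Ordinal ht)) // el dsum_inj_same big1 => [|t nt].
  exact/esym/addr0.
rewrite dsum_inj_other //; apply: contraNneq nt => et.
by apply/eqP/val_inj => /=; move: et; lia.
Qed.

Lemma dsum_fg : (forall j, fin_generated (V j)) -> fin_generated dsum.
Proof.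
move=> fgV; have [a [N dec]] := dsum_decomp.
pose n j := sval (cid (fgV j)).
pose g j : 'I_(n j) -> V j := sval (cid (svalP (cid (fgV j)))).
have gP j : forall x, exists c : 'I_(n j) -> R, x = \sum_t c t *: g j t.
  exact: svalP (cid (svalP (cid (fgV j)))).
pose T := {t : 'I_N & 'I_(n (a + t%:Z))}.
pose G (u : T) := dsum_inj _ (g _ (tagged u)).
exists #|{: T}|, (fun r => G (enum_val r)) => x.
pose c (t : 'I_N) := sval (cid (gP _ (x (a + t%:Z)))).
have cP (t : 'I_N) : x (a + t%:Z) = \sum_r c t r *: g _ r.
  exact: svalP (cid (gP _ (x (a + t%:Z)))).
exists (fun r => c (tag (enum_val r)) (tagged (enum_val r))).
rewrite {1}[x]dec; under eq_bigr => t _.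
  by rewrite cP linear_sum; under eq_bigr do rewrite linearZ; over.
rewrite (sig_big_dep _ _
  (fun (t : 'I_N) r => c t r *: dsum_inj (a + t%:Z) (g _ r))) /=.
rewrite (reindex_onto (@enum_val T predT) enum_rank) => [|u _]; last first.
  exact: enum_rankK.
by apply: eq_bigl => r; rewrite enum_valK eqxx.
Qed.

Lemma dsum_proj : (forall j, projective_mod (V j)) -> projective_mod dsum.
Proof.
move=> prV M L p f p_surj; have [a [N dec]] := dsum_decomp.
have lift j : exists h : {linear V j -> M}, forall v, p (h v) = f (dsum_inj j v).
  exact: (prV j M L p (f \o dsum_inj j) p_surj).
pose h j := sval (cid (lift j)).
have hP j v : p (h j v) = f (dsum_inj j v) by exact: svalP (cid (lift j)) v.
pose H (x : dsum) : M := \sum_(t < N) h _ (x (a + t%:Z)).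
have H_lin : linear H.
  move=> c x y; rewrite /H scaler_sumr -big_split /=.
  by apply: eq_bigr => t _; rewrite linearP.
pose HH := GRing.isLinear.Build R dsum M _ H H_lin.
pose HL : {linear dsum -> M} := HB.pack H HH.
exists HL => x; rewrite /= /H linear_sum {2}[x]dec linear_sum.
by apply: eq_bigr => t _; rewrite hP.
Qed.

End DirectSum.

Arguments dsumP {R m V i}.

(* The compression functor from Cb to Cper m, on objects [compr_ob m X] and on
   morphisms [compr m f]. *)
Section Compression.
Variables (R : nzRingType) (m : nat).

Section DSumMap.
Variables (X : cplx R int) (i i' : 'Z_m).

(* The component of degree j of the image of x is d (x (j - 1)); the test on
   i' is only needed for the pairs (i, i') with i' != i + 1, for which the
   differential is zero. *)
Program Definition compr_diff_fun (x : dsum X i) : dsum X i' :=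
  @DSum _ _ _ _
    (fun j => if i' == i + 1 then diff X (j - 1) j (x (j - 1)) else 0) _ _.
Next Obligation.
move=> [x [a [b h]] h2] /=; exists (a + 1), (b + 1) => j hj.
by case: ifP => // _; rewrite h ?linear0 //; lia.
Qed.
Next Obligation.
move=> x j hj /=; case: ifP => // /eqP ei; rewrite fam_res ?linear0 //.
by apply: contraNneq hj; rewrite ei => <-; rewrite intrB mulr1z subrK.
Qed.

Lemma compr_diff_linear : linear compr_diff_fun.
Proof.
move=> c x y; apply: dsumP => j /=.
by case: ifP => _; rewrite ?linearP // scaler0 addr0.
Qed.
HB.instance Definition _ := GRing.isLinear.Build R (dsum X i) (dsum X i') _
  compr_diff_fun compr_diff_linear.
Definition compr_diff : {linear dsum X i -> dsum X i'} := compr_diff_fun.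

End DSumMap.

Section DSumMor.
Variables (X Y : cplx R int) (f : cmor X Y) (i : 'Z_m).

Program Definition compr_mor_fun (x : dsum X i) : dsum Y i :=
  @DSum _ _ _ _ (fun j => f j (x j)) _ _.
Next Obligation.
by move=> [x [a [b h]] h2] /=; exists a, b => j /h ->; rewrite linear0.
Qed.
Next Obligation. by move=> x j hj /=; rewrite fam_res // linear0. Qed.

Lemma compr_mor_linear : linear compr_mor_fun.
Proof. by move=> c x y; apply: dsumP => j /=; rewrite linearP. Qed.
HB.instance Definition _ := GRing.isLinear.Build R (dsum X i) (dsum Y i) _
  compr_mor_fun compr_mor_linear.
Definition compr_mor : {linear dsum X i -> dsum Y i} := compr_mor_fun.

End DSumMor.

Program Definition compr_ob (X : Cb R) : Cper R m :=
  @Cplx R 'Z_m (fun i => dsum X i) (fun i i' => compr_diff X i i') _ _ _ _.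
Next Obligation.
by move=> X i i' x ni; apply: dsumP => j /=; rewrite (negPf ni).
Qed.
Next Obligation.
move=> X i i' i'' x; apply: dsumP => j /=; case: ifP => // _.
by case: ifP => _; rewrite ?diff_comp ?linear0.
Qed.
Next Obligation.
move=> X i; apply: dsum_fg; last exact: cob_fg.
exact: bcob_bounded.
Qed.
Next Obligation.
move=> X i; apply: dsum_proj; last exact: cob_proj.
exact: bcob_bounded.
Qed.

Program Definition compr (X Y : Cb R) (f : homset X Y) :
    homset (compr_ob X) (compr_ob Y) :=
  @CMor R 'Z_m (compr_ob X) (compr_ob Y) (fun i => compr_mor f i) _.
Next Obligation.
move=> X Y f i i' x; apply: dsumP => j /=.
by case: ifP => _; rewrite ?mor_comm ?linear0.
Qed.

End Compression.

Arguments compr_ob {R} m X.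
Arguments compr {R} m {X Y} f.

(* Main.v *)
Require Import Defs.
From HB Require Import structures.
From mathcomp Require Import all_boot all_order all_algebra all_field.
From mathcomp Require Import boolp classical_sets.
From mathcomp Require Import zify.

Set Implicit Arguments.
Unset Strict Implicit.
Unset Printing Implicit Defensive.

Import Order.TTheory GRing.Theory Num.Theory.
Local Open Scope ring_scope.

Local Obligation Tactic := idtac.

(** Let F be the compression functor and U the unrolling of an m-periodic
complex into an unbounded complex.  Maps from N to U M are maps from F N to M,
and maps from U M to N are maps from M to F N ([flat], [sharp]), so that F is
adjoint to U on both sides.  The complex U (F X) is the direct sum of the
shifts of X by the multiples of m, its sheets, and an endomorphism of F X has
a component from the sheet 0 to itself, [sheet0_part].

Two facts carry the comparison of almost split maps.  If X is indecomposable,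
an endomorphism of F X with component 1 on the sheet 0 is invertible
([sheet0_part_liso]): a composite that passes through a proper shift of X is
not invertible, as this shift is not isomorphic to X, so that up to radical
terms taking the component on the sheet 0 is multiplicative.  And
finite strong global dimension bounds the width of every indecomposable
bounded complex ([bounded_support]); hence, far from the cuts, the summands of
a truncation of U M are summands of U M itself.  The second fact makes every
indecomposable periodic complex a compression ([compr_dense]) and lets a map
from F X to M be studied through a bounded truncation of U M.  By the first
fact this map is a split monomorphism as soon as the corresponding map from X
to the truncation is, so that F preserves left and right almost split maps
([compr_las], [compr_ras]).  Minimality is then automatic for a degreewise
split sequence with indecomposable ends ([ses_lmin]).  Conversely a
factorization or a splitting in the periodic category restricts to the sheet 0
([compr_reflects]).

Knitting is a formal consequence of a list of properties of an exact category
with finite dimensional morphism spaces ([exactness],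
[exactness_knittable]).  This list is its own dual, so that half of each
argument is the other half in the opposite category.  For periodic complexes
([periodic_exactness]) the projective objects and the injective ones are the
contractible complexes, and a direct factorization shows that no arrow joins
two of them.  Almost split maps are first built for bounded complexes and then
transported by F.  An indecomposable non-contractible N has a chain map w from
N to some bounded Q which is not null-homotopic, while w h is null-homotopic for
every h from an indecomposable to N that is not a split epimorphism; the cocone
of w is then almost split over N.  Usually w comes from the Nakayama functor
and Serre duality.  Here Q is built one degree at a time ([resolution]), as a
complex of projective modules paired with N, and w corresponds to a linear
form on the graded endomorphisms of N that vanishes on the radical and on the
null-homotopic maps, but not on the identity ([radical_cocycle]).

The additive function is the dimension of the fixed space of e in degree i; it
is an invariant which adds up over degreewise split sequences and over direct
sums ([dim_at_additive]). *)

(** * Linear categories with finite dimensional morphism spaces *)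

(** Parallel morphisms are compared by Leibniz equality, so that the axioms are
equations to rewrite with; chain maps qualify because they are extensional. *)
Record lincat (k : fieldType) := LinCat {
  lob :> Type;
  lhom : lob -> lob -> lmodType k;
  lid : forall X, lhom X X;
  lcomp : forall X Y Z, lhom Y Z -> lhom X Y -> lhom X Z;
  lcompA : forall X Y Z W (h : lhom Z W) (g : lhom Y Z) (f : lhom X Y),
    lcomp h (lcomp g f) = lcomp (lcomp h g) f;
  lcomp1f : forall X Y (f : lhom X Y), lcomp (lid Y) f = f;
  lcompf1 : forall X Y (f : lhom X Y), lcomp f (lid X) = f;
  lcompP_l : forall X Y Z (g : lhom Y Z), linear (fun f : lhom X Y => lcomp g f);
  lcompP_r : forall X Y Z (f : lhom X Y), linear (fun g : lhom Y Z => lcomp g f);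
  lhom_fin : forall X Y, fin_generated (lhom X Y)
}.
Arguments lhom {k l}.
Arguments lid {k l}.
Arguments lcomp {k l X Y Z}.

Notation "g ** f" := (lcomp g f) (at level 40, left associativity).

Definition acat (k : fieldType) (L : lincat k) : addcat :=
  @AddCat L (fun X Y => lhom X Y) (fun X Y f g => f = g) (fun X => lid X)
    (fun X Y Z g f => g ** f) (fun X Y => 0) (fun X Y f g => f + g).

(** Every notion below is self-dual up to exchanging left and right: a statement
on left almost split maps is the right-hand statement in the opposite category. *)
Definition opL (k : fieldType) (L : lincat k) : lincat k :=
  @LinCat k L (fun X Y => @lhom k L Y X) (fun X => lid X)
    (fun X Y Z g f => f ** g)
    (fun X Y Z W h g f => esym (lcompA f g h))
    (fun X Y f => lcompf1 f) (fun X Y f => lcomp1f f)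
    (fun X Y Z g => lcompP_r g) (fun X Y Z f => lcompP_l f)
    (fun X Y => lhom_fin Y X).

Section Linear.
Variables (k : fieldType) (L : lincat k).
Implicit Types X Y Z W : L.

Lemma lcompDl X Y Z (g h : lhom Y Z) (f : lhom X Y) : (g + h) ** f = g ** f + h ** f.
Proof. by have := lcompP_r f 1 g h; rewrite !scale1r. Qed.
Lemma lcompDr X Y Z (g : lhom Y Z) (f h : lhom X Y) : g ** (f + h) = g ** f + g ** h.
Proof. by have := lcompP_l g 1 f h; rewrite !scale1r. Qed.
Lemma lcomp0f X Y Z (f : lhom X Y) : (0 : lhom Y Z) ** f = 0.
Proof. by apply: (addIr (0 ** f)); rewrite -lcompDl !add0r. Qed.
Lemma lcompf0 X Y Z (g : lhom Y Z) : g ** (0 : lhom X Y) = 0.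
Proof. by apply: (addIr (g ** 0)); rewrite -lcompDr !add0r. Qed.
Lemma lcompZl X Y Z c (g : lhom Y Z) (f : lhom X Y) : (c *: g) ** f = c *: (g ** f).
Proof. by move: (lcompP_r f c g 0) => /=; rewrite !addr0 lcomp0f addr0. Qed.
Lemma lcompZr X Y Z c (g : lhom Y Z) (f : lhom X Y) : g ** (c *: f) = c *: (g ** f).
Proof. by move: (lcompP_l g c f 0) => /=; rewrite !addr0 lcompf0 addr0. Qed.
Lemma lcompNf X Y Z (g : lhom Y Z) (f : lhom X Y) : (- g) ** f = - (g ** f).
Proof. by rewrite -scaleN1r lcompZl scaleN1r. Qed.
Lemma lcompfN X Y Z (g : lhom Y Z) (f : lhom X Y) : g ** (- f) = - (g ** f).
Proof. by rewrite -scaleN1r lcompZr scaleN1r. Qed.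
Lemma lcompBl X Y Z (g h : lhom Y Z) (f : lhom X Y) : (g - h) ** f = g ** f - h ** f.
Proof. by rewrite lcompDl lcompNf. Qed.
Lemma lcompBr X Y Z (g : lhom Y Z) (f h : lhom X Y) : g ** (f - h) = g ** f - g ** h.
Proof. by rewrite lcompDr lcompfN. Qed.
Lemma lcomp_suml X Y Z T (r : seq T) (P : pred T) (g : T -> lhom Y Z) (f : lhom X Y) :
  (\sum_(i <- r | P i) g i) ** f = \sum_(i <- r | P i) g i ** f.
Proof. by apply: (big_morph (fun g => g ** f)) => [u v|]; rewrite ?lcompDl ?lcomp0f. Qed.
Lemma lcomp_sumr X Y Z T (r : seq T) (P : pred T) (g : lhom Y Z) (f : T -> lhom X Y) :
  g ** (\sum_(i <- r | P i) f i) = \sum_(i <- r | P i) g ** f i.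
Proof. by apply: (big_morph (fun f => g ** f)) => [u v|]; rewrite ?lcompDr ?lcompf0. Qed.

(** The number of generators of End X is the measure of the inductions over
objects. *)
Definition spanned n X := exists g : 'I_n -> lhom X X,
  forall x, exists c : 'I_n -> k, x = \sum_(i < n) c i *: g i.

Lemma spanned_ex X : exists n, spanned n X.
Proof. by have [n [g gP]] := lhom_fin X X; exists n, g. Qed.

(** Since 1 - i p is not zero it gives a nontrivial relation between p and i:
compressed by p and i, a linear combination of the generators of End X
vanishes, and one compressed generator is superfluous. *)
Lemma spanned_proper_retract n X Y (i : lhom Y X) (p : lhom X Y) :
  p ** i = lid Y -> i ** p <> lid X -> spanned n X ->
  exists2 n', n = n'.+1 & spanned n' Y.
Proof.
move=> pi ip [g gP]; have [c cP] := gP (lid X - i ** p).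
have [s0 cs0] : exists s, c s != 0.
  apply/not_existsP => c0; apply: ip; apply/esym/subr0_eq.
  by rewrite cP big1 // => s _; have /negP/negPn/eqP-> := c0 s; rewrite scale0r.
case: n g gP c cP s0 cs0 => [|n] g gP c cP s0 cs0; first by case: (s0).
exists n => //; exists (fun s => p ** g (lift s0 s) ** i) => x.
have [d dP] := gP (i ** x ** p).
have rel : \sum_s c s *: (p ** g s ** i) = 0.
  under eq_bigr do rewrite -lcompZl -lcompZr; rewrite -lcomp_suml -lcomp_sumr -cP.
  by rewrite lcompBr lcompBl lcompf1 !lcompA pi lcomp1f pi subrr.
have ex : x = \sum_s d s *: (p ** g s ** i).
  under eq_bigr do rewrite -lcompZl -lcompZr; rewrite -lcomp_suml -lcomp_sumr -dP.
  by rewrite !lcompA pi lcomp1f -lcompA pi lcompf1.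
have e0 : p ** g s0 ** i = \sum_s (- ((c s0)^-1 * c (lift s0 s))) *: (p ** g (lift s0 s) ** i).
  move: rel; rewrite (bigD1_ord s0) //= => /(canRL (addrK _)); rewrite sub0r => e.
  apply: (scalerI cs0); rewrite e scaler_sumr -sumrN; apply: eq_bigr => s _.
  by rewrite scalerA mulrN mulrA divff // mul1r scaleNr.
exists (fun s => d (lift s0 s) - d s0 * ((c s0)^-1 * c (lift s0 s))).
rewrite {1}ex (bigD1_ord s0) //= e0 scaler_sumr -big_split /=; apply: eq_bigr => s _.
by rewrite scalerA mulrN addrC -scalerDl.
Qed.

Definition lpow X (u : lhom X X) n := iter n (lcomp u) (lid X).

Arguments lpow X u n : simpl never.

Lemma lpowS X (u : lhom X X) n : lpow u n.+1 = u ** lpow u n. Proof. by []. Qed.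
Lemma lpowD X (u : lhom X X) a b : lpow u (a + b) = lpow u a ** lpow u b.
Proof. by elim: a => [|a IH]; rewrite ?lcomp1f // addSn !lpowS IH lcompA. Qed.
Lemma lpow_comm X (u v : lhom X X) n : u ** v = v ** u -> u ** lpow v n = lpow v n ** u.
Proof.
move=> uv; elim: n => [|n IH]; first by rewrite lcompf1 lcomp1f.
by rewrite lpowS lcompA uv -lcompA IH lcompA.
Qed.
Lemma lpow_comm2 X (u v : lhom X X) m n :
  u ** v = v ** u -> lpow u m ** lpow v n = lpow v n ** lpow u m.
Proof. by move=> uv; apply: lpow_comm; apply/esym/lpow_comm/esym. Qed.

(** The powers of u are linearly dependent; a relation divided by its nonzero
coefficient of lowest degree expresses a power of u by higher ones. *)
Lemma fitting_rel X (u : lhom X X) :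
  exists r w, u ** w = w ** u /\ lpow u r = lpow u r.+1 ** w.
Proof.
have [n [g gP]] := lhom_fin X X.
pose c (j : 'I_n.+1) := sval (cid (gP (lpow u j))).
have cP (j : 'I_n.+1) : lpow u j = \sum_i c j i *: g i := svalP (cid (gP (lpow u j))).
pose B := \matrix_(j < n.+1, i < n) c j i.
have : kermx B != 0.
  rewrite kermx_eq0 /row_free; apply: contraTneq (rank_leq_col B) => ->.
  by rewrite -ltnNge.
case/rowV0Pn => v /sub_kermxP vB v0.
have rel : \sum_j v 0 j *: lpow u (j : 'I_n.+1) = 0.
  under eq_bigr => j _. rewrite cP scaler_sumr. under eq_bigr => i _ do rewrite scalerA. over.
  rewrite exchange_big big1 // => i _; rewrite -scaler_suml.
  have /matrixP/(_ 0 i) := vB; rewrite !mxE => e.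
  suff -> : \sum_j v 0 j * c j i = 0 by rewrite scale0r.
  by apply: etrans e; apply: eq_bigr => j _; rewrite mxE.
have [j0 vj0 jmin] : exists2 j : 'I_n.+1, v 0 j != 0 & forall i : 'I_n.+1, v 0 i != 0 -> (j <= i)%N.
  have /existsP[j1 vj1] : [exists j, v 0 j != 0].
    rewrite -negb_forall; apply: contraNN v0 => /forallP v0; apply/eqP/rowP => j.
    by rewrite mxE; apply/eqP.
  by exists [arg min_(j < j1 | v 0 j != 0) (j : nat)]; case: arg_minnP => // j.
pose w := - (v 0 j0)^-1 *: \sum_(j < n.+1 | j != j0) v 0 j *: lpow u (j - j0.+1).
have uw : u ** w = w ** u.
  rewrite /w lcompZr lcompZl lcomp_sumr lcomp_suml; congr (_ *: _); apply: eq_bigr => j _.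
  by rewrite lcompZr lcompZl lpow_comm.
exists j0, w; split=> //.
apply: (scalerI vj0); rewrite /w lcompZr scalerA mulrN divff // scaleN1r lcomp_sumr.
move: rel; rewrite (bigD1 j0) //= => /(canRL (addrK _)); rewrite sub0r => ->.
congr (- _); apply: eq_bigr => j nj; rewrite lcompZr.
have [->|vj] := eqVneq (v 0 j) 0; first by rewrite !scale0r.
rewrite -lpowD subnKC // ltn_neqAle jmin // andbT.
by apply: contraNneq nj => e; apply/eqP/val_inj.
Qed.

(** Fitting's lemma: e is the projection onto the stable image of u, where u is
invertible with inverse v. *)
Lemma fitting X (u : lhom X X) : exists (e v : lhom X X) (r : nat),
  [/\ e ** e = e, v ** u = e, u ** v = e & lpow u r ** e = lpow u r].
Proof.
have [r0 [w [uw er]]] := fitting_rel u.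
have {er} [r er] : exists r, lpow u r.+1 = lpow u r.+2 ** w.
  by exists r0; rewrite lpowS er lcompA.
have step j : lpow u r.+1 = lpow u (r.+1 + j) ** lpow w j.
  elim: j => [|j IH]; first by rewrite addn0 lcompf1.
  rewrite {1}IH (addnC r.+1 j) lpowD er lcompA -lpowD -lcompA -lpowS.
  by congr (lpow u _ ** _); rewrite !addnS addnC.
pose e := lpow u r.+1 ** lpow w r.+1.
have ee : e ** e = e.
  rewrite /e -lcompA (lcompA (lpow w _)) -(lpow_comm2 _ _ uw).
  by rewrite -lcompA lcompA -lpowD lcompA -step.
exists e, (lpow u r ** lpow w r.+1), r.+1; split=> //.
- by rewrite -lcompA -(lpow_comm _ uw) lcompA -(lpow_comm r (erefl (u ** u))).
- by rewrite lcompA.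
by rewrite lcompA -lpowD -step.
Qed.

End Linear.

Lemma compl_idem (k : fieldType) (L : lincat k) (X : L) (e : lhom X X) : e ** e = e ->
  (lid X - e) ** (lid X - e) = lid X - e.
Proof. by move=> ee; rewrite lcompBl !lcompBr !lcomp1f lcompf1 ee subrr subr0. Qed.

(** * Indecomposable objects *)

Definition splits_idem (k : fieldType) (L : lincat k) := forall (X : L) (e : lhom X X),
  e ** e = e -> exists (Y : L) (i : lhom Y X) (p : lhom X Y), p ** i = lid Y /\ i ** p = e.

Definition liso (k : fieldType) (L : lincat k) (X Y : L) (f : lhom X Y) :=
  exists g : lhom Y X, g ** f = lid X /\ f ** g = lid Y.

Notation lindec L := (@indecomposable (acat L)).

Section KrullSchmidt.
Variables (k : fieldType) (L : lincat k).
Implicit Types X Y Z W : L.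

Definition dec_over X (J : finType) (Y : J -> L) (i : forall j, lhom (Y j) X)
    (p : forall j, lhom X (Y j)) : Prop :=
  [/\ forall j, p j ** i j = lid (Y j), forall j l, j != l -> p l ** i j = 0
    & \sum_j i j ** p j = lid X].

Lemma dec_over_ord X (J : finType) (Y : J -> L) i p : @dec_over X J Y i p ->
  @is_direct_sum (acat L) X #|J| (fun t => Y (enum_val t)).
Proof.
move=> [pi ort tot]; exists (fun t => i (enum_val t)), (fun t => p (enum_val t)).
split=> [t|s t st|/=]; [exact: pi| |].
  by apply: ort; rewrite (inj_eq enum_val_inj).
rewrite -tot (reindex_onto (@enum_val J predT) enum_rank) => [|j _]; last exact: enum_rankK.
by apply: eq_bigl => r; rewrite enum_valK eqxx.
Qed.

Lemma dec_over_card n X (J : finType) (Y : J -> L) i p : #|J| = n -> @dec_over X J Y i p ->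
  exists Y' : 'I_n -> L, @is_direct_sum (acat L) X n Y' /\ forall j, exists t, Y' j = Y t.
Proof.
move=> <- d; exists (fun t => Y (enum_val t)); split; first exact: dec_over_ord d.
by move=> j; exists (enum_val j).
Qed.

Lemma is_zeroP X : @is_zero (acat L) X <-> lid X = 0. Proof. by []. Qed.

Lemma liso_id X : liso (lid X). Proof. by exists (lid X); rewrite !lcomp1f. Qed.
Lemma liso_comp X Y Z (g : lhom Y Z) (f : lhom X Y) : liso g -> liso f -> liso (g ** f).
Proof.
move=> [g' [g'g gg']] [f' [f'f ff']]; exists (f' ** g'); split.
  by rewrite lcompA -(lcompA f') g'g lcompf1.
by rewrite lcompA -(lcompA g) ff' lcompf1.
Qed.
Hypothesis spl : splits_idem L.

Lemma split_idem X (e : lhom X X) : e ** e = e ->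
  exists Y0 Y1 (i0 : lhom Y0 X) (p0 : lhom X Y0) (i1 : lhom Y1 X) (p1 : lhom X Y1),
    [/\ [/\ p0 ** i0 = lid Y0, p1 ** i1 = lid Y1, i0 ** p0 = e & i1 ** p1 = lid X - e],
      p1 ** i0 = 0 & p0 ** i1 = 0].
Proof.
move=> ee; have [Y0 [i0 [p0 [pi0 ip0]]]] := spl ee.
have [Y1 [i1 [p1 [pi1 ip1]]]] := spl (compl_idem ee).
exists Y0, Y1, i0, p0, i1, p1; split=> //.
  rewrite -[p1]lcomp1f -pi1 -[i0]lcompf1 -pi0 -!lcompA (lcompA i1) ip1 (lcompA i0) ip0.
  by rewrite (lcompA (lid X - e)) lcompBl lcomp1f ee subrr lcomp0f lcompf0.
rewrite -[p0]lcomp1f -pi0 -[i1]lcompf1 -pi1 -!lcompA (lcompA i0) ip0 (lcompA i1) ip1.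
by rewrite (lcompA e) lcompBr lcompf1 ee subrr lcomp0f lcompf0.
Qed.

Lemma indec_idem X (e : lhom X X) : lindec L X -> e ** e = e -> e = 0 \/ e = lid X.
Proof.
move=> [_ iX] ee.
have [Y0 [Y1 [i0 [p0 [i1 [p1 [[pi0 pi1 ip0 ip1] p1i0 p0i1]]]]]]] := split_idem ee.
have e0 Y (i : lhom Y X) (p : lhom X Y) : lid Y = 0 -> i ** p = 0.
  by move=> Y0'; rewrite -[p]lcomp1f Y0' lcomp0f lcompf0.
pose Y (b : bool) := if b then Y0 else Y1.
pose i (b : bool) : lhom (Y b) X := match b with true => i0 | false => i1 end.
pose p (b : bool) : lhom X (Y b) := match b with true => p0 | false => p1 end.
have dY : @dec_over X _ Y i p.
  split=> [[]//|[] [] //|]; by rewrite big_bool /= ip0 ip1 addrC subrK.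
have [Y' [/iX [j +] yY]] := dec_over_card card_bool dY.
have [b ->] := yY j; rewrite is_zeroP.
case: b => /= z; first by left; rewrite -ip0 e0.
by right; apply/esym/subr0_eq; rewrite -ip1 e0.
Qed.

Lemma idem_indec X : lid X <> 0 -> (forall e : lhom X X, e ** e = e -> e = 0 \/ e = lid X) ->
  lindec L X.
Proof.
move=> X0 h; split=> // Y [i [p [/= pi ort tot]]].
have [|e|e] := h (i ord0 ** p ord0).
- by rewrite lcompA -(lcompA (i _)) pi lcompf1.
- exists ord0; apply/is_zeroP.
  by rewrite -(pi ord0) -[p _]lcomp1f -(pi ord0) -!lcompA (lcompA (i _)) e lcomp0f lcompf0.
- exists ord_max; apply/is_zeroP; rewrite -(pi ord_max) -[p ord_max]lcompf1 -e lcompA.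
  by rewrite (ort ord0 ord_max) // !lcomp0f.
Qed.

Lemma indec_fitting X (u : lhom X X) : lindec L X -> liso u \/ exists r, lpow u r = 0.
Proof.
move=> iX; have [e [v [r [ee vu uv ur]]]] := fitting u.
have [e0|e1] := indec_idem iX ee; first by right; exists r; rewrite -ur e0 lcompf0.
by left; exists v; rewrite vu uv e1.
Qed.

Lemma lpow_retr X (u r : lhom X X) n : r ** u = lid X -> lpow u n = 0 -> lid X = 0.
Proof.
move=> ru; elim: n => [//|n IH] e; apply: IH.
by rewrite -[lpow u n]lcomp1f -ru -lcompA -lpowS e lcompf0.
Qed.

(** Geometric series. *)
Lemma nil_one_sub X (u : lhom X X) r : lpow u r = 0 -> liso (lid X - u).
Proof.
move=> ur; pose s := \sum_(j < r) lpow u j.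
have us : u ** s = s ** u.
  rewrite /s lcomp_sumr lcomp_suml; apply: eq_bigr => j _; exact: lpow_comm.
have e : (lid X - u) ** s = lid X.
  rewrite lcompBl lcomp1f /s lcomp_sumr; clear s us.
  case: r ur => [|r] ur.
    by rewrite !big_ord0 subrr; apply/esym.
  by rewrite big_ord_recl /= [X in _ - X]big_ord_recr /= -lpowS ur addr0 addrK.
by exists s; split=> //; rewrite lcompBr lcompf1 -us -e lcompBl lcomp1f.
Qed.

Lemma indec_split_mono X (u r : lhom X X) : lindec L X -> r ** u = lid X -> liso u.
Proof.
move=> iX ru; have [//|[n un]] := indec_fitting u iX.
by case: (iX) => X0 _; case: X0; apply: lpow_retr ru un.
Qed.

Lemma indec_nonzero X : lindec L X -> lid X <> 0. Proof. by case. Qed.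

Lemma indec_split_epi X (u r : lhom X X) : lindec L X -> u ** r = lid X -> liso u.
Proof.
move=> iX ur; have [r' [r'r rr']] := indec_split_mono iX ur.
exists r; split=> //; suff -> : u = r' by [].
by rewrite -[u]lcompf1 -rr' lcompA ur lcomp1f.
Qed.

Lemma indec_liso_compl X (u v : lhom X X) : lindec L X -> liso (u ** v) -> liso u /\ liso v.
Proof.
move=> iX [w [wuv uvw]]; split.
  by apply: (@indec_split_epi _ _ (v ** w)); rewrite // lcompA.
by apply: (@indec_split_mono _ _ (w ** u)); rewrite // -lcompA.
Qed.

(** The endomorphism ring of an indecomposable object is local. *)
Lemma indec_liso_add X (u v : lhom X X) : lindec L X -> liso (u + v) -> liso u \/ liso v.
Proof.
move=> iX [w [wuv uvw]].
have [wu|[r wu]] := indec_fitting (w ** u) iX.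
  by left; case: (indec_liso_compl iX wu).
right; have := nil_one_sub wu; rewrite -wuv -lcompBr addrC addKr.
by case/(indec_liso_compl iX).
Qed.

Lemma indec_liso_sum X T (s : seq T) (P : pred T) (u : T -> lhom X X) : lindec L X ->
  liso (\sum_(t <- s | P t) u t) -> exists2 t, P t & liso (u t).
Proof.
move=> iX; elim: s => [|t s IH].
  rewrite big_nil => -[w [e _]]; case: (indec_nonzero iX).
  by rewrite -e lcompf0.
rewrite big_cons; case: ifP => [Pt|_]; last exact: IH.
by case/(indec_liso_add iX) => [|/IH //]; exists t.
Qed.

(** The idempotent f (r f)^-1 r of Y is not zero, hence it is the identity. *)
Lemma retract_indec X Y (f : lhom X Y) (r : lhom Y X) :
  lid X <> 0 -> lindec L Y -> liso (r ** f) -> liso f /\ liso r.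
Proof.
move=> X0 iY [g [grf rfg]].
have [|e|e] := @indec_idem Y (f ** g ** r) iY.
- by rewrite -!lcompA !(lcompA r) (lcompA (r ** f)) rfg lcomp1f.
- case: X0; rewrite -grf -[r ** f]lcomp1f -rfg -!lcompA (lcompA f g) (lcompA (f ** g)) e.
  by rewrite lcomp0f !lcompf0.
split; first by exists (g ** r); rewrite -lcompA grf lcompA e.
by exists (f ** g); rewrite e lcompA rfg.
Qed.

(** A nontrivial idempotent splits X into two proper retracts, whose
endomorphism rings need fewer generators. *)
Lemma decomposition X : exists n (Y : 'I_n -> L),
  @is_direct_sum (acat L) X n Y /\ forall j, lindec L (Y j).
Proof.
suff [J [Y [i [p [d iY]]]]] : exists (J : finType) (Y : J -> L) i p,
    @dec_over X _ Y i p /\ forall j, lindec L (Y j).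
  exists #|J|, (fun t => Y (enum_val t)); split=> //; exact: dec_over_ord d.
have [n] := spanned_ex X; have [m] := ubnP n.
elim: m => // m IH in n X * => nm spX.
have [X0|X0] := pselect (lid X = 0).
  exists void, (fun=> X), (fun=> 0), (fun=> 0).
  by split=> [|[]]; split=> [[]|[]|]; rewrite big_pred0 // X0.
have [h|/existsNP[e /not_implyP[ee /not_orP[e0 e1]]]] :=
  pselect (forall e : lhom X X, e ** e = e -> e = 0 \/ e = lid X).
  exists unit, (fun=> X), (fun=> lid X), (fun=> lid X); split=> [|_]; last exact: idem_indec.
  split=> [j|[] []//|]; first exact: lcomp1f.
  by rewrite (big_pred1 tt) => [|[]//]; apply: lcomp1f.
have [Y0 [Y1 [i0 [p0 [i1 [p1 [[pi0 pi1 ip0 ip1] p1i0 p0i1]]]]]]] := split_idem ee.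
have [n0 en0 sp0] : exists2 n0, n = n0.+1 & spanned n0 Y0.
  by apply: spanned_proper_retract pi0 _ spX; rewrite ip0.
have [n1 en1 sp1] : exists2 n0, n = n0.+1 & spanned n0 Y1.
  apply: spanned_proper_retract pi1 _ spX; rewrite ip1 => h; apply: e0.
  by rewrite -[e](subKr (lid X)) h subrr.
have [|J0 [Z0 [a0 [b0 [[ba0 ort0 tot0] iZ0]]]]] := IH n0 Y0 _ sp0; first by rewrite -ltnS -en0.
have [|J1 [Z1 [a1 [b1 [[ba1 ort1 tot1] iZ1]]]]] := IH n1 Y1 _ sp1; first by rewrite -ltnS -en1.
pose Y (j : J0 + J1) := match j with inl a => Z0 a | inr b => Z1 b end.
pose i (j : J0 + J1) : lhom (Y j) X :=
  match j with inl a => i0 ** a0 a | inr b => i1 ** a1 b end.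
pose p (j : J0 + J1) : lhom X (Y j) :=
  match j with inl a => b0 a ** p0 | inr b => b1 b ** p1 end.
exists (J0 + J1)%type, Y, i, p.
split=> [|[a|b]]; [|exact: iZ0|exact: iZ1].
split=> [[a|b]|[a|b] [c|d]|] /=.
- by rewrite lcompA -(lcompA (b0 a)) pi0 lcompf1.
- by rewrite lcompA -(lcompA (b1 b)) pi1 lcompf1.
- by rewrite (inj_eq (@inl_inj _ _)) => ac; rewrite lcompA -(lcompA (b0 c)) pi0 lcompf1 ort0.
- by rewrite lcompA -(lcompA (b1 d)) p1i0 lcompf0 lcomp0f.
- by rewrite lcompA -(lcompA (b0 c)) p0i1 lcompf0 lcomp0f.
- by rewrite (inj_eq (@inr_inj _ _)) => ac; rewrite lcompA -(lcompA (b1 d)) pi1 lcompf1 ort1.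
rewrite big_sumType /=.
under eq_bigr do rewrite lcompA -(lcompA i0).
under [X in _ + X]eq_bigr do rewrite lcompA -(lcompA i1).
rewrite -!lcomp_suml -!lcomp_sumr tot0 tot1 !lcompf1 ip0 ip1.
by rewrite addrC subrK.
Qed.

End KrullSchmidt.

(** * Exact categories that can be knitted *)

Definition sesT (k : fieldType) (L : lincat k) :=
  forall X Y Z : L, lhom X Y -> lhom Y Z -> Prop.
Definition exc (k : fieldType) (L : lincat k) (S : sesT L) : excat := @ExCat (acat L) S.

Notation smono L := (@split_mono (acat L) _ _).
Notation sepi L := (@split_epi (acat L) _ _).
Notation ras L := (@right_almost_split (acat L) _ _).
Notation las L := (@left_almost_split (acat L) _ _).
Notation rmin L := (@right_minimal (acat L) _ _).
Notation lmin L := (@left_minimal (acat L) _ _).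

(** Together with Krull-Schmidt decompositions, this is all that knitting uses.
The axioms come in dual pairs.  By [ex_cover] a map through which a cover
factors is a deflation, and this turns an almost split map into an almost split
sequence. *)
Record exactness (k : fieldType) (L : lincat k) (S : sesT L) : Prop := Exactness {
  ex_zero : forall X Y Z (f : lhom X Y) (g : lhom Y Z), S X Y Z f g -> g ** f = 0;
  ex_mono : forall X Y Z (f : lhom X Y) (g : lhom Y Z), S X Y Z f g ->
    forall W (h : lhom W X), f ** h = 0 -> h = 0;
  ex_epi : forall X Y Z (f : lhom X Y) (g : lhom Y Z), S X Y Z f g ->
    forall W (h : lhom Z W), h ** g = 0 -> h = 0;
  ex_ker : forall X Y Z (f : lhom X Y) (g : lhom Y Z), S X Y Z f g ->
    forall W (h : lhom W Y), g ** h = 0 -> exists h', f ** h' = h;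
  ex_coker : forall X Y Z (f : lhom X Y) (g : lhom Y Z), S X Y Z f g ->
    forall W (h : lhom Y W), h ** f = 0 -> exists h', h' ** g = h;
  ex_push : forall X Y Z (f : lhom X Y) (g : lhom Y Z), S X Y Z f g ->
    forall W (h : lhom X W), exists E (f' : lhom W E) (h' : lhom Y E) (g' : lhom E Z),
      [/\ S W E Z f' g', h' ** f = f' ** h & g' ** h' = g];
  ex_pull : forall X Y Z (f : lhom X Y) (g : lhom Y Z), S X Y Z f g ->
    forall W (h : lhom W Z), exists E (f' : lhom X E) (h' : lhom E Y) (g' : lhom E W),
      [/\ S X E W f' g', g ** h' = h ** g' & h' ** f' = f];
  ex_cover : forall Z, exists P (p : lhom P Z), @projective_obj (exc S) P /\
    forall E (g : lhom E Z) p', g ** p' = p -> exists X f, S X E Z f g;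
  ex_hull : forall X, exists J (j : lhom X J), @injective_obj (exc S) J /\
    forall E (f : lhom X E) j', j' ** f = j -> exists Z g, S X E Z f g;
  ex_ras : forall Z, lindec L Z -> ~ @projective_obj (exc S) Z ->
    exists E (g : lhom E Z), ras L g;
  ex_las : forall X, lindec L X -> ~ @injective_obj (exc S) X ->
    exists E (f : lhom X E), las L f;
  ex_noirr : forall V W (f : lhom V W), lindec L V -> lindec L W ->
    @injective_obj (exc S) V -> @projective_obj (exc S) W -> ~ @irreducible (acat L) V W f
}.

Section Opposite.
Variables (k : fieldType) (L : lincat k) (S : sesT L).

Definition opS : sesT (opL L) := fun X Y Z f g => S g f.

Lemma op_splits : splits_idem L -> splits_idem (opL L).
Proof. by move=> s X e /s [Y [i [p [pi ip]]]]; exists Y, p, i. Qed.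

Lemma op_direct_sum X n (Y : 'I_n -> L) :
  @is_direct_sum (acat (opL L)) X n Y <-> @is_direct_sum (acat L) X n Y.
Proof.
by split=> -[i [p [pi ort tot]]]; exists p, i; split=> // j l jl; apply: ort; rewrite eq_sym.
Qed.

Lemma op_indec X : lindec (opL L) X <-> lindec L X.
Proof. by split=> -[X0 h]; split=> // Y /op_direct_sum/h. Qed.

Lemma op_proj P : @projective_obj (exc opS) P <-> @injective_obj (exc S) P.
Proof.
split=> h X Y Z f g s u; have [v e] := h Z Y X g f s u; by exists v.
Qed.

Lemma op_inj P : @injective_obj (exc opS) P <-> @projective_obj (exc S) P.
Proof.
split=> h X Y Z f g s u; have [v e] := h Z Y X g f s u; by exists v.
Qed.

Lemma op_irr (X Y : L) (f : lhom X Y) :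
  @irreducible (acat (opL L)) Y X f <-> @irreducible (acat L) X Y f.
Proof.
split=> -[a b h]; split=> // W u v e; have := h W v u e; by rewrite or_comm.
Qed.

Lemma op_arrow X Y : @ar_arrow (acat (opL L)) Y X <-> @ar_arrow (acat L) X Y.
Proof.
split=> -[iY iX [f irr]]; split; try exact/op_indec; by exists f; apply/op_irr.
Qed.

Lemma op_isom X Y : @isomorphic (acat (opL L)) X Y <-> @isomorphic (acat L) X Y.
Proof. by split=> -[f [g [gf fg]]]; exists g, f. Qed.

Lemma op_mesh X n (Y : 'I_n -> L) Z :
  @ar_mesh (exc opS) Z n Y X <-> @ar_mesh (exc S) X n Y Z.
Proof.
split=> -[E [f [g [[s [a b c d]] dE iY]]]]; exists E, g, f.
  split; [split; [exact: s|]|exact/op_direct_sum|by move=> j; apply/op_indec].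
  by split; [exact: c|move=> u /d[v []]; exists v|exact: a|move=> u /b[v []]; exists v].
split; [split; [exact: s|]|exact/op_direct_sum|by move=> j; apply/op_indec].
by split; [exact: c|move=> u /d[v []]; exists v|exact: a|move=> u /b[v []]; exists v].
Qed.

Lemma op_exactness : exactness S -> exactness opS.
Proof.
move=> h; split=> //.
- by move=> X Y Z f g; apply: (ex_zero h).
- by move=> X Y Z f g; apply: (ex_epi h).
- by move=> X Y Z f g; apply: (ex_mono h).
- by move=> X Y Z f g; apply: (ex_coker h).
- by move=> X Y Z f g; apply: (ex_ker h).
- move=> X Y Z f g s W u; have [E [f' [h' [g' [s' e1 e2]]]]] := ex_pull h s u.
  by exists E, g', h', f'.
- move=> X Y Z f g s W u; have [E [f' [h' [g' [s' e1 e2]]]]] := ex_push h s u.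
  by exists E, g', h', f'.
- move=> Z; have [J [j [iJ hj]]] := ex_hull h Z; exists J, j; split; first exact/op_proj.
  by move=> E g p' /hj [Z' [g' s]]; exists Z', g'.
- move=> Z; have [J [j [iJ hj]]] := ex_cover h Z; exists J, j; split; first exact/op_inj.
  by move=> E g p' /hj [Z' [g' s]]; exists Z', g'.
- move=> Z /op_indec iZ nZ; have [|E [g gP]] := ex_las h iZ; last by exists E, g.
  by move/op_proj.
- move=> Z /op_indec iZ nZ; have [|E [g gP]] := ex_ras h iZ; last by exists E, g.
  by move/op_inj.
move=> V W f /op_indec iV /op_indec iW /op_inj jV /op_proj pW /op_irr.
exact: (ex_noirr h).
Qed.

End Opposite.

Section RightAlmostSplit.
Variables (k : fieldType) (L : lincat k).
Hypothesis spl : splits_idem L.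
Implicit Types X Y Z E W : L.

(** An idempotent e of Z and its complement cannot both lift to E, for then the
identity would; the one that does not lift is a split epimorphism, hence 1. *)
Lemma ras_indec E Z (g : lhom E Z) : ras L g -> lindec L Z.
Proof.
move=> [ns lift]; apply: idem_indec => [Z0|e ee].
  by apply: ns; exists 0; rewrite /= lcompf0 Z0.
apply/or_asboolP/negPn/negP; rewrite negb_or => /andP[/asboolPn e0 /asboolPn e1].
have [|h gh] := lift Z e.
  by move=> [s /= es]; apply: e1; rewrite -[LHS]lcompf1 -es lcompA ee.
have [|h' gh'] := lift Z (lid Z - e).
  move=> [s /= es]; apply: e0.
  suff e1' : lid Z - e = lid Z by rewrite -[e](subKr (lid Z)) e1' subrr.
  by have := congr1 (lcomp (lid Z - e)) es; rewrite lcompA (compl_idem ee) es lcompf1.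
by apply: ns; exists (h + h'); rewrite /= lcompDr; move: gh gh' => /= -> ->; rewrite addrC subrK.
Qed.

(** Take E with the fewest generators of End E.  If g u = g then g e = g for the
Fitting idempotent e of u, and the image of e would be a smaller choice unless
e = 1. *)
Lemma ras_minimal E Z (g : lhom E Z) : ras L g ->
  exists E' (g' : lhom E' Z) (i : lhom E' E), [/\ ras L g', rmin L g' & g' = g ** i /\ exists p, g = g' ** p].
Proof.
move=> gr; pose P n := exists E' (g' : lhom E' Z) (i : lhom E' E),
  [/\ ras L g', spanned n E' & g' = g ** i /\ exists p, g = g' ** p].
have exP : exists n, `[< P n >].
  have [n spn] := spanned_ex E; exists n; apply/asboolP; exists E, g, (lid E).
  by split=> //; rewrite lcompf1; split=> //; exists (lid E); rewrite lcompf1.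
case: (ex_minnP exP) => n /asboolP[E' [g' [i [rg' spn [gi [q gq]]]]]] nmin.
exists E', g', i; split=> //; last by split=> //; exists q.
move=> u /= gu; have [e [v [r [ee vu uv ur]]]] := fitting u.
have gur j : g' ** lpow u j = g'.
  by elim: j => [|j IH]; rewrite ?lcompf1 // lpowS lcompA gu.
have ge : g' ** e = g' by rewrite -{1}(gur r) -lcompA ur gur.
have [e1|e1] := pselect (e = lid E'); first by exists v; rewrite /= vu uv e1.
have [Y [a [b [ba ab]]]] := spl ee.
have [|n' en spn'] := spanned_proper_retract ba _ spn; first by rewrite ab.
have : `[< P n' >].
  apply/asboolP; exists Y, (g' ** a), (i ** a); split=> //.
    case: rg' => ns lift; split.
      by move=> [s /= gas]; apply: ns; exists (a ** s); rewrite /= lcompA.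
    move=> W h /lift[h' /= e']; exists (b ** h').
    by rewrite /= -lcompA (lcompA a) ab lcompA ge.
  rewrite gi lcompA; split=> //; exists (b ** q).
  by rewrite -gi -lcompA (lcompA a) ab lcompA ge.
by move/nmin; rewrite en ltnn.
Qed.

End RightAlmostSplit.

Section Mesh.
Variables (k : fieldType) (L : lincat k) (S : sesT L).
Hypotheses (spl : splits_idem L).
Implicit Types X Y Z E W V : L.

Hypothesis exS : exactness S.

Lemma split_ses X E Z (f : lhom X E) (g : lhom E Z) : S f g -> smono L f <-> sepi L g.
Proof.
move=> s; split=> -[r /= e].
  have [|h hg] := ex_coker exS s (h := lid E - f ** r).
    by rewrite lcompBl lcomp1f -lcompA e lcompf1 subrr.
  exists h; apply/subr0_eq/(ex_epi exS s); rewrite /= lcompBl lcomp1f -lcompA hg.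
  by rewrite lcompBr lcompf1 lcompA (ex_zero exS s) lcomp0f subr0 subrr.
have [|h fh] := ex_ker exS s (h := lid E - r ** g).
  by rewrite lcompBr lcompf1 lcompA e lcomp1f subrr.
exists h; apply/subr0_eq/(ex_mono exS s); rewrite /= lcompBr lcompf1 lcompA fh.
by rewrite lcompBl lcomp1f -lcompA (ex_zero exS s) lcompf0 subr0 subrr.
Qed.

(** An endomorphism u of the middle term with u f = f induces v on Z.  If v were
nilpotent, a power of u would map into X and split f.  Otherwise v is
invertible; then 1 - e, for the Fitting idempotent e of u, kills f and maps
into X, so that it has square zero and vanishes. *)
Lemma ses_lmin X E Z (f : lhom X E) (g : lhom E Z) :
  S f g -> ~ smono L f -> lindec L Z -> lmin L f.
Proof.
move=> s ns iZ u /= uf.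
have [|v vg] := ex_coker exS s (h := g ** u).
  by rewrite -lcompA uf (ex_zero exS s).
have fn n : lpow u n ** f = f.
  by elim: n => [|n IH]; rewrite ?lcomp1f // lpowS -lcompA IH.
have gn n : g ** lpow u n = lpow v n ** g.
  by elim: n => [|n IH]; rewrite ?lcompf1 ?lcomp1f // !lpowS lcompA -vg -lcompA IH lcompA.
have [[w [wv vw]]|[n vn]] := indec_fitting spl v iZ; last first.
  case: ns; have [|r fr] := ex_ker exS s (h := lpow u n); first by rewrite gn vn lcomp0f.
  exists r; apply/subr0_eq/(ex_mono exS s).
  by rewrite /= lcompBr lcompf1 lcompA fr fn subrr.
have [e [u' [r [ee u'u uu' ur]]]] := fitting u.
have ef : e ** f = f.
  have : f = lpow u r ** (e ** f) by rewrite lcompA ur fn.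
  have eu : forall j, lpow u j ** e = e ** lpow u j.
    by move=> j; apply/esym/lpow_comm; rewrite -{1}uu' -lcompA u'u.
  by rewrite lcompA eu -lcompA fn => {2}->.
have [|z zg] := ex_coker exS s (h := lid E - e).
  by rewrite lcompBl lcomp1f ef subrr.
have z0 : (lid E - e) = 0.
  have vr : lpow v r ** (g ** (lid E - e)) = 0.
    by rewrite lcompA -gn -lcompA lcompBr lcompf1 ur subrr lcompf0.
  have vinj j W (x : lhom W Z) : lpow v j ** x = 0 -> x = 0.
    elim: j => [|j IH]; first by rewrite lcomp1f.
    rewrite lpowS -lcompA => h; apply: IH.
    by rewrite -[LHS]lcomp1f -wv -lcompA h lcompf0.
  have ge := vinj _ _ _ vr.
  have [t ft] := ex_ker exS s ge.
  have : (lid E - e) ** (lid E - e) = 0.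
    by rewrite -{2}ft lcompA lcompBl lcomp1f ef subrr lcomp0f.
  by rewrite lcompBl lcomp1f lcompBr lcompf1 ee subrr subr0.
by exists u'; rewrite /= u'u uu'; move/subr0_eq: z0 => <-.
Qed.

(** Let g' be the deflation pushed out along h.  If g' does not split it factors
through the almost split g; by minimality the composite endomorphism of E is
invertible, and this splits h. *)
Lemma ras_las X E Z (f : lhom X E) (g : lhom E Z) :
  S f g -> ras L g -> rmin L g -> las L f.
Proof.
move=> s rg mg; split; first by move/(split_ses s); case: rg.
move=> W h nh; have [E' [f' [h' [g' [s' e1 e2]]]]] := ex_push exS s h.
have [sp|nsp] := pselect (sepi L g').
  have [r /= rf] := (split_ses s').2 sp.
  by exists (r ** h'); rewrite /= -lcompA e1 lcompA rf lcomp1f.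
case: nh; case: rg => _ /(_ _ _ nsp) [v /= gv].
have [|w fw] := ex_ker exS s (h := v ** f').
  by rewrite lcompA gv (ex_zero exS s').
have [|u [/= u1 u2]] := mg (v ** h'); first by rewrite /= lcompA gv e2.
have gu : g ** u = g by rewrite -{1}e2 -gv -!lcompA (lcompA v) u2 lcompf1.
have uf : v ** h' ** f = f ** (w ** h) by rewrite -lcompA e1 !lcompA fw.
have [|f2 ff2] := ex_ker exS s (h := u ** f); first by rewrite lcompA gu (ex_zero exS s).
exists (f2 ** w); apply/subr0_eq/(ex_mono exS s); rewrite /= lcompBr lcompf1.
by rewrite -lcompA lcompA ff2 -lcompA -uf lcompA u1 lcomp1f subrr.
Qed.

(** A cover of Z does not split, hence it factors through the minimal right
almost split map onto Z, which is therefore a deflation. *)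
Lemma mesh_end Z : lindec L Z -> ~ @projective_obj (exc S) Z ->
  exists X n (Y : 'I_n -> L), @ar_mesh (exc S) X n Y Z.
Proof.
move=> iZ nZ; have [E0 [g0 /ras_minimal]] := ex_ras exS iZ nZ.
case/(_ spl) => E [g [_ [rg mg _]]].
have [P [p [pP pg]]] := ex_cover exS Z.
have np : ~ sepi L p.
  move=> [s /= ps]; apply: nZ => A B C f h ses u.
  have [v e] := pP _ _ _ _ _ ses (u ** p); exists (v ** s).
  by move: e => /= e; rewrite /= lcompA e -lcompA ps lcompf1.
have [p' gp] := rg.2 _ _ np.
have [X [f s]] := pg _ _ _ gp.
have [n [Y [dE iY]]] := decomposition spl E.
exists X, n, Y, E, f, g; split=> //; split=> //.
have lf := ras_las s rg mg.
by split=> //; apply: ses_lmin s lf.1 iZ.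
Qed.

Lemma isom_liso X Y : @isomorphic (acat L) X Y <-> exists f : lhom X Y, liso f.
Proof. by []. Qed.

Lemma irr_liso V X Y (h : lhom X Y) (f : lhom V X) : liso h ->
  @irreducible (acat L) V X f -> @irreducible (acat L) V Y (h ** f).
Proof.
move=> [h' [h'h hh']] [nm ne fac]; split.
- by move=> [r /= e]; apply: nm; exists (r ** h); rewrite /= -lcompA.
- move=> [s /= e]; apply: ne; exists (s ** h); rewrite /=.
  have -> : f ** (s ** h) = h' ** (h ** f ** s) ** h by rewrite !lcompA h'h lcomp1f.
  by rewrite e lcompf1.
move=> W a b /= e; have [||[s /= bs]] := fac W a (h' ** b); last first.
- right; exists (s ** h'); rewrite /= lcompA.
  have -> : b ** s ** h' = h ** (h' ** b ** s) ** h' by rewrite !lcompA hh' lcomp1f.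
  by rewrite bs lcompf1.
- by left.
by rewrite /= -lcompA e lcompA h'h lcomp1f.
Qed.

(** By minimality the components of f on the indecomposable summands of E are
irreducible.  Conversely, an irreducible map from X factors through f by a
split epimorphism from E onto W, and W is one of the summands. *)
Lemma mesh_arrows X n (Y : 'I_n -> L) Z W : @ar_mesh (exc S) X n Y Z ->
  lindec L X -> @ar_arrow (acat L) X W <-> exists j, @isomorphic (acat L) W (Y j).
Proof.
move=> [E [f [g [[s [lf mf rg mg]] dE iY]]]] iX.
have [i [p [/= pi ort tot]]] := dE.
have irr j : @irreducible (acat L) X (Y j) (p j ** f).
  have nm : ~ smono L (p j ** f).
    by move=> [r /= e]; apply: lf.1; exists (r ** p j); rewrite /= -lcompA.
  split=> //.
    move=> [t /= e]; apply: nm.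
    have [|_ [r [rpf _]]] := retract_indec spl (indec_nonzero (iY j)) iX (f := t) (r := p j ** f).
      by rewrite e; apply: liso_id.
    by exists r.
  move=> V a b /= e; have [sa|na] := pselect (smono L a); [by left|right].
  have [a' /= ea] := lf.2 _ _ na.
  have [|u [/= u1 u2]] := mf (lid E - i j ** (p j - b ** a')).
    by rewrite /= lcompBl lcomp1f -lcompA lcompBl -(lcompA b) ea e subrr lcompf0 subr0.
  exists (a' ** u ** i j); rewrite /= -(pi j) -{2}[i j]lcomp1f -u2 !lcompA.
  congr (_ ** _ ** _).
  by rewrite lcompBr lcompf1 lcompA pi lcomp1f subKr.
split=> [[_ iW [h [nm ne fac]]]|[j [h [h' [/= h'h hh']]]]].
  have [h' /= eh] := lf.2 _ _ nm.
  have [/lf.1 //|[t /= ht]] := fac _ _ _ eh.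
  have : liso (\sum_(j < n) (h' ** i j) ** (p j ** t)).
    have -> : \sum_(j < n) (h' ** i j) ** (p j ** t) = lid W; last exact: liso_id.
    under eq_bigr do rewrite lcompA -(lcompA h').
    by rewrite -lcomp_suml -lcomp_sumr tot lcompf1.
  case/(indec_liso_sum spl iW) => j _ lj.
  exists j; apply/isom_liso; exists (p j ** t).
  by case: (retract_indec spl (indec_nonzero iW) (iY j) lj).
split=> //.
  have eW : lid W <> 0.
    move=> W0; case: (iY j) => + _; apply; apply/is_zeroP.
    by rewrite -hh' -[h]lcompf1 W0 lcompf0 lcomp0f.
  apply: idem_indec => // e ee.
  have [||] := @indec_idem _ _ spl _ (h ** e ** h') (iY j).
  - by rewrite -(lcompA (h ** e)) !(lcompA h') h'h lcomp1f lcompA -(lcompA h e e) ee.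
  - move=> e0; left; have : h' ** (h ** e ** h') ** h = 0 by rewrite e0 lcompf0 lcomp0f.
    by rewrite !lcompA h'h lcomp1f -lcompA h'h lcompf1.
  move=> e0; right; have : h' ** (h ** e ** h') ** h = lid W by rewrite e0 lcompf1.
  by rewrite !lcompA h'h lcomp1f -lcompA h'h lcompf1.
exists (h' ** (p j ** f)); apply: irr_liso; last exact: irr.
by exists h.
Qed.

Lemma mesh_indec X n (Y : 'I_n -> L) Z : @ar_mesh (exc S) X n Y Z -> lindec L Z.
Proof. by move=> [E [f [g [[s [lf mf rg mg]] dE iY]]]]; apply: ras_indec rg. Qed.

End Mesh.

Section Knitting.
Variables (k : fieldType) (L : lincat k) (S : sesT L).
Hypotheses (spl : splits_idem L) (exS : exactness S).

(** An arrow V -> W belongs to the mesh that ends at W or to the mesh that starts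
at V, unless W is projective and V injective; [ex_noirr] excludes the latter. *)
Theorem exactness_knittable : knittable (exc S).
Proof.
have spl' := op_splits spl; have exS' := op_exactness exS.
have startP (X : L) : lindec L X -> ~ @injective_obj (exc S) X ->
    exists Z n (Y : 'I_n -> L), @ar_mesh (exc S) X n Y Z.
  move=> iX nX; have [||Z [n [Y m]]] := @mesh_end _ _ (@opS k L S) spl' exS' X.
  - exact/op_indec.
  - by move/op_proj.
  by exists Z, n, Y; apply/op_mesh.
have arr X n (Y : 'I_n -> L) Z (W : L) : @ar_mesh (exc S) X n Y Z ->
    (@ar_arrow (acat L) X W <-> exists j, @isomorphic (acat L) W (Y j)) /\
    (@ar_arrow (acat L) W Z <-> exists j, @isomorphic (acat L) W (Y j)).
  move=> m; have m' := (op_mesh _ _ _).2 m.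
  have iX : lindec L X by exact: ((op_indec X).1 (mesh_indec m')).
  have iZ := mesh_indec m.
  split; first exact: (mesh_arrows spl W m iX).
  rewrite -op_arrow; rewrite (mesh_arrows spl' W m' ((op_indec _).2 iZ)).
  by split=> -[j /op_isom]; exists j.
split=> //; [exact: mesh_end|by move=> X n Y Z m W; apply: arr|].
move=> V W [iV iW [f irr]].
have [pW|nW] := pselect (@projective_obj (exc S) W); last first.
  have [X [n [Y m]]] := mesh_end spl exS iW nW.
  exists X, n, Y, W; split=> //; right; split.
    by exists (lid W), (lid W); rewrite /= lcomp1f.
  by apply/(arr _ _ _ _ _ m).2; split=> //; exists f.
have [jV|nV] := pselect (@injective_obj (exc S) V); last first.
  have [Z [n [Y m]]] := startP V iV nV.
  exists V, n, Y, Z; split=> //; left; split.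
    by exists (lid V), (lid V); rewrite /= lcomp1f.
  by apply/(arr _ _ _ _ _ m).1; split=> //; exists f.
by case: (ex_noirr exS iV iW jV pW irr).
Qed.

End Knitting.

(** * Linear algebra over the base field *)

Section LinearAlgebra.
Variable k : fieldType.

Definition lin_closed (V : lmodType k) (S : V -> Prop) :=
  S 0 /\ forall c x y, S x -> S y -> S (c *: x + y).

Lemma lin_closed_sum (V : lmodType k) (S : V -> Prop) (T : finType) (c : T -> k) (x : T -> V) :
  lin_closed S -> (forall t, S (x t)) -> S (\sum_t c t *: x t).
Proof.
move=> [S0 SD] Sx; apply: big_rec => // t y _ Sy; exact: SD.
Qed.

Lemma subspace_rV n (S : 'rV[k]_n -> Prop) : lin_closed S ->
  exists r (x : 'I_r -> 'rV[k]_n), (forall i, S (x i)) /\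
    forall v, S v -> exists c : 'I_r -> k, v = \sum_i c i *: x i.
Proof.
move=> clS; pose P d := `[< exists B : 'M[k]_n, (forall i, S (row i B)) /\ \rank B = d >].
have exP : exists d, P d.
  exists 0%N; apply/asboolP; exists 0; split; last exact: mxrank0.
  by move=> i; rewrite row0; case: clS.
have Pn d : P d -> (d <= n)%N by move=> /asboolP[B [_ <-]]; exact: rank_leq_row.
case: (ex_maxnP exP Pn) => d /asboolP[B [SB rB]] dmax.
have rowS (w : 'rV_n) : (w <= B)%MS -> S w.
  case/submxP => D ->; rewrite mulmx_sum_row; exact: lin_closed_sum.
exists n, (fun i => row i B); split=> // v Sv.
suff /submxP[D ->] : (v <= B)%MS by exists (D 0); rewrite mulmx_sum_row.
apply/negPn/negP => nvB; pose B' := (B + v)%MS.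
have rB' : (\rank B < \rank B')%N.
  rewrite ltnNge; apply: contra nvB => le; apply: submx_trans (addsmxSr B v) _.
  by rewrite -(geq_leqif (mxrank_leqif_sup (addsmxSl B v))).
have /dmax : P (\rank B'); last by rewrite -rB leqNgt rB'.
apply/asboolP; exists B'; split=> // i.
have : (row i B' <= B + v)%MS by exact: row_sub.
case/sub_addsmxP => -[u1 u2] /= ->.
have -> : u2 *m v = u2 0 0 *: v by rewrite {1}[u2]mx11_scalar mul_scalar_mx.
rewrite addrC; apply: (clS.2) => //; apply: rowS; exact: submxMl.
Qed.

Lemma subspace_fg (V : lmodType k) (S : V -> Prop) : fin_generated V -> lin_closed S ->
  exists r (x : 'I_r -> V), (forall i, S (x i)) /\
    forall v, S v -> exists c : 'I_r -> k, v = \sum_i c i *: x i.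
Proof.
move=> [n [g gP]] [S0 SD].
pose phi (c : 'rV[k]_n) : V := \sum_i c 0 i *: g i.
have phiP a (c d : 'rV_n) : phi (a *: c + d) = a *: phi c + phi d.
  rewrite /phi scaler_sumr -big_split; apply: eq_bigr => i _ /=.
  by rewrite !mxE scalerA scalerDl.
have phi_sum r (c : 'I_r -> k) x : phi (\sum_i c i *: x i) = \sum_i c i *: phi (x i).
  elim/big_rec2: _ => [|i y1 y2 _ <-]; last exact: phiP.
  by rewrite /phi big1 // => i _; rewrite mxE scale0r.
have [|r [x [Sx gen]]] := @subspace_rV n (fun c => S (phi c)).
  split=> [|a c d Sc Sd]; last by rewrite phiP; apply: SD.
  by rewrite /phi big1 // => i _; rewrite mxE scale0r.
exists r, (phi \o x); split=> // v Sv; have [c cP] := gP v.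
have ev : v = phi (\row_i c i) by rewrite cP; apply: eq_bigr => i _; rewrite mxE.
have [|d dP] := gen (\row_i c i); first by rewrite -ev.
by exists d; rewrite ev dP phi_sum.
Qed.

Lemma vect_fg (V : vectType k) : fin_generated V.
Proof.
exists (\dim {:V}), (fun i => (vbasis {:V})`_i) => x.
exists (fun i => coord (vbasis {:V}) i x); apply: coord_vbasis; exact: memvf.
Qed.

Lemma injective_fg (V : lmodType k) n (f : {linear V -> 'rV[k]_n}) :
  injective f -> fin_generated V.
Proof.
move=> fI; have [|r [x [Sx gen]]] := @subspace_rV n (fun c => exists v, f v = c).
  split=> [|a c d [v <-] [w <-]]; first by exists 0; rewrite linear0.
  by exists (a *: v + w); rewrite linearP.
pose v i := sval (cid (Sx i)); have vP i : f (v i) = x i := svalP (cid (Sx i)).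
exists r, v => y; have [|c cP] := gen (f y); first by exists y.
exists c; apply: fI; rewrite cP linear_sum; apply: eq_bigr => i _.
by rewrite linearZ vP.
Qed.

(** A single-valued linear relation is a functional on a subspace.  It is
extended one generator at a time, with value 0 on each new direction. *)
Lemma functional_ext (V : lmodType k) (R : V -> k -> Prop) : fin_generated V ->
  R 0 0 -> (forall c v w a b, R v a -> R w b -> R (c *: v + w) (c * a + b)) ->
  (forall a, R 0 a -> a = 0) ->
  exists f : {linear V -> k^o}, forall v a, R v a -> f v = a.
Proof.
move=> [n [g gP]] R0 RD Rs.
have [R' [[R'0 R'D R's] [RR' tot]]] : exists R' : V -> k -> Prop,
  [/\ R' 0 0, (forall c v w a b, R' v a -> R' w b -> R' (c *: v + w) (c * a + b))
   & (forall a, R' 0 a -> a = 0)] /\ (forall v a, R v a -> R' v a) /\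
   forall x, x \in codom g -> exists a, R' x a.
  elim: (codom g) => [|x s [R' [[R'0 R'D R's] [RR' tot]]]]; first by exists R.
  have [[a Ra]|nR] := pselect (exists a, R' x a).
    exists R'; split=> //; split=> // y; rewrite inE => /orP[/eqP->|/tot //].
    by exists a.
  exists (fun v a => exists c, R' (v - c *: x) a); split; first split.
  - by exists 0; rewrite scale0r subr0.
  - move=> c v w a b [c1 h1] [c2 h2]; exists (c * c1 + c2).
    by have := R'D c _ _ _ _ h1 h2; rewrite scalerBr scalerA addrACA -opprD -scalerDl.
  - move=> a [c]; rewrite sub0r => h; have [c0|c0] := eqVneq c 0.
      by move: h; rewrite c0 scale0r oppr0 => /R's.
    case: nR; exists (- c^-1 * a); have := R'D (- c^-1) _ _ _ _ h R'0.
    by rewrite !addr0 scalerN scaleNr opprK scalerA mulVf // scale1r.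
  split=> [v a /RR' h|y]; first by exists 0; rewrite scale0r subr0.
  rewrite inE => /orP[/eqP->|/tot [a ya]]; last by exists a, 0; rewrite scale0r subr0.
  by exists 0, 1; rewrite scale1r subrr.
have totV v : exists a, R' v a.
  have [c ->] := gP v; elim/big_rec: _ => [|i y _ [a ya]]; first by exists 0.
  by have [|b yb] := tot (g i); [exact: codom_f|exists (c i * b + a); apply: R'D].
pose f v := sval (cid (totV v)); have fP v : R' v (f v) := svalP (cid (totV v)).
have fu v a : R' v a -> f v = a.
  move=> va; have := R'D (-1) _ _ _ _ va (fP v).
  by rewrite scaleN1r addNr => /R's; rewrite mulN1r addrC => /subr0_eq.
have flin : linear (f : V -> k^o).
  by move=> c v w; apply: fu; apply: R'D.
pose F := GRing.isLinear.Build k V k^o _ (f : V -> k^o) flin.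
exists (HB.pack (f : V -> k^o) F : {linear V -> k^o}) => v a /RR'; exact: fu.
Qed.

(** Families of vectors in spaces that vary with the index.  The product is taken
over all of nat, and [gfam_fg] asks the spaces to vanish from B on, so that a
member of a family need never be moved to another degree. *)
Definition gfam (V : nat -> lmodType k) := forall t, V t.

Section Gfam.
Variable V : nat -> lmodType k.
HB.instance Definition _ := gen_eqMixin (gfam V).
HB.instance Definition _ := gen_choiceMixin (gfam V).
Let addA : associative (fun x y : gfam V => (fun t => x t + y t) : gfam V).
Proof. by move=> x y z; apply: functional_extensionality_dep => t; rewrite addrA. Qed.
Let addC : commutative (fun x y : gfam V => (fun t => x t + y t) : gfam V).
Proof. by move=> x y; apply: functional_extensionality_dep => t; rewrite addrC. Qed.
Let add0 : left_id ((fun=> 0) : gfam V) (fun x y : gfam V => (fun t => x t + y t) : gfam V).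
Proof. by move=> x; apply: functional_extensionality_dep => t; rewrite add0r. Qed.
Let addN : left_inverse ((fun=> 0) : gfam V) (fun x : gfam V => (fun t => - x t) : gfam V)
  (fun x y : gfam V => (fun t => x t + y t) : gfam V).
Proof. by move=> x; apply: functional_extensionality_dep => t; rewrite addNr. Qed.
HB.instance Definition _ := GRing.isZmodule.Build (gfam V) addA addC add0 addN.
Let scA a b (x : gfam V) : ((fun t => a *: (b *: x t)) : gfam V) = (fun t => (a * b) *: x t).
Proof. by apply: functional_extensionality_dep => t; rewrite scalerA. Qed.
Let sc1 : left_id 1 (fun a (x : gfam V) => (fun t => a *: x t) : gfam V).
Proof. by move=> x; apply: functional_extensionality_dep => t; rewrite scale1r. Qed.
Let scDr : right_distributive (fun a (x : gfam V) => (fun t => a *: x t) : gfam V) +%R.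
Proof. by move=> a x y; apply: functional_extensionality_dep => t; rewrite [LHS]scalerDr. Qed.
Let scDl (x : gfam V) : {morph (fun a => (fun t => a *: x t) : gfam V) : a b / a + b}.
Proof. by move=> a b; apply: functional_extensionality_dep => t; rewrite [LHS]scalerDl. Qed.
HB.instance Definition _ := GRing.Zmodule_isLmodule.Build k (gfam V) scA sc1 scDr scDl.

Lemma gfamP (x y : gfam V) : (forall t, x t = y t) -> x = y.
Proof. exact: functional_extensionality_dep. Qed.

Lemma gfam_addE (x y : gfam V) t : (x + y) t = x t + y t. Proof. by []. Qed.
Lemma gfam_linE c (x y : gfam V) t : (c *: x + y) t = c *: x t + y t. Proof. by []. Qed.

Lemma gfam_sumE T (r : seq T) (P : pred T) (F : T -> gfam V) t :
  (\sum_(i <- r | P i) F i) t = \sum_(i <- r | P i) F i t.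
Proof. by elim/big_rec2: _ => // i x y _ <-. Qed.

Definition single t (x : V t) : gfam V := @dfwith _ V (fun=> 0) t x.

Lemma single_in t x : @single t x t = x. Proof. exact: dfwith_in. Qed.
Lemma single_out t x t' : t != t' -> @single t x t' = 0. Proof. exact: dfwith_out. Qed.

Lemma single_linear t : linear (@single t).
Proof.
move=> c x y; apply: gfamP => t'; have [<-|n] := eqVneq t t'.
  by rewrite gfam_linE !single_in.
by rewrite gfam_linE !single_out // scaler0 addr0.
Qed.

HB.instance Definition _ t := GRing.isLinear.Build k (V t) (gfam V) _ (@single t) (@single_linear t).

Lemma gfam_fg B : (forall t, fin_generated (V t)) ->
  (forall t, (B <= t)%N -> forall x : V t, x = 0) -> fin_generated (gfam V).
Proof.
move=> fgV V0.
pose n t := sval (cid (fgV t)).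
pose g t : 'I_(n t) -> V t := sval (cid (svalP (cid (fgV t)))).
have gP t : forall x, exists c : 'I_(n t) -> k, x = \sum_i c i *: g t i.
  exact: svalP (cid (svalP (cid (fgV t)))).
pose T := {t : 'I_B & 'I_(n t)}.
pose H (u : T) := single (g _ (tagged u)).
exists #|{: T}|, (fun r => H (enum_val r)) => x.
pose c (t : 'I_B) := sval (cid (gP t (x t))).
have cP (t : 'I_B) : x t = \sum_r c t r *: g _ r := svalP (cid (gP t (x t))).
exists (fun r => c (tag (enum_val r)) (tagged (enum_val r))).
have -> : x = \sum_(t < B) single (x t).
  apply: gfamP => s; rewrite gfam_sumE; have [sB|Bs] := ltnP s B; last first.
    by rewrite (V0 _ Bs (x s)) big1 // => t _; apply: V0.
  rewrite (bigD1 (Ordinal sB)) //= single_in big1 ?addr0 // => t nt.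
  by rewrite single_out.
transitivity (\sum_(t < B) \sum_(r < n t) c t r *: single (g t r)).
  apply: eq_bigr => t _; rewrite cP.
  elim/big_rec2: _ => [|i y1 y2 _ <-]; last exact: single_linear.
  by apply: gfamP => s; have [<-|ne] := eqVneq (t : nat) s; rewrite ?single_in ?single_out.
rewrite (sig_big_dep _ _ (fun (t : 'I_B) r => c t r *: single (g t r))) /=.
rewrite (reindex_onto (@enum_val T predT) enum_rank) => [|u _]; last exact: enum_rankK.
by apply: eq_bigl => r; rewrite enum_valK eqxx.
Qed.
End Gfam.

End LinearAlgebra.

(** * A complex representing a dual *)

(** For projective modules this is the regular module and its powers.  The
definition is self-dual, so that the opposite category has a generator too. *)
Record generator (k : fieldType) (P : lincat k) := Generator {
  gob : P;
  gpow : nat -> P;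
  gin : forall n, nat -> lhom gob (gpow n);
  gpr : forall n, nat -> lhom (gpow n) gob;
  gpr_in : forall n a b, (a < n)%N -> (b < n)%N ->
    gpr n b ** gin n a = if a == b then lid gob else 0;
  gin_pr : forall n, \sum_(a < n) gin n a ** gpr n a = lid (gpow n);
  ggen : forall W : P, exists n (b : 'I_n -> lhom W gob) (a : 'I_n -> lhom gob W),
    \sum_p a p ** b p = lid W
}.

Section Step.
Variables (k : fieldType) (P : lincat k) (G : generator P).
Local Notation g0 := (gob G).

Definition functional (V : lmodType k) := {linear V -> k^o}.

(** The complex Q has in each degree a power of the generator g0, with
differential given by the matrix D; the functionals y a on Hom(Zi, g0) are the
components of a pairing of Hom(Zi, Qi) with k.  The first two clauses say that
the differential squares to zero and that the pairing is closed.  The third is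
exactness: a vector u of maps killed by the differential, together with a
functional yy that matches its pairing, comes from the preceding degree. *)
Definition good_stage (Zi Zj : P) (dl : lhom Zi Zj) (R0 R1 R2 : nat)
    (D0 D1 : nat -> nat -> lhom g0 g0)
    (y0 : nat -> functional (lhom Zi g0)) (y1 : nat -> functional (lhom Zj g0)) : Prop :=
  [/\ forall a c, (a < R0)%N -> (c < R2)%N -> \sum_(b < R1) D1 b c ** D0 a b = 0,
      forall a v, (a < R0)%N -> \sum_(b < R1) y1 b (D0 a b ** v) = - y0 a (v ** dl)
    & forall (u : nat -> lhom g0 g0) (yy : functional (lhom Zi g0)),
        (forall c, (c < R2)%N -> \sum_(b < R1) D1 b c ** u b = 0) ->
        (forall v, \sum_(b < R1) y1 b (u b ** v) = - yy (v ** dl)) ->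
        exists kap : nat -> k,
          (forall b, (b < R1)%N -> \sum_(a < R0) kap a *: D0 a b = u b) /\
          (forall v, \sum_(a < R0) kap a * y0 a v = yy v)].

(** Matrices are functions of natural numbers, so that their sizes may vary with
the degree; the default value is taken outside the range only. *)
Definition extend (T : Type) (x0 : T) n (f : 'I_n -> T) (a : nat) : T :=
  if insub a is Some a' then f a' else x0.

Lemma extendE T (x0 : T) n (f : 'I_n -> T) (a : 'I_n) : extend x0 f a = f a.
Proof. by rewrite /extend valK. Qed.

(** The pairs (u, yy) that have to be hit form a subspace of a finite dimensional
space.  A finite family spanning it gives the new generators of Q, with the
components u as differential and the functionals yy as pairing. *)
Lemma good_stage_step (Zi Zj : P) (dl : lhom Zi Zj) (R1 R2 : nat)
    (D1 : nat -> nat -> lhom g0 g0) (y1 : nat -> functional (lhom Zj g0)) :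
  exists R0 D0 y0, good_stage dl R0 R1 R2 D0 D1 y0 y1.
Proof.
have [n [g gP]] := lhom_fin g0 g0.
have [p [h hP]] := lhom_fin Zi g0.
pose V := ('M[k]_(R1, n) * 'rV[k]_p)%type.
pose uC (C : 'M[k]_(R1, n)) (b : 'I_R1) := \sum_s C b s *: g s.
have uC_lin c C C' b : uC (c *: C + C') b = c *: uC C b + uC C' b.
  rewrite /uC scaler_sumr -big_split; apply: eq_bigr => s _ /=.
  by rewrite !mxE scalerA scalerDl.
have uC0 b : uC 0 b = 0 by rewrite /uC big1 // => s _; rewrite mxE scale0r.
pose S (x : V) := (forall c, (c < R2)%N -> \sum_(b < R1) D1 b c ** uC x.1 b = 0) /\
  exists yy : functional (lhom Zi g0), (forall t, yy (h t) = x.2 0 t) /\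
    forall v, \sum_(b < R1) y1 b (uC x.1 b ** v) = - yy (v ** dl).
have clS : lin_closed S.
  split.
    split=> [c _|]; first by rewrite big1 // => b _; rewrite uC0 lcompf0.
    exists (\0 : {linear _ -> k^o}); split=> [t|v]; first by rewrite mxE.
    by rewrite oppr0 big1 // => b _; rewrite uC0 lcomp0f linear0.
  move=> c [C1 e1] [C2 e2] [a1 [f1 [/= b1 c1]]] [a2 [f2 [/= b2 c2]]]; split=> /=.
    move=> d dR; under eq_bigr do rewrite uC_lin lcompDr lcompZr.
    by rewrite big_split /= -scaler_sumr a1 // a2 // scaler0 addr0.
  exists ((c \*: f1) \+ f2 : {linear _ -> k^o}); split=> [t|v] /=.
    by rewrite b1 b2 !mxE.
  under eq_bigr do rewrite uC_lin lcompDl lcompZl linearD linearZ.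
  by rewrite big_split /= -scaler_sumr c1 c2 scalerN -opprD.
have [r [x [Sx gen]]] := subspace_fg (@vect_fg k V) clS.
pose yy a := sval (cid (Sx a).2).
have yyP a : (forall t, yy a (h t) = (x a).2 0 t) /\
    forall v, \sum_(b < R1) y1 b (uC (x a).1 b ** v) = - yy a (v ** dl).
  exact: svalP (cid (Sx a).2).
exists r, (fun a b => extend 0 (fun a' => extend 0 (uC (x a').1) b) a).
exists (extend (\0 : {linear _ -> k^o}) yy); split.
- move=> a c ar cR; rewrite -[RHS]((Sx (Ordinal ar)).1 c cR).
  by apply: eq_bigr => b _; rewrite -[a]/(Ordinal ar : nat) !extendE.
- move=> a v ar; rewrite -[a]/(Ordinal ar : nat) !extendE -(yyP (Ordinal ar)).2.
  by apply: eq_bigr => b _; rewrite !extendE.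
move=> u f uc uf.
pose C := \matrix_(b < R1, s < n) sval (cid (gP (u b))) s.
have CP (b : 'I_R1) : uC C b = u b.
  rewrite [RHS](svalP (cid (gP (u b)))); apply: eq_bigr => s _.
  by rewrite mxE.
have [|kap kapP] := gen (C, \row_t f (h t)).
  split=> /= [c cR|].
    by rewrite -[RHS](uc c cR); apply: eq_bigr => b _; rewrite CP.
  exists f; split=> [t|v]; first by rewrite mxE.
  by rewrite -uf; apply: eq_bigr => b _; rewrite CP.
have kapC : C = \sum_a kap a *: (x a).1.
  by move/(congr1 fst): kapP => /= ->; elim/big_rec2: _ => // a u1 u2 _ <-.
have kapf : \row_t f (h t) = \sum_a kap a *: (x a).2.
  by move/(congr1 snd): kapP => /= ->; elim/big_rec2: _ => // a u1 u2 _ <-.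
exists (extend 0 kap); split.
  move=> b bR; rewrite -[b]/(Ordinal bR : nat) -CP.
  under eq_bigr do rewrite !extendE.
  rewrite kapC; elim/big_rec2: _ => [|a C1 u1 _ ->]; first by rewrite uC0.
  by rewrite uC_lin.
move=> v; under eq_bigr do rewrite !extendE.
have [c ->] := hP v; rewrite linear_sum; under eq_bigr do rewrite linear_sum mulr_sumr.
rewrite exchange_big; apply: eq_bigr => t _; rewrite linearZ /=.
have -> : f (h t) = \sum_a kap a * (x a).2 0 t.
  have /rowP/(_ t) := kapf; rewrite mxE => ->; rewrite summxE.
  by apply: eq_bigr => a _; rewrite mxE.
rewrite scaler_sumr; apply: eq_bigr => a _; rewrite linearZ /= (yyP a).1.
by rewrite [RHS]mulrCA.
Qed.

(** Reversing arrows turns a differential of degree 1 into one of degree -1; the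
sign eps lets the same construction serve both. *)
Definition is_pcx (eps : int) (Z : int -> P) (d : forall i j, lhom (Z i) (Z j)) : Prop :=
  (forall i j, j != i + eps -> d i j = 0) /\ (forall i j l, d j l ** d i j = 0).

Section Resolution.
Variables (eps : int) (i0 : int).
Hypothesis eps1 : eps = 1 \/ eps = -1.
Variables (Z : int -> P) (dZ : forall i j, lhom (Z i) (Z j)).
(** The construction runs against the differential and reaches this degree at
step t. *)
Definition deg_at (t : nat) : int := i0 - eps * t%:Z.

Lemma deg_at_inj s t : deg_at s = deg_at t -> s = t.
Proof. rewrite /deg_at; case: eps1 => ->; lia. Qed.
Lemma deg_atS t : deg_at t.+1 + eps = deg_at t.
Proof. rewrite /deg_at; case: eps1 => ->; lia. Qed.

Hypothesis Z0 : lid (Z (deg_at 0)) = 0.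

(** Each step changes the data in one degree, which the earlier conditions do not
involve; after T steps the complex is cut off. *)
Lemma good_stages T : (0 < T)%N -> exists (r : int -> nat) (D : int -> nat -> nat -> lhom g0 g0)
    (y : forall i, nat -> functional (lhom (Z i) g0)),
  (forall t, (t < T)%N -> good_stage (dZ (deg_at t) (deg_at t + eps)) (r (deg_at t)) (r (deg_at t + eps))
     (r (deg_at t + eps + eps)) (D (deg_at t)) (D (deg_at t + eps)) (y (deg_at t)) (y (deg_at t + eps))) /\
  (forall i, (0 < r i)%N -> exists t, (0 < t < T)%N /\ i = deg_at t).
Proof.
case: T => // T _; elim: T => [|T [r [D [y [gd rT]]]]].
  exists (fun=> 0%N), (fun _ _ _ => 0), (fun _ _ => \0 : {linear _ -> k^o}).
  split=> [t|//]; rewrite ltnS leqn0 => /eqP->; split=> // u yy _ _.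
  exists (fun=> 0); split=> // v; rewrite big_ord0.
  by rewrite -[v]lcompf1 Z0 lcompf0 linear0.
have [R0 [D0 [y0 gd0]]] := good_stage_step (dZ (deg_at T.+1) (deg_at T.+1 + eps)) (r (deg_at T.+1 + eps))
  (r (deg_at T.+1 + eps + eps)) (D (deg_at T.+1 + eps)) (y (deg_at T.+1 + eps)).
pose upd (A : Type) (x : A) (f : int -> A) i := if i == deg_at T.+1 then x else f i.
have updN A (x : A) f i : i != deg_at T.+1 -> upd A x f i = f i by rewrite /upd => /negPf->.
have updE A (x : A) f : upd A x f (deg_at T.+1) = x by rewrite /upd eqxx.
have n1 t : (t <= T)%N -> deg_at t != deg_at T.+1 by move=> tT; apply/eqP => /deg_at_inj; lia.
have n2 t : (t <= T.+1)%N -> deg_at t + eps != deg_at T.+1.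
  by move=> tT; apply/eqP; rewrite /deg_at; case: eps1 => ->; lia.
have n3 t : (t <= T.+1)%N -> deg_at t + eps + eps != deg_at T.+1.
  by move=> tT; apply/eqP; rewrite /deg_at; case: eps1 => ->; lia.
exists (upd _ R0 r), (upd _ D0 D), (@dfwith _ _ y (deg_at T.+1) y0); split=> [t|i].
  rewrite ltnS leq_eqVlt => /orP[/eqP->|tT].
    by rewrite !updE !updN ?n2 ?n3 // dfwith_in dfwith_out // eq_sym n2.
  rewrite !updN ?n1 ?n2 ?n3 //; try by rewrite ltnW.
  rewrite !dfwith_out; first exact: gd.
    by rewrite eq_sym n2 // ltnW.
  by rewrite eq_sym n1.
rewrite /upd; case: eqP => [-> _|_ /rT [t [tT ->]]]; first by exists T.+1; rewrite ltnSn.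
by exists t; split=> //; lia.
Qed.

(** Up to the cut at step T, composition with q identifies the complex of maps
from W to Q with the dual of the complex of maps from Z to W: the last clause
lifts at once a cocycle u and the functional bounding its pairing.  Thus Q
replaces the complex that the Nakayama functor would produce from Z. *)
Lemma resolution T : (0 < T)%N -> is_pcx eps dZ ->
  exists (Q : int -> P) (dQ : forall i j, lhom (Q i) (Q j))
    (q : forall i, functional (lhom (Z i) (Q i))),
  [/\ is_pcx eps dQ,
      forall i, lid (Q i) = 0 \/ exists t, (0 < t < T)%N /\ i = deg_at t,
      forall t (f : lhom (Z (deg_at t)) (Q (deg_at t.+1))),
        q _ (dQ (deg_at t.+1) (deg_at t) ** f) = - q _ (f ** dZ (deg_at t.+1) (deg_at t))
    & forall t W (u : lhom W (Q (deg_at t))) (yy : functional (lhom (Z (deg_at t.+1)) W)),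
        (t.+1 < T)%N ->
        (forall l, dQ (deg_at t) l ** u = 0) ->
        (forall v, q _ (u ** v) = - yy (v ** dZ (deg_at t.+1) (deg_at t))) ->
        exists u', dQ (deg_at t.+1) (deg_at t) ** u' = u /\ forall v, q _ (u' ** v) = yy v].
Proof.
move=> T0 [dZs dZd]; have [r [D [y [gd rT]]]] := good_stages T0.
pose Q i := gpow G (r i).
pose dQ i j : lhom (Q i) (Q j) := if j == i + eps then
  \sum_(a < r i) \sum_(b < r j) gin G (r j) b ** D i a b ** gpr G (r i) a else 0.
pose qf i (f : lhom (Z i) (Q i)) : k^o := \sum_(a < r i) y i a (gpr G (r i) a ** f).
have qlin i : linear (@qf i).
  move=> c f g; rewrite /qf scaler_sumr -big_split; apply: eq_bigr => a _ /=.
  by rewrite lcompDr lcompZr linearP.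
pose q i : functional (lhom (Z i) (Q i)) :=
  HB.pack (@qf i) (GRing.isLinear.Build k _ k^o _ (@qf i) (qlin i)).
have pr_in n a (b : 'I_n) : (a < n)%N ->
    gpr G n b ** gin G n a = if a == b :> nat then lid g0 else 0 by move=> an; rewrite gpr_in.
have pr_dQ i j b : j = i + eps -> (b < r j)%N ->
    gpr G (r j) b ** dQ i j = \sum_(a < r i) D i a b ** gpr G (r i) a.
  move=> ej bj; rewrite /dQ ej eqxx -ej lcomp_sumr; apply: eq_bigr => a _.
  rewrite lcomp_sumr (bigD1 (Ordinal bj)) //= !lcompA gpr_in // eqxx lcomp1f.
  rewrite big1 ?addr0 // => b' nb; rewrite !lcompA gpr_in //.
  by rewrite (negPf (nb : b' != b :> nat)) !lcomp0f.
have ext i W (u u' : lhom W (Q i)) :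
    (forall a, (a < r i)%N -> gpr G (r i) a ** u = gpr G (r i) a ** u') -> u = u'.
  move=> e; rewrite -[u]lcomp1f -[u']lcomp1f -gin_pr !lcomp_suml.
  by apply: eq_bigr => a _; rewrite -!lcompA e.
have Q0 i : r i = 0%N -> lid (Q i) = 0 by rewrite /Q => ->; rewrite -gin_pr big_ord0.
have ddQ i j l : dQ j l ** dQ i j = 0.
  have [ej|nj] := eqVneq j (i + eps); last by rewrite [X in _ ** X]/dQ (negPf nj) lcompf0.
  have [el|nl] := eqVneq l (j + eps); last by rewrite [X in X ** _]/dQ (negPf nl) lcomp0f.
  have [r0|/rT[t [/andP[_ tT] ei]]] := posnP (r i).
    by rewrite -[dQ i j]lcompf1 Q0 // !lcompf0.
  apply: ext => c cl; rewrite lcompf0 lcompA (pr_dQ _ _ _ el) // lcomp_suml.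
  under eq_bigr do rewrite -lcompA (pr_dQ _ _ _ ej) // lcomp_sumr.
  rewrite exchange_big big1 // => a _.
  under eq_bigr do rewrite lcompA; rewrite -lcomp_suml.
  have [g1 _ _] := gd _ tT; rewrite -ei -ej -el in g1.
  by rewrite g1 ?lcomp0f.
exists Q, dQ, q; split.
- by split=> // i j nj; rewrite /dQ (negPf nj).
- move=> i; have [r0|/rT h] := posnP (r i); [left; exact: Q0|by right].
- move=> t f; have [r0|/rT[t' [/andP[_ tT] /deg_at_inj et]]] := posnP (r (deg_at t.+1)).
    by rewrite -[f]lcomp1f Q0 // !(lcomp0f, lcompf0) !linear0 ?oppr0.
  rewrite -{}et in tT; have [_ g2 _] := gd _ tT; rewrite deg_atS in g2.
  rewrite /= /qf; under eq_bigr => b _.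
    rewrite lcompA (pr_dQ _ _ _ (esym (deg_atS t))) // lcomp_suml linear_sum.
    under eq_bigr do rewrite -lcompA.
    over.
  rewrite exchange_big -sumrN; apply: eq_bigr => a _.
  by rewrite g2 // lcompA.
move=> t W u yy tT du uq; have [_ _ g3] := gd _ tT; rewrite deg_atS in g3.
have [n [be [al alb]]] := ggen G W.
have lift p : exists u' : lhom g0 (Q (deg_at t.+1)), dQ (deg_at t.+1) (deg_at t) ** u' = u ** al p /\
    forall v, qf _ (u' ** v) = yy (al p ** v).
  pose yp v : k^o := yy (al p ** v).
  have yplin : linear yp by move=> c v v'; rewrite /yp lcompDr lcompZr linearP.
  pose ypf : functional (lhom (Z (deg_at t.+1)) g0) :=
    HB.pack yp (GRing.isLinear.Build k _ k^o _ yp yplin).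
  have [||kap [kap1 kap2]] := g3 (fun b => gpr G _ b ** u ** al p) ypf.
  - move=> c cR; have := congr1 (fun x => gpr G _ c ** x ** al p) (du (deg_at t + eps)).
    rewrite lcompf0 lcomp0f lcompA pr_dQ // => e; rewrite -[RHS]e !lcomp_suml.
    by apply: eq_bigr => b _; rewrite !lcompA.
  - move=> v; rewrite /= /yp lcompA -uq /= /qf; apply: eq_bigr => b _.
    by rewrite -!lcompA.
  exists (\sum_(a < r (deg_at t.+1)) kap a *: gin G _ a); split.
    apply: ext => b br; rewrite lcompA pr_dQ ?deg_atS // lcompA -kap1 // lcomp_suml.
    apply: eq_bigr => a _; rewrite lcomp_sumr (bigD1 a) //= lcompZr -lcompA pr_in // eqxx.
    rewrite lcompf1 big1 ?addr0 // => a' na; rewrite lcompZr -lcompA pr_in //.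
    by rewrite (negPf (na : a' != a :> nat)) lcompf0 scaler0.
  move=> v; rewrite -[RHS]kap2 /qf; apply: eq_bigr => a _.
  rewrite lcompA lcomp_sumr (bigD1 a) //= lcompZr pr_in // eqxx.
  rewrite big1 ?addr0 => [|a' na]; last first.
    by rewrite lcompZr pr_in // (negPf (na : a' != a :> nat)) scaler0.
  by rewrite lcompZl lcomp1f linearZ.
pose u' p := sval (cid (lift p)).
have u'P p : dQ (deg_at t.+1) (deg_at t) ** u' p = u ** al p /\
    forall v, qf _ (u' p ** v) = yy (al p ** v) by exact: svalP (cid (lift p)).
exists (\sum_p u' p ** be p); split.
  rewrite lcomp_sumr -[RHS]lcompf1 -alb lcomp_sumr; apply: eq_bigr => p _.
  by rewrite !lcompA (u'P p).1.
move=> v; rewrite lcomp_suml linear_sum -[v in RHS]lcomp1f -alb lcomp_suml linear_sum.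
by apply: eq_bigr => p _; rewrite -!lcompA; apply: (u'P p).2.
Qed.
End Resolution.
End Step.

Section ZeroObject.
Variables (k : fieldType) (P : lincat k).
Lemma from0 (X Y : P) (f : lhom X Y) : lid X = 0 -> f = 0.
Proof. by move=> X0; rewrite -[f]lcompf1 X0 lcompf0. Qed.
Lemma to0 (X Y : P) (f : lhom X Y) : lid Y = 0 -> f = 0.
Proof. by move=> X0; rewrite -[f]lcomp1f X0 lcomp0f. Qed.
End ZeroObject.

(** * The cocycle that detects the radical *)

Section Cocycle.
Variables (k : fieldType) (P : lincat k) (G : generator P).
Variables (eps : int) (i0 : int).
Hypothesis eps1 : eps = 1 \/ eps = -1.
Local Notation deg_at := (deg_at eps i0).

Definition pchain (X Y : int -> P) (dX : forall i j, lhom (X i) (X j))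
    (dY : forall i j, lhom (Y i) (Y j)) (f : forall i, lhom (X i) (Y i)) :=
  forall i j, dY i j ** f i = f j ** dX i j.

Definition phomot (X Y : int -> P) (dX : forall i j, lhom (X i) (X j))
    (dY : forall i j, lhom (Y i) (Y j)) (s : forall i j, lhom (X i) (Y j)) i : lhom (X i) (Y i) :=
  dY (i - eps) i ** s i (i - eps) + s (i + eps) i ** dX i (i + eps).

Variables (Z : int -> P) (dZ : forall i j, lhom (Z i) (Z j)).
Variables (B T : nat).
Hypothesis cZ : is_pcx eps dZ.
Hypothesis ZB : forall i, lid (Z i) = 0 \/ exists t, (0 < t < B)%N /\ i = deg_at t.
Hypotheses (BT : (B <= T)%N) (T0 : (0 < T)%N).
Variable J : (forall i, lhom (Z i) (Z i)) -> Prop.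
Hypothesis JD : forall c u v, J u -> J v -> J (fun i => c *: u i + v i).
Hypothesis Jh : forall s, J (phomot dZ dZ s).
Hypothesis J1 : ~ J (fun i => lid (Z i)).

Let deg_atP s t : deg_at s = deg_at t -> s = t. Proof. exact: deg_at_inj. Qed.
Let deg_atSS t : deg_at t.+1 + eps = deg_at t. Proof. exact: deg_atS. Qed.
Let deg_atB t : deg_at t - eps = deg_at t.+1. Proof. by rewrite -deg_atSS addrK. Qed.

Let Zout t : (B <= t)%N -> lid (Z (deg_at t)) = 0.
Proof. by move=> Bt; case: (ZB (deg_at t)) => // -[t' [/andP[_ tB] /deg_atP e]]; lia. Qed.
Let Zii0 : lid (Z (deg_at 0)) = 0.
Proof. by case: (ZB (deg_at 0)) => // -[t' [/andP[tB _] /deg_atP e]]; lia. Qed.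

Definition sfam (X Y : int -> P) t (x : lhom (X (deg_at t)) (Y (deg_at t))) : forall i, lhom (X i) (Y i) :=
  @dfwith _ (fun i => lhom (X i) (Y i)) (fun=> 0) (deg_at t) x.

(** Prescribing the value 0 on J and 1 on the identity is consistent because the
identity is not in J. *)
Lemma trace_functional : exists eta : functional (gfam (fun t => lhom (Z (deg_at t)) (Z (deg_at t)))),
  (forall v, J v -> eta (fun t => v (deg_at t)) = 0) /\ eta (fun t => lid (Z (deg_at t))) = 1.
Proof.
pose V := gfam (fun t => lhom (Z (deg_at t)) (Z (deg_at t))).
have fgV : fin_generated V.
  apply: (@gfam_fg _ _ B) => [t|t Bt x]; first exact: lhom_fin.
  exact/from0/Zout.
pose R (x : V) (a : k) := exists v, J v /\ x = (fun t => v (deg_at t) + a *: lid (Z (deg_at t))).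
have J0 : J (fun=> 0).
  have := Jh (fun _ _ => 0); congr J; apply: functional_extensionality_dep => i.
  by rewrite /phomot lcompf0 lcomp0f addr0.
have [|c v w a b [v1 [Jv ->]] [v2 [Jw ->]]|a [v [Jv e]]|eta etaP] := functional_ext fgV (R := R).
- by exists (fun=> 0); split=> //; apply: gfamP => t; rewrite scale0r addr0.
- exists (fun i => c *: v1 i + v2 i); split; first exact: JD.
  apply: gfamP => t; rewrite gfam_linE scalerDr scalerA scalerDl !addrA.
  by congr (_ + _); rewrite addrAC.
- have [//|a0] := eqVneq a 0; case: J1.
  have := JD (- a^-1) Jv J0; congr J; apply: functional_extensionality_dep => i.
  have [Zi|[t [_ ->]]] := ZB i; first by rewrite (from0 (lid _) Zi) (from0 (_ + _) Zi).
  have et : 0 = v (deg_at t) + a *: lid (Z (deg_at t)) := congr1 (fun f : V => f t) e.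
  move/esym/eqP: et; rewrite addr_eq0 => /eqP ->; rewrite addr0 scaleNr scalerN opprK scalerA.
  by rewrite mulVf // scale1r.
exists eta; split=> [v Jv|].
  apply: etaP; exists v; split=> //; apply: gfamP => t; by rewrite scale0r addr0.
by apply: etaP; exists (fun=> 0); split=> //; apply: gfamP => t; rewrite scale1r add0r.
Qed.

(** Here J is a space of graded endomorphisms of Z: in the applications, the
null-homotopic ones and the chain maps that are not invertible.  The functional
of [trace_functional] corresponds under the pairing to a cocycle w.  A
null-homotopy of w would make the functional vanish on the identity.  If all
composites h v lie in J, the functional attached to w h vanishes on the cycles,
hence it is a boundary, and so is w h. *)
Theorem radical_cocycle : exists (Q : int -> P) (dQ : forall i j, lhom (Q i) (Q j))
    (w : forall i, lhom (Z i) (Q i)),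
  [/\ is_pcx eps dQ /\ forall i, lid (Q i) = 0 \/ exists t, (0 < t < T)%N /\ i = deg_at t,
      pchain dZ dQ w,
      ~ exists s, forall i, w i = phomot dZ dQ s i
    & forall (W : int -> P) (dW : forall i j, lhom (W i) (W j)) (h : forall i, lhom (W i) (Z i)),
        is_pcx eps dW -> pchain dW dZ h -> (forall t, (T <= t.+1)%N -> lid (W (deg_at t)) = 0) ->
        (forall v, pchain dZ dW v -> J (fun i => h i ** v i)) ->
        exists s, forall i, w i ** h i = phomot dW dQ s i].
Proof.
have [eta [etaJ eta1]] := trace_functional.
have [Q [dQ [q [[dQs dQQ] QT q1 q2]]]] := resolution G eps1 Zii0 T0 cZ.
have [dZs dZZ] := cZ.
have Qii0 : lid (Q (deg_at 0)) = 0.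
  by case: (QT (deg_at 0)) => // -[t' [/andP[tB _] /deg_atP e]]; lia.
pose y t (x : lhom (Z (deg_at t)) (Z (deg_at t))) := eta (single x).
have etaS v : eta v = \sum_(t < B) y t (v t).
  rewrite -linear_sum; congr (eta _); apply: gfamP => t; rewrite gfam_sumE.
  have [tB|Bt] := ltnP t B; last first.
    by rewrite (from0 (v t) (Zout Bt)) big1 // => s _; apply/from0/Zout.
  rewrite (bigD1 (Ordinal tB)) //= single_in big1 ?addr0 // => s ns.
  by rewrite single_out.
have ylin t c u v : y t (c *: u + v) = c *: y t u + y t v by rewrite /y single_linear linearP.
have y0 t : y t 0 = 0.
  by have := ylin t (-1) 0 0; rewrite scaler0 addr0 scaleN1r addNr.
have y3 t (s : lhom (Z (deg_at t)) (Z (deg_at t.+1))) :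
    y t (dZ (deg_at t.+1) (deg_at t) ** s) = - y t.+1 (s ** dZ (deg_at t.+1) (deg_at t)).
  pose s' (p : int * int) : lhom (Z p.1) (Z p.2) :=
    @dfwith _ (fun p : int * int => lhom (Z p.1) (Z p.2)) (fun=> 0) (deg_at t, deg_at t.+1) s p.
  have := etaJ _ (Jh (fun i j => s' (i, j))); rewrite -/(deg_at) => e.
  apply/eqP; rewrite -addr_eq0 /y -linearD -[X in _ == X]e; apply/eqP; congr (eta _).
  apply: gfamP => t'; rewrite gfam_addE /phomot deg_atB.
  have [e1|n1] := eqVneq t t'.
    subst t'; rewrite /s' dfwith_in [X in X + _]single_in dfwith_out; last first.
      by rewrite xpair_eqE negb_and; apply/orP; right; apply/eqP => /deg_atP; lia.
    by rewrite lcomp0f [X in _ + X]single_out //; apply/eqP; lia.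
  have [e1|n2] := eqVneq t.+1 t'.
    subst t'; rewrite deg_atSS /s' dfwith_in [X in _ + X]single_in dfwith_out; last first.
      by rewrite xpair_eqE negb_and; apply/orP; left; apply/eqP => /deg_atP; lia.
    by rewrite lcompf0 [X in X + _]single_out.
  rewrite !single_out // addr0.
  rewrite /s' !dfwith_out ?lcompf0 ?lcomp0f ?addr0 //.
    by rewrite xpair_eqE negb_and; apply/orP; right; apply/eqP => /deg_atP; move/eqP: n2.
  by rewrite xpair_eqE negb_and; apply/orP; left; apply/eqP => /deg_atP; move/eqP: n1.
(* The cocycle w has q (w v) = eta v; it is lifted through the resolution one
   degree after the other. *)
have [w [wq wd]] : exists w : forall i, lhom (Z i) (Q i),
   (forall t, (t < T)%N -> forall v, q _ (w (deg_at t) ** v) = y t v) /\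
   (forall t, (t.+1 < T)%N -> dQ (deg_at t.+1) (deg_at t) ** w (deg_at t.+1) = w (deg_at t) ** dZ (deg_at t.+1) (deg_at t)).
  have [n en] : exists n, T = n.+1 by case: (T) T0 => // n; exists n.
  suff : forall n, (n < T)%N -> exists w : forall i, lhom (Z i) (Q i),
      (forall t, (t <= n)%N -> forall v, q _ (w (deg_at t) ** v) = y t v) /\
      (forall t, (t < n)%N -> dQ (deg_at t.+1) (deg_at t) ** w (deg_at t.+1) = w (deg_at t) ** dZ (deg_at t.+1) (deg_at t)).
    move/(_ n); rewrite en ltnSn => /(_ isT)[w [w1 w2]]; exists w.
    by split=> [t|t]; rewrite ltnS; [exact: w1|exact: w2].
  clear n en; elim=> [_|n IH nT]; first exists (fun=> 0).
    split=> [t|//]; rewrite leqn0 => /eqP-> v.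
    by rewrite lcomp0f linear0 (from0 v Zii0) y0.
  have [|w [w1 w2]] := IH; first exact: ltnW.
  have [||x [x1 x2]] := q2 n _ (w (deg_at n) ** dZ (deg_at n.+1) (deg_at n))
      (eta \o (@single _ _ n.+1) : {linear _ -> k^o}) nT.
  - move=> l; rewrite lcompA; case: n w w1 w2 {IH nT} => [|n] w w1 w2.
      by rewrite (from0 (_ ** w _) Zii0) lcomp0f.
    have [->|nl] := eqVneq l (deg_at n.+1 + eps); last by rewrite dQs // !lcomp0f.
    by rewrite deg_atSS w2 // -lcompA dZZ lcompf0.
  - by move=> v; rewrite -lcompA w1 // y3.
  have no t : (t <= n)%N -> deg_at n.+1 != deg_at t by move=> tn; apply/eqP => /deg_atP; lia.
  exists (@dfwith _ _ w (deg_at n.+1) x); split=> t; rewrite ?ltnS leq_eqVlt => /orP[/eqP->|tn].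
  - by move=> v; rewrite dfwith_in x2.
  - by move=> v; rewrite dfwith_out ?no // w1.
  - by rewrite dfwith_in dfwith_out ?no // x1.
  by rewrite !dfwith_out ?no ?(ltnW tn) // w2.
have wch : pchain dZ dQ w.
  move=> i j; have [ej|nj] := eqVneq j (i + eps); last by rewrite dQs // dZs // lcompf0 lcomp0f.
  have [Zi|[[|t] [/andP[t0 tB] ei]]] := ZB i => //.
    by rewrite (from0 (w i) Zi) (from0 (dZ i j) Zi) !lcompf0.
  by rewrite ej ei deg_atSS wd //; apply: leq_trans BT.
exists Q, dQ, w; split=> //.
  move=> [s ws].
  (* For w = d s + s d the sum of the q (w) telescopes. *)
  pose al t := q _ (s (deg_at t) (deg_at t.+1) ** dZ (deg_at t.+1) (deg_at t)).
  have tot n : \sum_(t < n.+1) q _ (w (deg_at t)) = - al n.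
    elim: n => [|n IH]; rewrite big_ord_recr ?big_ord0 ?add0r ?IH /= ws /phomot deg_atB linearD q1 -/(al _).
      have -> : s (deg_at 0 + eps) (deg_at 0) ** dZ (deg_at 0) (deg_at 0 + eps) = 0 by exact: from0.
      by rewrite linear0 addr0 add0r.
    by rewrite deg_atSS -/(al n) addrCA addNr addr0.
  have := eta1; rewrite etaS => e; have [B0|B1] := posnP B.
    by move: e; rewrite B0 big_ord0 => /eqP; rewrite eq_sym oner_eq0.
  case/eqP: (oner_neq0 k); rewrite -e -(prednK B1).
  under eq_bigr => t _.
    rewrite -(wq t); last by have := ltn_ord t; move: BT B1; lia.
    rewrite lcompf1; over.
  rewrite tot /al [X in q _ X](_ : _ = 0) ?linear0 ?oppr0 //.
  by rewrite (from0 (dZ _ _)) ?lcompf0 //; apply: Zout; rewrite prednK.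
move=> W dW h [dWs dWW] hch W0 hJ.
pose u i := w i ** h i.
have uch : pchain dW dQ u by move=> i j; rewrite /u lcompA wch -!lcompA hch.
(* th is a functional on the maps Z -> W of degree -1 with th (d v - v d) =
   q (w h v): it exists because q (w h v) = eta (h v) = 0 for chain maps v. *)
pose V' := gfam (fun t => lhom (Z (deg_at t.+1)) (W (deg_at t))).
have fgV' : fin_generated V'.
  apply: (@gfam_fg _ _ B) => [t|t Bt x]; first exact: lhom_fin.
  by apply/from0/Zout/(leq_trans Bt).
pose Dl (v : forall i, lhom (Z i) (W i)) : V' := fun t =>
  dW (deg_at t.+1) (deg_at t) ** v (deg_at t.+1) - v (deg_at t) ** dZ (deg_at t.+1) (deg_at t).
pose tr (v : forall i, lhom (Z i) (W i)) : k := \sum_(t < B) q _ (u (deg_at t) ** v (deg_at t)).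
pose R (x : V') (a : k) := exists v, x = Dl v /\ a = tr v.
have [|c x1 x2 a b [v1 [-> ->]] [v2 [-> ->]]|a [v [e ->]]|th thP] := functional_ext fgV' (R := R).
- exists (fun=> 0); split; last by rewrite /tr big1 // => t _; rewrite lcompf0 linear0.
  by apply: gfamP => t; rewrite /Dl lcompf0 lcomp0f subr0.
- exists (fun i => c *: v1 i + v2 i); split.
    apply: gfamP => t; rewrite gfam_linE /Dl lcompDr lcompZr lcompDl lcompZl scalerBr opprD.
    by rewrite addrACA.
  rewrite /tr mulr_sumr -big_split; apply: eq_bigr => t _ /=.
  by rewrite lcompDr lcompZr linearP.
- have vch : pchain dZ dW v.
    move=> i j; have [ej|nj] := eqVneq j (i + eps); last by rewrite dWs // dZs // lcompf0 lcomp0f.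
    have [Zi|[[|t] [/andP[t0 tB] ei]]] := ZB i => //.
      by rewrite (from0 (v i) Zi) (from0 (dZ i j) Zi) !lcompf0.
    rewrite ej ei deg_atSS; apply/subr0_eq; have /(congr1 (fun f : V' => f t)) := e; exact: esym.
  rewrite -[RHS](etaJ _ (hJ v vch)) etaS /tr; apply: eq_bigr => t _.
  by rewrite /u -lcompA wq //; apply: leq_trans BT.
pose th1 t (x : lhom (Z (deg_at t.+1)) (W (deg_at t))) : k := th (single x).
have thE t (v : lhom (Z (deg_at t.+1)) (W (deg_at t.+1))) :
    q _ (u (deg_at t.+1) ** v) = th1 t (dW (deg_at t.+1) (deg_at t) ** v) - th1 t.+1 (v ** dZ (deg_at t.+2) (deg_at t.+1)).
  have [tB|Bt] := ltnP t.+1 B; last first.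
    by rewrite (from0 v (Zout Bt)) !lcompf0 lcomp0f linear0 /th1 !linear0 subrr.
  rewrite -linearB; pose v' : forall i, lhom (Z i) (W i) := sfam v.
  have -> : q _ (u (deg_at t.+1) ** v) = tr v'.
    rewrite /tr (bigD1 (Ordinal tB)) //= /v' /sfam dfwith_in big1 ?addr0 // => s ns.
    rewrite dfwith_out ?lcompf0 ?linear0 //; apply/eqP => /deg_atP e; case/eqP: ns.
    exact/val_inj/esym.
  apply/esym/thP; exists v'; split=> //; apply: gfamP => s.
  rewrite /Dl; change ((single (dW (deg_at t.+1) (deg_at t) ** v) : V') s -
    (single (v ** dZ (deg_at t.+2) (deg_at t.+1)) : V') s = dW (deg_at s.+1) (deg_at s) ** v' (deg_at s.+1) - v' (deg_at s) ** dZ (deg_at s.+1) (deg_at s)).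
  have [e1|n1] := eqVneq t s.
    subst s; rewrite single_in /v' /sfam dfwith_in single_out; last by apply/eqP; lia.
    by rewrite dfwith_out ?lcomp0f //; apply/eqP => /deg_atP; lia.
  rewrite single_out // sub0r /v' /sfam [X in _ ** X - _]dfwith_out; last first.
    by apply/eqP => /deg_atP; move/eqP: n1; lia.
  rewrite lcompf0 sub0r; congr (- _); have [e2|n2] := eqVneq t.+1 s.
    by subst s; rewrite single_in dfwith_in.
  by rewrite single_out // dfwith_out ?lcomp0f //; apply/eqP => /deg_atP; move/eqP: n2.
(* The homotopy s is lifted along th, as w was along eta. *)
have [s sP] : exists s : forall p : int * int, lhom (W p.1) (Q p.2),
    forall t, (t.+1 < T)%N -> (forall v, q _ (s (deg_at t, deg_at t.+1) ** v) = th1 t v) /\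
      dQ (deg_at t.+1) (deg_at t) ** s (deg_at t, deg_at t.+1) + s (deg_at t + eps, deg_at t) ** dW (deg_at t) (deg_at t + eps) = u (deg_at t).
  suff H : forall n, (n < T)%N -> exists s : forall p : int * int, lhom (W p.1) (Q p.2),
    forall t, (t < n)%N -> (forall v, q _ (s (deg_at t, deg_at t.+1) ** v) = th1 t v) /\
      dQ (deg_at t.+1) (deg_at t) ** s (deg_at t, deg_at t.+1) + s (deg_at t + eps, deg_at t) ** dW (deg_at t) (deg_at t + eps) = u (deg_at t).
    have [|s sP] := H T.-1; first by rewrite prednK.
    by exists s => t tT; apply: sP; rewrite -ltnS prednK.
  elim=> [|n IH nT]; first by exists (fun=> 0).
  have [|s sP] := IH; first exact: ltnW.
  have [||x [x1 x2]] := q2 n _ (u (deg_at n) - s (deg_at n + eps, deg_at n) ** dW (deg_at n) (deg_at n + eps))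
      (th \o (@single _ _ n) : {linear _ -> k^o}) nT.
  - move=> l; case: n sP {IH nT} => [|n] sP; first by rewrite (from0 (dQ _ _) Qii0) lcomp0f.
    have [->|nl] := eqVneq l (deg_at n.+1 + eps); last by rewrite dQs // !lcomp0f.
    rewrite deg_atSS lcompBr uch lcompA; have [_ e] := sP n (ltnSn n).
    by rewrite -lcompBl -e addrC addKr -lcompA dWW lcompf0.
  - case: n sP {IH nT} => [|n] sP v; first by rewrite (from0 v Zii0) lcompf0 lcomp0f !linear0 ?oppr0.
    rewrite deg_atSS lcompBl linearB thE; have [e _] := sP n (ltnSn n).
    by rewrite -lcompA e /= addrAC subrr add0r.
  have pn (i j : int) : j != deg_at n.+1 -> (deg_at n, deg_at n.+1) != (i, j).
    by move=> h1; rewrite xpair_eqE negb_and [X in _ || ~~ X]eq_sym h1 orbT.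
  exists (@dfwith _ _ s (deg_at n, deg_at n.+1) x) => t; rewrite ltnS leq_eqVlt => /orP[/eqP->|tn].
    rewrite dfwith_in; split=> //; rewrite dfwith_out; last by apply: pn; apply/eqP => /deg_atP; lia.
    by rewrite x1 subrK.
  rewrite !dfwith_out; first exact: sP.
    by apply: pn; apply/eqP => /deg_atP; lia.
  by apply: pn; apply/eqP => /deg_atP; lia.
exists (fun i j => s (i, j)) => i; rewrite -/(u i) /phomot.
have [Qi|[t [/andP[t0 tT] ei]]] := QT i; first by rewrite (to0 (u i) Qi) (to0 (_ + _) Qi).
have [tT'|Tt] := ltnP t.+1 T; last first.
  have Wi := W0 _ Tt; rewrite -ei in Wi; by rewrite (from0 (u i) Wi) (from0 (_ + _) Wi).
by rewrite ei deg_atB; have [_ ->] := sP t tT'.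
Qed.

End Cocycle.

(** * Finitely generated projective modules *)

Lemma linear_ext (R : nzRingType) (M N : lmodType R) (f g : {linear M -> N}) :
  f =1 g -> f = g.
Proof.
case: f g => f [[a1] [a2]] [g [[b1] [b2]]] /= e; have {}e : f = g by apply: funext.
case: _ / e in b1 b2 *.
by rewrite (Prop_irrelevance a1 b1) (Prop_irrelevance a2 b2).
Qed.

Definition mklin (R : nzRingType) (M N : lmodType R) (f : M -> N) (fl : linear f) :
  {linear M -> N} := HB.pack f (GRing.isLinear.Build R M N _ f fl).

Section FinGenProj.
Variable R : nzRingType.
Implicit Types M N : lmodType R.

(** The dual basis lemma turns finitely generated projective modules into a notion
that visibly passes to retracts and to sums. *)
Definition dual_basis M := exists (J : finType) (a : J -> M) (b : J -> {linear M -> R^o}),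
  forall x, x = \sum_i (b i x : R) *: a i.

Lemma dual_basis_fgp M : dual_basis M <-> fin_generated M /\ projective_mod M.
Proof.
split=> [[J [a [b ab]]]|[[n [a aP]] prM]].
  split.
    exists #|J|, (fun t => a (enum_val t)) => x; exists (fun t => b (enum_val t) x).
    rewrite {1}[x]ab (reindex_onto (@enum_val J predT) enum_rank) => [|j _].
      by apply: eq_bigl => r; rewrite enum_valK eqxx.
    exact: enum_rankK.
  move=> N L p f p_surj.
  pose y i := sval (cid (p_surj (f (a i)))).
  have yP i : p (y i) = f (a i) := svalP (cid (p_surj (f (a i)))).
  pose h x := \sum_i (b i x : R) *: y i.
  have hl : linear h.
    move=> c u v; rewrite /h scaler_sumr -big_split; apply: eq_bigr => i _ /=.
    by rewrite linearP scalerDl scalerA.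
  exists (mklin hl) => x; rewrite /= /h linear_sum [in RHS](ab x) linear_sum.
  by apply: eq_bigr => i _; rewrite !linearZ yP.
pose p (v : 'rV[R]_n) := \sum_i v 0 i *: a i.
have pl : linear p.
  move=> c u v; rewrite /p scaler_sumr -big_split; apply: eq_bigr => i _ /=.
  by rewrite !mxE scalerDl scalerA.
have [|h hP] := prM _ _ (mklin pl) idfun.
  move=> y; have [c ->] := aP y; exists (\row_i c i); apply: eq_bigr => i _.
  by rewrite mxE.
have bl i : linear (fun x => h x 0 i : R^o) by move=> c u v; rewrite linearP !mxE.
by exists 'I_n, a, (fun i => mklin (bl i)) => x; rewrite -[LHS]hP.
Qed.

Lemma dual_basis_retract M N (i : {linear N -> M}) (p : {linear M -> N}) :
  (forall x, p (i x) = x) -> dual_basis M -> dual_basis N.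
Proof.
move=> pi [n [a [b ab]]]; exists n, (p \o a), (fun j => b j \o i : {linear N -> R^o}) => x.
rewrite -[LHS]pi [in LHS](ab (i x)) linear_sum; apply: eq_bigr => j _.
by rewrite linearZ.
Qed.

Lemma dual_basis_pair M N : dual_basis M -> dual_basis N -> dual_basis (M * N)%type.
Proof.
move=> [J [a [b ab]]] [J' [a' [b' ab']]].
exists (J + J')%type, (fun j => match j with inl i => (a i, 0) | inr i => (0, a' i) end).
exists (fun j => match j with
  inl i => b i \o fst : {linear (M * N)%type -> R^o}
| inr i => b' i \o snd : {linear (M * N)%type -> R^o} end).
move=> [x y]; rewrite big_sumType /=.
transitivity (((x, 0) : (M * N)%type) + (0, y)); first by congr pair; rewrite ?addr0 ?add0r.
congr (_ + _).
  rewrite [in LHS](ab x); elim/big_rec2: _ => // i u v _ <-.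
  by congr pair; rewrite /= scaler0 addr0.
rewrite [in LHS](ab' y); elim/big_rec2: _ => // i u v _ <-.
by congr pair; rewrite /= scaler0 addr0.
Qed.

Lemma dual_basis_regular : dual_basis (R^o : lmodType R).
Proof.
exists unit, (fun=> 1 : R^o), (fun=> idfun) => x.
by rewrite (big_pred1 tt) => [|[]//]; rewrite /= /GRing.scale /= mulr1.
Qed.

Lemma dual_basis_rV n : dual_basis ('rV[R]_n : lmodType R).
Proof.
have bl i : linear (fun x : 'rV[R]_n => x 0 i : R^o) by move=> c u v; rewrite !mxE.
exists 'I_n, (fun i => delta_mx 0 i), (fun i => mklin (bl i)) => x.
exact: row_sum_delta.
Qed.

End FinGenProj.

Section HomSpace.
Variables (k : fieldType) (A : falgType k).
Implicit Types M N : lmodType A.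

(** As A is not commutative, linear maps between A-modules carry no module
structure by themselves; this alias receives the one over the base field. *)
Definition linT M N := {linear M -> N}.
HB.instance Definition _ M N := gen_eqMixin (linT M N).
HB.instance Definition _ M N := gen_choiceMixin (linT M N).

Section Instance.
Variables M N : lmodType A.
Definition lin_add (f g : linT M N) : linT M N := (f : {linear M -> N}) \+ (g : {linear M -> N}).
Definition lin_zero : linT M N := \0 : {linear M -> N}.
Definition lin_opp (f : linT M N) : linT M N := \- (f : {linear M -> N}).
Fact scale_lin_subproof (c : k) (f : linT M N) : linear (fun x => (c%:A : A) *: (f : {linear _ -> _}) x).
Proof.
move=> a x y; rewrite linearP scalerDr !scalerA; congr (_ *: _ + _).
by rewrite mulr_algl mulr_algr.
Qed.
Definition lin_scale (c : k) (f : linT M N) : linT M N := mklin (scale_lin_subproof c f).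

Let addA : associative lin_add.
Proof. by move=> f g h; apply: linear_ext => x; apply: addrA. Qed.
Let addC : commutative lin_add.
Proof. by move=> f g; apply: linear_ext => x; apply: addrC. Qed.
Let add0 : left_id lin_zero lin_add.
Proof. by move=> f; apply: linear_ext => x; apply: add0r. Qed.
Let addN : left_inverse lin_zero lin_opp lin_add.
Proof. by move=> f; apply: linear_ext => x; apply: addNr. Qed.
HB.instance Definition _ := GRing.isZmodule.Build (linT M N) addA addC add0 addN.
Let scA a b (f : linT M N) : lin_scale a (lin_scale b f) = lin_scale (a * b) f.
Proof. by apply: linear_ext => x; rewrite /= scalerA -scalerAl mul1r scalerA. Qed.
Let sc1 : left_id 1 lin_scale.
Proof. by move=> f; apply: linear_ext => x; rewrite /= !scale1r. Qed.
Let scDr : right_distributive lin_scale +%R.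
Proof. by move=> a f g; apply: linear_ext => x; apply: scalerDr. Qed.
Let scDl (f : linT M N) : {morph lin_scale^~ f : a b / a + b}.
Proof. by move=> a b; apply: linear_ext => x; rewrite /= !scalerDl. Qed.
HB.instance Definition _ := GRing.Zmodule_isLmodule.Build k (linT M N) scA sc1 scDr scDl.
End Instance.

Lemma injective_vect_fg (V : lmodType k) (W : vectType k) (f : {linear V -> W}) :
  injective f -> fin_generated V.
Proof.
move=> fI; pose g x := \row_i coord (vbasis {:W}) i (f x).
have gl : linear g by move=> c x y; apply/rowP => i; rewrite !mxE !linearP.
apply: (@injective_fg _ _ _ (mklin gl)) => x y /rowP e; apply: fI.
rewrite (coord_vbasis (memvf (f x))) (coord_vbasis (memvf (f y))).
by apply: eq_bigr => i _; have := e i; rewrite !mxE => ->.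
Qed.

Lemma linT_fg M N : dual_basis M -> dual_basis N -> fin_generated (linT M N).
Proof.
move=> [J [a [b ab]]] [J' [a' [b' ab']]].
pose F (f : linT M N) : {ffun J * J' -> A} := [ffun p => b' p.2 ((f : {linear M -> N}) (a p.1))].
have Fl : linear F.
  move=> c f g; apply/ffunP => p; rewrite !ffunE /= linearD linearZ /=.
  by rewrite /GRing.scale /= mulr_algl.
apply: (@injective_vect_fg _ _ (mklin Fl)) => f g /= /ffunP e.
apply: linear_ext => x; rewrite (ab x) !linear_sum; apply: eq_bigr => j _; rewrite !linearZ.
congr (_ *: _); rewrite [LHS]ab' [RHS]ab'; apply: eq_bigr => j' _; congr (_ *: _).
by have := e (j, j'); rewrite !ffunE.
Qed.

Definition linT_at M N (x : M) (f : linT M N) : N := (f : {linear M -> N}) x.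

Record fgproj := FGProj { pmod :> lmodType A; pmodP : dual_basis pmod }.

Program Definition projL : lincat k :=
  @LinCat k fgproj (fun X Y => linT X Y) (fun X => (idfun : {linear X -> X}))
    (fun X Y Z g f => ((g : {linear _ -> _}) \o (f : {linear _ -> _}) : {linear X -> Z})) _ _ _ _ _ _.
Next Obligation. by move=> *; apply: linear_ext. Qed.
Next Obligation. by move=> *; apply: linear_ext. Qed.
Next Obligation. by move=> *; apply: linear_ext. Qed.
Next Obligation. by move=> M N L g c f f'; apply: linear_ext => x /=; rewrite linearD linearZ. Qed.
Next Obligation. by move=> M N L g c f f'; apply: linear_ext. Qed.
Next Obligation. by move=> M N; apply: linT_fg; apply: pmodP. Qed.

End HomSpace.

Definition op_generator (k : fieldType) (P : lincat k) (G : generator P) : generator (opL P) :=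
  @Generator k (opL P) (gob G) (gpow G) (fun n a => gpr G n a) (fun n a => gin G n a)
    (fun n a b an bn => etrans (gpr_in G bn an) (congr1 (fun c : bool => if c then _ else _) (eq_sym b a)))
    (fun n => gin_pr G n)
    (fun W => let: ex_intro n (ex_intro b (ex_intro a e)) := ggen G W in
       ex_intro _ n (ex_intro _ a (ex_intro _ b e))).

Section ProjGenerator.
Variables (k : fieldType) (A : falgType k).

Definition reg_pr : fgproj A := FGProj (dual_basis_regular A).
Definition rV_pr n : fgproj A := FGProj (dual_basis_rV A n).

Fact rV_in_subproof n a : linear (fun x : A^o => \row_(j < n) (if j == a :> nat then x else 0) : 'rV[A]_n).
Proof.
move=> c x y; apply/rowP => j; rewrite !mxE; case: ifP => _ //.
by rewrite mulr0 addr0.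
Qed.
Definition rV_in n a : linT (A^o : lmodType A) 'rV[A]_n := mklin (@rV_in_subproof n a).
Fact rV_out_subproof n a : linear (fun x : 'rV[A]_n => extend 0 (x 0) a : A^o).
Proof. by move=> c x y; rewrite /extend; case: insubP => [j _ _|_]; rewrite ?mxE // scaler0 addr0. Qed.
Definition rV_out n a : linT 'rV[A]_n (A^o : lmodType A) := mklin (@rV_out_subproof n a).

Program Definition proj_generator : generator (projL A) :=
  @Generator k (projL A) reg_pr rV_pr rV_in rV_out _ _ _.
Next Obligation.
move=> n a b an bn; apply: linear_ext => x /=.
by rewrite -[b]/(Ordinal bn : nat) extendE mxE /= eq_sym; case: ifP.
Qed.
Next Obligation.
move=> n; apply: linear_ext => x /=; apply/rowP => j.
have sE (F : 'I_n -> linT 'rV[A]_n 'rV[A]_n) y : (\sum_i F i : {linear _ -> _}) y = \sum_i (F i : {linear _ -> _}) y.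
  by elim/big_rec2: _ => // i u v _ <-.
rewrite sE summxE (bigD1 j) //= mxE eqxx extendE big1 ?addr0 // => i ij.
by rewrite mxE (negPf (_ : (j != i :> nat))) // eq_sym.
Qed.
Next Obligation.
move=> W; have [J [a [b ab]]] := pmodP W.
have al j : linear (fun x : A^o => (x : A) *: a j).
  by move=> c x y; rewrite scalerDl scalerA.
exists #|J|, (fun t => b (enum_val t) : linT _ _), (fun t => mklin (al (enum_val t)) : linT _ _).
apply: linear_ext => x.
have sE n (F : 'I_n -> linT W W) y : (\sum_i F i : {linear _ -> _}) y = \sum_i (F i : {linear _ -> _}) y.
  by elim/big_rec2: _ => // i u v _ <-.
rewrite sE /= [RHS]ab (reindex_onto (@enum_val J predT) enum_rank) => [|j _].
  by apply: eq_bigl => r; rewrite enum_valK eqxx.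
exact: enum_rankK.
Qed.

End ProjGenerator.

(** * Categories of complexes *)

Section Cmor.
Variables (k : fieldType) (A : falgType k) (I : nzRingType).
Implicit Types X Y Z : cplx A I.

Lemma cmorP X Y (f g : cmor X Y) : (forall i x, f i x = g i x) -> f = g.
Proof.
case: f g => f fc [g gc] /= e; have {}e : f = g.
  by apply: functional_extensionality_dep => i; apply: linear_ext => x; apply: e.
by case: _ / e in gc *; congr CMor; apply: Prop_irrelevance.
Qed.

Lemma cmor_eqE X Y (f g : cmor X Y) : cmor_eq f g = (f = g).
Proof. by apply/propext; split=> [/cmorP//|->]. Qed.

HB.instance Definition _ X Y := gen_eqMixin (cmor X Y).
HB.instance Definition _ X Y := gen_choiceMixin (cmor X Y).

Section Instance.
Variables X Y : cplx A I.
Program Definition cmor_opp (f : cmor X Y) : cmor X Y := @CMor _ _ X Y (fun i => \- (f i)) _.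
Next Obligation. by move=> f i j x /=; rewrite mor_comm linearN. Qed.
Program Definition cmor_scale (c : k) (f : cmor X Y) : cmor X Y :=
  @CMor _ _ X Y (fun i => lin_scale c (f i)) _.
Next Obligation. by move=> c f i j x /=; rewrite mor_comm linearZ. Qed.

Let addA : associative (@cmor_add A I X Y).
Proof. by move=> f g h; apply: cmorP => i x; apply: addrA. Qed.
Let addC : commutative (@cmor_add A I X Y).
Proof. by move=> f g; apply: cmorP => i x; apply: addrC. Qed.
Let add0 : left_id (cmor_zero X Y) (@cmor_add A I X Y).
Proof. by move=> f; apply: cmorP => i x; apply: add0r. Qed.
Let addN : left_inverse (cmor_zero X Y) cmor_opp (@cmor_add A I X Y).
Proof. by move=> f; apply: cmorP => i x; apply: addNr. Qed.
HB.instance Definition _ := GRing.isZmodule.Build (cmor X Y) addA addC add0 addN.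
Let scA a b (f : cmor X Y) : cmor_scale a (cmor_scale b f) = cmor_scale (a * b) f.
Proof. by apply: cmorP => i x; rewrite /= scalerA -scalerAl mul1r scalerA. Qed.
Let sc1 : left_id 1 cmor_scale.
Proof. by move=> f; apply: cmorP => i x; rewrite /= !scale1r. Qed.
Let scDr : right_distributive cmor_scale +%R.
Proof. by move=> a f g; apply: cmorP => i x; apply: scalerDr. Qed.
Let scDl (f : cmor X Y) : {morph cmor_scale^~ f : a b / a + b}.
Proof. by move=> a b; apply: cmorP => i x; rewrite /= !scalerDl. Qed.
HB.instance Definition _ := GRing.Zmodule_isLmodule.Build k (cmor X Y) scA sc1 scDr scDl.

Lemma cmor_addE (f g : cmor X Y) i x : (f + g) i x = f i x + g i x. Proof. by []. Qed.
Lemma cmor_oppE (f : cmor X Y) i x : (- f) i x = - f i x. Proof. by []. Qed.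
Lemma cmor_zeroE i x : (0 : cmor X Y) i x = 0. Proof. by []. Qed.
Lemma cmor_scaleE c (f : cmor X Y) i x : (c *: f) i x = (c%:A : A) *: f i x. Proof. by []. Qed.
Lemma cmor_sumE T (r : seq T) (P : pred T) (F : T -> cmor X Y) i x :
  (\sum_(t <- r | P t) F t) i x = \sum_(t <- r | P t) F t i x.
Proof. by elim/big_rec2: _ => // t y z _ <-. Qed.

Lemma cob_dual i : dual_basis (X i).
Proof. by apply/dual_basis_fgp; split; [exact: cob_fg|exact: cob_proj]. Qed.

End Instance.

Definition cplx_of (X : I -> lmodType A) d shape comp (dual : forall i, dual_basis (X i)) :
  cplx A I := @Cplx A I X d shape comp
  (fun i => ((dual_basis_fgp _).1 (dual i)).1) (fun i => ((dual_basis_fgp _).1 (dual i)).2).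

(** A chain map is determined by the coordinates of the images of generators, in
finitely many degrees. *)
Lemma cmor_fg X Y (D : finType) (deg : D -> I) :
  (forall i, (exists d, deg d = i) \/ forall x : X i, x = 0) -> fin_generated (cmor X Y).
Proof.
move=> sup.
pose J d := sval (cid (cob_dual X (deg d))).
pose a d : J d -> X (deg d) := sval (cid (svalP (cid (cob_dual X (deg d))))).
have aP d : exists b : J d -> {linear X (deg d) -> A^o}, forall x, x = \sum_i (b i x : A) *: a d i.
  exact: svalP (cid (svalP (cid (cob_dual X (deg d))))).
pose J' d := sval (cid (cob_dual Y (deg d))).
have bP' d := svalP (cid (cob_dual Y (deg d))).
pose b d : J' d -> {linear Y (deg d) -> A^o} := sval (cid (svalP (cid (bP' d)))).
have bP d : forall x, x = \sum_i (b d i x : A) *: sval (cid (bP' d)) i.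
  exact: svalP (cid (svalP (cid (bP' d)))).
pose S := {d : D & (J d * J' d)%type}.
pose F (f : cmor X Y) : {ffun S -> A} :=
  [ffun p => b _ (tagged p).2 (f _ (a _ (tagged p).1))].
have Fl : linear F.
  move=> c f g; apply/ffunP => p; rewrite !ffunE /= linearD linearZ /=.
  by rewrite /GRing.scale /= mulr_algl.
apply: (@injective_vect_fg _ _ _ (mklin Fl)) => f g /= /ffunP e.
apply: cmorP => i x; have [[d di]|x0] := sup i; last by rewrite (x0 x) !linear0.
subst i; have [be beP] := aP d.
rewrite (beP x) !linear_sum; apply: eq_bigr => j _; rewrite !linearZ.
congr (_ *: _); rewrite [LHS]bP [RHS]bP; apply: eq_bigr => j' _; congr (_ *: _).
by have := e (Tagged (fun d => (J d * J' d)%type) (j, j')); rewrite !ffunE.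
Qed.

End Cmor.

Section Lincats.
Variables (k : fieldType) (A : falgType k).

Program Definition perL (m : nat) : lincat k :=
  @LinCat k (cplx A 'Z_m) (fun X Y => cmor X Y) (fun X => cmor_id X)
    (fun X Y Z g f => cmor_comp g f) _ _ _ _ _ _.
Next Obligation. by move=> *; apply: cmorP. Qed.
Next Obligation. by move=> *; apply: cmorP. Qed.
Next Obligation. by move=> *; apply: cmorP. Qed.
Next Obligation. by move=> m X Y Z g c f f'; apply: cmorP => i x /=; rewrite linearD linearZ. Qed.
Next Obligation. by move=> m X Y Z g c f f'; apply: cmorP. Qed.
Next Obligation. by move=> m X Y; apply: (@cmor_fg _ _ _ _ _ 'Z_m id) => i; left; exists i. Qed.

Program Definition bndL : lincat k :=
  @LinCat k (bcplx A) (fun X Y => cmor X Y) (fun X => cmor_id X)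
    (fun X Y Z g f => cmor_comp g f) _ _ _ _ _ _.
Next Obligation. by move=> *; apply: cmorP. Qed.
Next Obligation. by move=> *; apply: cmorP. Qed.
Next Obligation. by move=> *; apply: cmorP. Qed.
Next Obligation. by move=> X Y Z g c f f'; apply: cmorP => i x /=; rewrite linearD linearZ. Qed.
Next Obligation. by move=> X Y Z g c f f'; apply: cmorP. Qed.
Next Obligation.
move=> X Y; have [a [b ab]] := bcob_bounded X.
apply: (@cmor_fg _ _ _ _ _ 'I_(`|b - a|%N.+1) (fun t => a + (t : nat)%:Z)) => i.
have [i_ab|/ab] := boolP (a <= i <= b); last by right.
left; have t_lt : (`|i - a| < `|b - a|.+1)%N by lia.
by exists (Ordinal t_lt) => /=; lia.
Qed.

(** Pointwise equality of chain maps may be replaced by Leibniz equality inside a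
category, which turns the categories of complexes into those of [perL] and
[bndL]. *)
Lemma cmor_eqF (I : nzRingType) (T : Type) (c : T -> cplx A I) :
  (fun X Y : T => @cmor_eq A I (c X) (c Y)) = (fun X Y f g => f = g).
Proof. by do 4!apply: functional_extensionality_dep => ?; exact: cmor_eqE. Qed.

Lemma CperE m : Cper A m = @exc k (perL m) (fun X Y Z f g => degreewise_split f g).
Proof. by rewrite /Cper /exc /Cper_cat /acat (cmor_eqF id). Qed.

End Lincats.

Section FixedSubmodule.
Variables (R : nzRingType) (M : lmodType R) (e : {linear M -> M}).

(** The image of an idempotent, as the module of its fixed points: this form makes
the inclusion injective by definition. *)
Record fixmod := FixMod { fval :> M; fvalP : e fval = fval }.

Lemma fixmodP (x y : fixmod) : fval x = fval y -> x = y.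
Proof.
by case: x y => [x ex] [y ey] /= exy; case: _ / exy in ey *; congr FixMod; apply: Prop_irrelevance.
Qed.

HB.instance Definition _ := gen_eqMixin fixmod.
HB.instance Definition _ := gen_choiceMixin fixmod.

Program Definition fix0 := @FixMod 0 _.
Next Obligation. exact: linear0. Qed.
Program Definition fixN (x : fixmod) := @FixMod (- fval x) _.
Next Obligation. by move=> x; rewrite linearN fvalP. Qed.
Program Definition fixD (x y : fixmod) := @FixMod (fval x + fval y) _.
Next Obligation. by move=> x y; rewrite linearD !fvalP. Qed.
Program Definition fixZ (c : R) (x : fixmod) := @FixMod (c *: fval x) _.
Next Obligation. by move=> c x; rewrite linearZ fvalP. Qed.

Let addA : associative fixD.
Proof. by move=> x y z; apply: fixmodP; apply: addrA. Qed.
Let addC : commutative fixD.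
Proof. by move=> x y; apply: fixmodP; apply: addrC. Qed.
Let add0 : left_id fix0 fixD.
Proof. by move=> x; apply: fixmodP; apply: add0r. Qed.
Let addN : left_inverse fix0 fixN fixD.
Proof. by move=> x; apply: fixmodP; apply: addNr. Qed.
HB.instance Definition _ := GRing.isZmodule.Build fixmod addA addC add0 addN.
Let scA a b (x : fixmod) : fixZ a (fixZ b x) = fixZ (a * b) x.
Proof. by apply: fixmodP; apply: scalerA. Qed.
Let sc1 : left_id 1 fixZ.
Proof. by move=> x; apply: fixmodP; apply: scale1r. Qed.
Let scDr : right_distributive fixZ +%R.
Proof. by move=> a x y; apply: fixmodP; apply: scalerDr. Qed.
Let scDl (x : fixmod) : {morph fixZ^~ x : a b / a + b}.
Proof. by move=> a b; apply: fixmodP; apply: scalerDl. Qed.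
HB.instance Definition _ := GRing.Zmodule_isLmodule.Build R fixmod scA sc1 scDr scDl.

Fact fval_subproof : linear fval. Proof. by []. Qed.
Definition fix_in : {linear fixmod -> M} := mklin fval_subproof.

Hypothesis ee : forall x, e (e x) = e x.
Definition fix_pr_fun (x : M) : fixmod := FixMod (ee x).
Fact fix_pr_subproof : linear fix_pr_fun.
Proof. by move=> c x y; apply: fixmodP; rewrite /= linearP. Qed.
Definition fix_pr : {linear M -> fixmod} := mklin fix_pr_subproof.

Lemma fix_prK x : fix_pr (fval x) = x. Proof. by apply: fixmodP; apply: fvalP. Qed.

Lemma fix_dual : dual_basis M -> dual_basis fixmod.
Proof. apply: (dual_basis_retract (i := fix_in) (p := fix_pr)); exact: fix_prK. Qed.
End FixedSubmodule.

(** * Images of idempotents and truncations *)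

Section FixComplex.
Variables (k : fieldType) (A : falgType k) (I : nzRingType).

Section Def.
Variables (B : I -> lmodType A) (hB : forall i, dual_basis (B i)).
Variable D : forall i j, {linear B i -> B j}.
Hypothesis Dshape : forall i j x, j != i + 1 -> D i j x = 0.
Variable e : forall i, {linear B i -> B i}.
Hypothesis ee : forall i x, e i (e i x) = e i x.
Hypothesis eDeD : forall i j l x, e l (D j l (e j (D i j (e i x)))) = 0.

(** The maps D need not form a complex, nor e a chain map: only the compression of
D to the images of e has to square to zero.  Truncations, kernels of
deflations, cokernels of inflations and stalks of complexes are of this kind. *)
Program Definition fix_cplx : cplx A I :=
  @cplx_of k A I (fun i => fixmod (e i)) (fun i j => fix_pr (@ee j) \o (D i j \o fix_in (e i)))
    _ _ (fun i => fix_dual (@ee i) (hB i)).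
Next Obligation. by move=> i j x ij; apply: fixmodP; rewrite /= Dshape // linear0. Qed.
Next Obligation. by move=> i j l x; apply: fixmodP; rewrite /= -(fvalP x) eDeD. Qed.
End Def.

Lemma split_cplx (X : cplx A I) (u : cmor X X) : cmor_comp u u = u ->
  exists (Y : cplx A I) (i : cmor Y X) (p : cmor X Y),
    cmor_comp p i = cmor_id Y /\ cmor_comp i p = u.
Proof.
move=> uu; have ee i x : u i (u i x) = u i x by have := congr1 (fun v : cmor X X => v i x) uu.
have eDeD i j l x : u l (diff X j l (u j (diff X i j (u i x)))) = 0.
  by rewrite !mor_comm !diff_comp.
pose Y := fix_cplx (cob_dual X) (@diff_shape _ _ X) ee eDeD.
have ich i j (x : Y i) : fval (diff Y i j x) = diff X i j (fval x).
  by rewrite /= mor_comm fvalP.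
pose i := @CMor _ _ Y X (fun i => fix_in (u i)) ich.
have pch i' j (x : X i') : fix_pr (ee j) (diff X i' j x) = diff Y i' j (fix_pr (ee i') x).
  by apply: fixmodP; rewrite /= !mor_comm ee.
pose p := @CMor _ _ X Y (fun i => fix_pr (ee i)) pch.
by exists Y, i, p; split; apply: cmorP => // j x /=; apply: fix_prK.
Qed.
End FixComplex.

Section Splitting.
Variables (k : fieldType) (A : falgType k).

Lemma perL_splits m : splits_idem (perL A m).
Proof. by move=> X u /split_cplx. Qed.

Lemma concentrated_retract (X Y : cplx A int) (i : cmor Y X) (p : cmor X Y) a b :
  (forall j y, p j (i j y) = y) -> concentrated X a b -> concentrated Y a b.
Proof. by move=> pi cX j jab y; rewrite -(pi j y) (cX j jab (i j y)) linear0. Qed.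

Lemma bndL_splits : splits_idem (bndL A).
Proof.
move=> X u /split_cplx [Y [i [p [pi ip]]]].
have Yb : exists a b, concentrated Y a b.
  have [a [b ab]] := bcob_bounded X; exists a, b.
  apply: (@concentrated_retract _ _ i p) ab => j y.
  by have := congr1 (fun f : cmor Y Y => f j y) pi.
by exists (BCplx Yb), i, p.
Qed.
End Splitting.

Section Truncation.
Variables (k : fieldType) (A : falgType k) (X : cplx A int) (a b : int).

Definition tr_idem i : {linear X i -> X i} := 
  if a <= i <= b then (idfun : {linear X i -> X i}) else (\0 : {linear X i -> X i}).
Lemma tr_idemE i x : tr_idem i x = if a <= i <= b then x else 0.
Proof. by rewrite /tr_idem; case: ifP. Qed.
Lemma tr_idemK i x : tr_idem i (tr_idem i x) = tr_idem i x.
Proof. by rewrite !tr_idemE; case: (_ <= _ <= _). Qed.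
Lemma tr_comp i j l x : tr_idem l (diff X j l (tr_idem j (diff X i j (tr_idem i x)))) = 0.
Proof.
rewrite (tr_idemE (diff _ i j _)); case: ifP => _; last by rewrite !linear0.
by rewrite diff_comp linear0.
Qed.
Definition trunc_cplx : cplx A int :=
  fix_cplx (cob_dual X) (@diff_shape _ _ X) (@tr_idemK) (@tr_comp).

Lemma trunc_concentrated : concentrated trunc_cplx a b.
Proof.
by move=> i iab x; apply: fixmodP; rewrite -(fvalP x) tr_idemE (negPf iab).
Qed.
Definition trunc : bcplx A := BCplx (ex_intro _ a (ex_intro _ b trunc_concentrated)).

Variable N : cplx A int.
Hypothesis N_in : concentrated N (a + 1) (b - 1).

(** Brutal truncation to [a, b].  Maps to or from a complex N supported strictly
inside do not meet the differentials that were cut. *)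
Lemma to_trunc (f : cmor N X) : exists g : cmor N trunc, forall i x, fval (g i x) = f i x.
Proof.
have ch i j (x : N i) : fix_pr (@tr_idemK j) (f j (diff N i j x)) =
    diff trunc i j (fix_pr (@tr_idemK i) (f i x)).
  apply: fixmodP; rewrite /= mor_comm (tr_idemE (f i x)); case: ifP => // /negbT iab.
  have -> : x = 0 by apply: N_in; lia.
  by rewrite !linear0.
exists (@CMor _ _ N trunc (fun i => fix_pr (@tr_idemK i) \o f i) ch) => i x /=.
rewrite tr_idemE; case: ifP => // /negbT iab; have -> : x = 0 by apply: N_in; lia.
  by rewrite !linear0.
Qed.

Lemma from_trunc (g : cmor N trunc) : exists f : cmor N X, forall i x, f i x = fval (g i x).
Proof.
have ch i j (x : N i) : fval (g j (diff N i j x)) = diff X i j (fval (g i x)).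
  rewrite mor_comm /= tr_idemE; case: ifP => // /negbT jab.
  have [ej|nj] := eqVneq j (i + 1); last by rewrite diff_shape.
  have -> : x = 0 by apply: N_in; lia.
  by rewrite !linear0.
by exists (@CMor _ _ N X (fun i => fix_in (tr_idem i) \o g i) ch).
Qed.

Lemma trunc_to (g : cmor X N) : exists f : cmor trunc N, forall i x, f i x = g i (fval x).
Proof.
have ch i j (x : trunc i) : g j (fval (diff trunc i j x)) = diff N i j (g i (fval x)).
  rewrite /= -mor_comm tr_idemE; case: ifP => // /negbT jab.
  have -> : g j (diff X i j (fval x)) = 0 by apply: N_in; lia.
  by rewrite linear0.
by exists (@CMor _ _ trunc N (fun i => g i \o fix_in (tr_idem i)) ch).
Qed.

Lemma trunc_from (f : cmor trunc N) :
  exists g : cmor X N, forall i x, g i x = f i (fix_pr (@tr_idemK i) x).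
Proof.
have ch i j (x : X i) : f j (fix_pr (@tr_idemK j) (diff X i j x)) =
    diff N i j (f i (fix_pr (@tr_idemK i) x)).
  rewrite -mor_comm; have [ej|nj] := eqVneq j (i + 1); last first.
    by rewrite !diff_shape // !linear0.
  have [jab|jab] := boolP (a + 1 <= j <= b - 1); last first.
    by rewrite (N_in jab (f j _)) [RHS](N_in jab).
  congr (f j _); apply: fixmodP; rewrite /= [in RHS](tr_idemE x).
  by case: ifP => // /negbT; lia.
by exists (@CMor _ _ X N (fun i => f i \o fix_pr (@tr_idemK i)) ch).
Qed.

End Truncation.

(** * Null-homotopic maps and contractible complexes *)

Section NullHomotopy.
Variables (k : fieldType) (A : falgType k) (I : nzRingType).
Implicit Types X Y Z : cplx A I.

Definition hmap X Y (s : forall i j, {linear X i -> Y j}) i (x : X i) : Y i :=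
  diff Y (i - 1) i (s i (i - 1) x) + s (i + 1) i (diff X i (i + 1) x).
Definition nullh X Y (f : cmor X Y) := exists s, forall i x, f i x = @hmap X Y s i x.
Definition contractible X := nullh (cmor_id X).

Fact hmap_subproof X Y (s : forall i j, {linear X i -> Y j}) i : linear (@hmap X Y s i).
Proof. by move=> c x y; rewrite /hmap !linearP scalerDr addrACA. Qed.

Lemma hmap_comm X Y (s : forall i j, {linear X i -> Y j}) i j x :
  @hmap X Y s j (diff X i j x) = diff Y i j (@hmap X Y s i x).
Proof.
have [->|nj] := eqVneq j (i + 1); last by rewrite !(diff_shape _ nj) /hmap !linear0 addr0.
by rewrite /hmap !linearD !diff_comp linear0 addr0 add0r addrK.
Qed.

Definition null_cmor X Y (s : forall i j, {linear X i -> Y j}) : cmor X Y :=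
  @CMor _ _ X Y (fun i => mklin (@hmap_subproof X Y s i)) (@hmap_comm X Y s).

Lemma null_cmor_nullh X Y s : nullh (@null_cmor X Y s).
Proof. by exists s. Qed.

Lemma homotopicE X Y (f g : cmor X Y) : homotopic f g <-> nullh (f - g).
Proof. by []. Qed.

Lemma nullh_lin X Y c (f g : cmor X Y) : nullh f -> nullh g -> nullh (c *: f + g).
Proof.
move=> [s fs] [t gt]; exists (fun i j => c *: (s i j : linT _ _) + t i j : linT _ _) => i x.
rewrite cmor_addE cmor_scaleE fs gt /hmap /= !linearD !linearZ /= scalerDr.
by rewrite addrACA.
Qed.

Lemma nullhD X Y (f g : cmor X Y) : nullh f -> nullh g -> nullh (f + g).
Proof. by move=> hf hg; rewrite -[f]scale1r; apply: nullh_lin. Qed.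
Lemma nullh0 X Y : nullh (0 : cmor X Y).
Proof. by exists (fun _ _ => \0) => i x; rewrite /hmap /= linear0 addr0. Qed.
Lemma nullhN X Y (f : cmor X Y) : nullh f -> nullh (- f).
Proof. by move=> hf; rewrite -scaleN1r -[_ *: _]addr0; apply: nullh_lin => //; apply: nullh0. Qed.
Lemma nullh_compl X Y Z (g : cmor Y Z) (f : cmor X Y) : nullh f -> nullh (cmor_comp g f).
Proof.
move=> [s fs]; exists (fun i j => g j \o s i j) => i x.
by rewrite /= fs /hmap linearD /= mor_comm.
Qed.
Lemma nullh_compr X Y Z (g : cmor Y Z) (f : cmor X Y) : nullh g -> nullh (cmor_comp g f).
Proof.
move=> [s fs]; exists (fun i j => s i j \o f i) => i x.
by rewrite /= fs /hmap /= mor_comm.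
Qed.

(** For a contraction s0, the maps s0 d in degree i and d s0 in degree i + 1 form
an idempotent chain map.  If they vanished for all i so would the identity;
where they are the identity, X is concentrated in the degrees i and i + 1. *)
Lemma contractible_indec X : contractible X ->
  (forall u : cmor X X, cmor_comp u u = u -> u = 0 \/ u = cmor_id X) -> cmor_id X <> 0 ->
  exists i (s : {linear X (i + 1) -> X i}),
    [/\ forall j, j != i -> j != i + 1 -> forall x : X j, x = 0,
      forall x : X i, s (diff X i (i + 1) x) = x & forall x, diff X i (i + 1) (s x) = x].
Proof.
move=> [s0 sh0] idem nz.
have sh i (x : X i) : x = diff X (i - 1) i (s0 i (i - 1) x) + s0 (i + 1) i (diff X i (i + 1) x).
  exact: sh0.
have dsd j l (x : X j) : l = j + 1 -> diff X j l (s0 l j (diff X j l x)) = diff X j l x.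
  move=> el; have := sh l (diff X j l x); rewrite diff_comp linear0 addr0.
  by rewrite (_ : l - 1 = j) ?el ?addrK // => ->.
pose u i j : {linear X j -> X j} :=
  if j == i then (s0 (j + 1) j \o diff X j (j + 1) : {linear _ -> _}) else
  if j == i + 1 then (diff X (j - 1) j \o s0 j (j - 1) : {linear _ -> _}) else (\0 : {linear _ -> _}).
have n1 (i : I) : i + 1 != i by rewrite -subr_eq0 addrAC subrr add0r oner_neq0.
have uch i j l x : u i l (diff X j l x) = diff X j l (u i j x).
  have [el|nl] := eqVneq l (j + 1); last by rewrite !(diff_shape _ nl) linear0.
  rewrite /u; case: (eqVneq j i) => [ej|nj].
    by subst i l; rewrite (negPf (n1 j)) eqxx /= addrK dsd.
  rewrite (_ : (l == i + 1) = false); last by rewrite el (inj_eq (addIr 1)) (negPf nj).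
  have -> : diff X j l ((if j == i + 1 then (diff X (j - 1) j \o s0 j (j - 1) : {linear _ -> _})
       else (\0 : {linear _ -> _})) x) = 0 by case: ifP; rewrite /= ?diff_comp ?linear0.
  by case: ifP; rewrite /= ?diff_comp ?linear0.
pose U i : cmor X X := CMor (uch i).
have UU i : cmor_comp (U i) (U i) = U i.
  apply: cmorP => j x /=; rewrite /u; case: ifP => [_|nj] /=; first by rewrite dsd.
  by case: ifP => [/eqP ej|_] //=; rewrite dsd ?subrK.
have [[i Ui]|nU] := pselect (exists i, U i = cmor_id X); last first.
  case: nz; apply: cmorP => j x; rewrite /= [LHS](sh j).
  have U0 i : U i = 0 by case: (idem _ (UU i)) => // e; case: nU; exists i.
  have := congr1 (fun f : cmor X X => f j x) (U0 j); rewrite /= /u eqxx /= => ->.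
  have := congr1 (fun f : cmor X X => f j x) (U0 (j - 1)).
  rewrite /= /u subrK eqxx (_ : (j == j - 1) = false) /=; first by rewrite addr0.
  by rewrite -[X in X == _](subrK 1) (negPf (n1 _)).
have UE j x : u i j x = x by have := congr1 (fun f : cmor X X => f j x) Ui.
exists i, (s0 (i + 1) i); split=> [j ji ji1 x|x|x].
- by rewrite -(UE j x) /u (negPf ji) (negPf ji1).
- by rewrite -[RHS]UE /u eqxx.
by have := UE _ x; rewrite /u (negPf (n1 i)) eqxx /= addrK.
Qed.
End NullHomotopy.

Section BoundedSupport.
Variables (k : fieldType) (A : falgType k) (nu : nat).
Hypothesis hnu : sgldim A nu.
Notation L := (bndL A).

Lemma cmor_isoP (X Y : bcplx A) (f : cmor X Y) (g : cmor Y X) :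
  @lcomp k L _ _ _ g f = lid (X : L) -> forall i x, g i (f i x) = x.
Proof. by move=> e i x; have := congr1 (fun h : cmor X X => h i x) e. Qed.

Lemma liso_nullh (X : bcplx A) (n : cmor X X) : nullh n -> liso (n : @lhom k L X X) -> contractible X.
Proof. by move=> hn [g [gn _]]; rewrite /contractible -[cmor_id X]gn; apply: nullh_compl. Qed.

(** A null-homotopic endomorphism of X is not invertible.  As the ring of
endomorphisms is local, one summand of a decomposition up to homotopy gives an
invertible endomorphism, and the other one is contractible. *)
Lemma indec_Kb (X : bcplx A) : lindec L X -> ~ contractible X -> @indecomposable (Kb A) X.
Proof.
move=> iX nX; split.
  by move/homotopicE => h; apply: nX; move: h; rewrite [_ - _]subr0.
move=> Y [i [p [pi ort tot]]].
pose e j : cmor X X := cmor_comp (i j) (p j).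
have ort' j l : j != l -> nullh (cmor_comp (p l) (i j)).
  by move=> /ort /homotopicE; rewrite [_ - _]subr0.
have null_of j l : j != l -> liso (e l : @lhom k L X X) -> @is_zero (Kb A) (Y j).
  move=> jl [g eg].
  have ej : nullh (e j).
    have -> : e j = cmor_comp (cmor_comp g (i l)) (cmor_comp (cmor_comp (p l) (i j)) (p j)).
      apply: cmorP => d x /=; have [ge _] := eg.
      by have /cmor_isoP -> := ge.
    by apply: nullh_compl; apply: nullh_compr; apply: ort'.
  apply/homotopicE; rewrite [_ - _]subr0.
  pose q : cmor (Y j) (Y j) := cmor_comp (p j) (i j).
  have hq : nullh (q - cmor_id (Y j)) by apply/homotopicE; apply: pi.
  have -> : idm (Y j) = cmor_comp (p j) (cmor_comp (e j) (i j))
      - cmor_comp q (q - cmor_id (Y j)) - (q - cmor_id (Y j)).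
    apply: cmorP => d x; rewrite !(cmor_addE, cmor_oppE) /= !linearB /=.
    by rewrite !opprK !addrA subrr add0r subrr add0r.
  apply: nullhD; last exact: nullhN.
  apply: nullhD; first by apply: nullh_compl; apply: nullh_compr.
  by apply/nullhN/nullh_compl.
move: tot; rewrite !big_ord_recl big_ord0 => /homotopicE tot.
pose n : cmor X X := cmor_id X - (e ord0 + e (lift ord0 ord0)).
have hn : nullh n.
  have := nullhN tot; congr nullh; rewrite opprB; congr (_ - _).
  by rewrite /= [X in cmor_add _ X](addr0 (e (lift ord0 ord0))).
have : liso (n + (e ord0 + e (lift ord0 ord0)) : @lhom k L X X).
  by rewrite subrK; apply: liso_id.
case/(indec_liso_add (@bndL_splits k A) iX) => [/(liso_nullh hn)//|].
case/(indec_liso_add (@bndL_splits k A) iX) => h.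
  by exists (lift ord0 ord0); apply: null_of h.
by exists ord0; apply: null_of h.
Qed.

(** If X is homotopy equivalent to Y through f and g, then g f is invertible,
since 1 - g f is null-homotopic; so the terms of X are summands of those of Y.
The bound is nu + 1, and not nu, because of the contractible complexes, of
width 1, which are zero up to homotopy. *)
Lemma bounded_support (X : bcplx A) : lindec L X -> exists a, concentrated X a (a + nu.+1%:Z).
Proof.
move=> iX; have [cX|nX] := pselect (contractible X).
  have [||i [s [out _ _]]] := contractible_indec cX.
  - by move=> u uu; apply: (indec_idem (@bndL_splits k A) iX).
  - exact: indec_nonzero iX.
  by exists i => j jn x; apply: out; apply: contraNneq jn => ->; lia.
have iK := indec_Kb iX nX.
pose P n := `[< @width_le A X n >].
have exP : exists n, P n.
  have [a [b ab]] := bcob_bounded X; exists `|b - a|%N; apply/asboolP.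
  exists a, X; split.
    by exists (cmor_id X), (cmor_id X); split; apply/homotopicE;
      rewrite [X in nullh X](_ : _ = 0); try exact: nullh0; apply: cmorP => j x; apply: subrr.
  by move=> i ni x; apply: ab; lia.
case: (ex_minnP exP) => n /asboolP wn nmin.
have nnu : (n <= nu)%N.
  by apply: (hnu.1 X) => //; split=> // n' w; apply: nmin; apply/asboolP.
have [a [Y [[f [g [/homotopicE gf _]]] cY]]] := wn; exists a => i ia x.
pose gf' : cmor X X := cmor_comp g f.
have : liso ((cmor_id X - gf') + gf' : @lhom k L X X) by rewrite subrK; apply: liso_id.
case/(indec_liso_add (@bndL_splits k A) iX).
  move/liso_nullh => h; case: nX; apply: h.
  by rewrite -opprB; apply: nullhN.
case=> r [/cmor_isoP rgf _]; rewrite -(rgf i x) /=.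
by rewrite (cY i _ (f i x)) ?linear0 ?linear0 //; lia.
Qed.

End BoundedSupport.

(** * Compression and unrolling *)

Section Cast.
Variables (R : nzRingType) (I : eqType) (M : I -> lmodType R).

(** A transport between degrees that is total, and zero between different
degrees: it may be used before the degrees are known to agree. *)
Definition ccast_fun i j (x : M i) : M j :=
  if @eqP _ i j is ReflectT e then ecast z (M z) e x else 0.
Lemma ccast_fun_id i (x : M i) : ccast_fun i x = x.
Proof. by rewrite /ccast_fun; case: eqP => // e; rewrite eq_axiomK. Qed.
Lemma ccast_fun_ne i j (x : M i) : i != j -> ccast_fun j x = 0.
Proof. by rewrite /ccast_fun; case: eqP. Qed.
Fact ccast_subproof i j : linear (@ccast_fun i j).
Proof.
move=> c x y; have [ij|ij] := eqVneq i j; first by subst j; rewrite !ccast_fun_id.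
by rewrite !ccast_fun_ne // scaler0 addr0.
Qed.
Definition ccast i j : {linear M i -> M j} := mklin (@ccast_subproof i j).
Lemma ccast_id i x : ccast i i x = x. Proof. exact: ccast_fun_id. Qed.
Lemma ccast_ne i j x : i != j -> ccast i j x = 0. Proof. exact: ccast_fun_ne. Qed.
End Cast.
Arguments ccast {R I M} i j.

Lemma ccast_diff (R I : nzRingType) (M : cplx R I) i i' j j' x : i = i' -> j = j' ->
  diff M i' j' (ccast i i' x) = ccast j j' (diff M i j x).
Proof. by move=> <- <-; rewrite !ccast_id. Qed.

Section DSumFacts.
Variables (k : fieldType) (A : falgType k) (m : nat).
Implicit Types X N : bcplx A.
Notation dinj X i0 j := (@dsum_inj A m X i0 j).

Lemma dsum_linP X (i0 : 'Z_m) (W : lmodType A) (f g : {linear dsum X i0 -> W}) :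
  (forall j v, j%:~R = i0 -> f (dinj X i0 j v) = g (dinj X i0 j v)) -> forall x, f x = g x.
Proof.
move=> e x; have [a [n dec]] := @dsum_decomp A m X i0 (bcob_bounded X).
rewrite (dec x) !linear_sum; apply: eq_bigr => t _.
have [ej|nj] := eqVneq ((a + t%:Z)%:~R : 'Z_m) i0; first exact: e.
suff -> : dinj X i0 (a + t%:Z) (x (a + t%:Z)) = 0 by rewrite !linear0.
by rewrite (fam_res _ nj) linear0.
Qed.

Lemma dinj_in X (i0 : 'Z_m) j (v : X j) : j%:~R = i0 -> dinj X i0 j v j = v.
Proof. by move=> ej; rewrite /= dfwith_in ej eqxx. Qed.

Lemma compr_diff_inj X (i i' : 'Z_m) j (v : X j) : i' = i + 1 ->
  compr_diff X i i' (dinj X i j v) = dinj X i' (j + 1) (diff X j (j + 1) v).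
Proof.
move=> ei; apply: dsumP => l /=; rewrite ei eqxx.
have cls : ((j + 1)%:~R == i + 1 :> 'Z_m) = (j%:~R == i :> 'Z_m).
  by rewrite intrD mulr1z (inj_eq (addIr 1)).
have [el|nl] := eqVneq (j + 1) l.
  subst l; rewrite addrK !dfwith_in cls.
  by case: ifP; rewrite ?linear0.
rewrite !dfwith_out ?linear0 //; apply: contraNneq nl => ->; by rewrite subrK.
Qed.
End DSumFacts.

Section Unroll.
Variables (k : fieldType) (A : falgType k) (m : nat).
Implicit Types X Y N : bcplx A.
Implicit Types M : cplx A 'Z_m.
Notation dinj X i0 j := (@dsum_inj A m X i0 j).
Notation F X := (compr_ob m X : cplx A 'Z_m).

Lemma int_modS (i : int) : ((i + 1)%:~R : 'Z_m) = i%:~R + 1.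
Proof. by rewrite intrD mulr1z. Qed.

Definition udiff M (i j : int) : {linear M i%:~R -> M j%:~R} :=
  if j == i + 1 then diff M i%:~R j%:~R else (\0 : {linear M i%:~R -> M j%:~R}).
Lemma udiffE M (i j : int) x : udiff M i j x = if j == i + 1 then diff M i%:~R j%:~R x else 0.
Proof. by rewrite /udiff; case: ifP. Qed.

Program Definition unroll M : cplx A int :=
  @Cplx A int (fun i => M i%:~R) (fun i j => udiff M i j) _ _ _ _.
Next Obligation. by move=> M i j x /negPf nj; rewrite udiffE nj. Qed.
Next Obligation.
by move=> M i j l x; rewrite !udiffE; do 2!case: ifP => _ //; rewrite ?linear0 ?diff_comp.
Qed.
Next Obligation. by move=> M i; apply: cob_fg. Qed.
Next Obligation. by move=> M i; apply: cob_proj. Qed.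

Lemma unroll_diff M i j x : diff (unroll M) i j x = if j == i + 1 then diff M i%:~R j%:~R x else 0.
Proof. exact: udiffE. Qed.

Program Definition unroll_mor M M' (f : cmor M M') : cmor (unroll M) (unroll M') :=
  @CMor _ _ (unroll M) (unroll M') (fun i => f i%:~R) _.
Next Obligation. by move=> M M' f i j x; rewrite !unroll_diff; case: ifP; rewrite ?mor_comm ?linear0. Qed.

Lemma int_surj (i0 : 'Z_m) : exists i : int, i0 = i%:~R.
Proof. by exists (i0 : nat)%:Z; rewrite -pmulrn natr_Zp. Qed.

Definition sdeg N : seq int :=
  let a := sval (cid (bcob_bounded N)) in let b := sval (cid (svalP (cid (bcob_bounded N)))) in
  [seq a + (t : nat)%:Z | t <- iota 0 `|b - a|.+1].
Lemma sdeg_uniq N : uniq (sdeg N).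
Proof. rewrite /sdeg map_inj_uniq ?iota_uniq // => x y /addrI; lia. Qed.
Lemma sdegP N j (x : N j) : j \notin sdeg N -> x = 0.
Proof.
move=> nj; apply: (svalP (cid (svalP (cid (bcob_bounded N))))).
apply: contra nj => h; apply/mapP; exists `|j - sval (cid (bcob_bounded N))|%N.
  by rewrite mem_iota; lia.
lia.
Qed.

Lemma sum_one (V : zmodType) (s : seq int) j0 (G : int -> V) : uniq s ->
  (forall j, j != j0 -> G j = 0) -> (j0 \notin s -> G j0 = 0) -> \sum_(j <- s) G j = G j0.
Proof.
move=> us Gz G0; have [js|/[dup] js /G0 ->] := boolP (j0 \in s).
  by rewrite (bigD1_seq j0) //= big1 ?addr0.
by rewrite big_seq big1 // => j jn; apply: Gz; apply: contraNneq js => <-.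
Qed.

Section Flat.
Variables (N : bcplx A) (M : cplx A 'Z_m) (f : cmor N (unroll M)).
Definition flat_fun i0 (x : dsum N i0) : M i0 := \sum_(j <- sdeg N) ccast j%:~R i0 (f j (x j)).
Fact flat_subproof i0 : linear (@flat_fun i0).
Proof.
move=> c x y; rewrite /flat_fun scaler_sumr -big_split; apply: eq_bigr => j _.
by rewrite (_ : (c *: x + y) j = c *: x j + y j) // !linearP.
Qed.
Lemma flat_inj i0 j v : j%:~R = i0 -> flat_fun (dinj N i0 j v) = ccast j%:~R i0 (f j v).
Proof.
move=> ej; rewrite /flat_fun (@sum_one _ _ j) ?sdeg_uniq ?dinj_in // => [l nl|nj].
  by rewrite dsum_inj_other ?linear0 // eq_sym.
by rewrite (sdegP v nj) !linear0.
Qed.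
Lemma flat_comm i i' (x : dsum N i) :
  mklin (@flat_subproof i') (diff (F N) i i' x) = diff M i i' (mklin (@flat_subproof i) x).
Proof.
have [ei|ni] := eqVneq i' (i + 1); last by rewrite !(diff_shape _ ni) linear0.
apply: (@dsum_linP _ A m N i _ (mklin (@flat_subproof i') \o diff (F N) i i')
  (diff M i i' \o mklin (@flat_subproof i))) => j v ej.
have ej1 : (j + 1)%:~R = i' by rewrite int_modS ej ei.
change (flat_fun (compr_diff N i i' (dinj N i j v)) = diff M i i' (flat_fun (dinj N i j v))).
rewrite compr_diff_inj // !flat_inj // mor_comm unroll_diff eqxx.
by rewrite -(ccast_diff _ ej ej1).
Qed.
Definition flat : cmor (F N) M :=
  @CMor _ _ (F N) M (fun i => mklin (@flat_subproof i)) flat_comm.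
End Flat.

Section Sharp.
Variables (N : bcplx A) (M : cplx A 'Z_m) (f : cmor (unroll M) N).
Program Definition sharp_fun i0 (y : M i0) : dsum N i0 :=
  @DSum _ _ _ _ (fun j => f j (ccast i0 j%:~R y)) _ _.
Next Obligation.
move=> i0 y; have [a [b ab]] := bcob_bounded N; exists a, b => j jab; exact: ab.
Qed.
Next Obligation. by move=> i0 y j nj /=; rewrite ccast_fun_ne ?linear0 // eq_sym. Qed.
Fact sharp_subproof i0 : linear (@sharp_fun i0).
Proof.
move=> c x y; apply: dsumP => j.
exact: (linearP (f j \o ccast i0 j%:~R : {linear _ -> _}) c x y).
Qed.
Lemma sharp_comm i i' (y : M i) :
  mklin (@sharp_subproof i') (diff M i i' y) = diff (F N) i i' (mklin (@sharp_subproof i) y).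
Proof.
have [ei|ni] := eqVneq i' (i + 1); last by rewrite !(diff_shape _ ni) linear0.
apply: dsumP => j /=; rewrite ei eqxx.
have [ej|nj] := eqVneq (i + 1) (j%:~R : 'Z_m); last first.
  rewrite [ccast_fun j%:~R _]ccast_fun_ne // [ccast_fun (j - 1)%:~R _]ccast_fun_ne ?linear0 //.
  by apply: contraNneq nj => ->; rewrite -int_modS subrK.
have ei1 : i = (j - 1)%:~R by rewrite intrB mulr1z -ej addrK.
apply: etrans (mor_comm f j (ccast i (j - 1)%:~R y : unroll M (j - 1))).
by rewrite unroll_diff subrK eqxx (ccast_diff _ ei1 ej).
Qed.
Definition sharp : cmor M (F N) :=
  @CMor _ _ M (F N) (fun i => mklin (@sharp_subproof i)) sharp_comm.
End Sharp.

Section Components.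
Variable X : bcplx A.

(** The inclusion of X as the sheet 0 of U (F X), and the projection onto it: the
unit and the counit of the two adjunctions. *)
Program Definition sheet0_in : cmor X (unroll (F X)) :=
  @CMor _ _ X (unroll (F X)) (fun i => dinj X i%:~R i) _.
Next Obligation.
move=> i j x; rewrite unroll_diff; case: eqP => [->|/eqP nj]; last by rewrite (diff_shape _ nj) linear0.
by apply/esym/compr_diff_inj; rewrite int_modS.
Qed.

Fact sheet0_out_subproof i : linear (fun x : dsum X (i%:~R : 'Z_m) => x i). Proof. by []. Qed.
Program Definition sheet0_out : cmor (unroll (F X)) X :=
  @CMor _ _ (unroll (F X)) X (fun i => mklin (@sheet0_out_subproof i)) _.
Next Obligation.
move=> i j x; rewrite unroll_diff; case: eqP => [->|/eqP nj]; last by rewrite (diff_shape _ nj).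
by rewrite /= int_modS eqxx addrK.
Qed.
End Components.

Lemma flatK N M (f : cmor N (unroll M)) : cmor_comp (unroll_mor (flat f)) (sheet0_in N) = f.
Proof.
apply: cmorP => i x; change (flat_fun f (dinj N i%:~R i x) = f i x).
by rewrite flat_inj // ccast_id.
Qed.

Lemma sharpK N M (f : cmor (unroll M) N) : cmor_comp (sheet0_out N) (unroll_mor (sharp f)) = f.
Proof. by apply: cmorP => i x; rewrite /= ccast_fun_id. Qed.

Lemma flat_unique N M (f g : cmor (F N) M) :
  cmor_comp (unroll_mor f) (sheet0_in N) = cmor_comp (unroll_mor g) (sheet0_in N) -> f = g.
Proof.
move=> e; apply: cmorP => i0; apply: (@dsum_linP _ A m N i0) => j v ej; subst i0.
by have := congr1 (fun h : cmor N (unroll M) => h j v) e.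
Qed.

Lemma sharp_unique N M (f g : cmor M (F N)) :
  cmor_comp (sheet0_out N) (unroll_mor f) = cmor_comp (sheet0_out N) (unroll_mor g) -> f = g.
Proof.
move=> e; apply: cmorP => i0 y; apply: dsumP => j.
have [ej|nj] := eqVneq (j%:~R : 'Z_m) i0; last by rewrite !(fam_res _ nj).
subst i0; by have := congr1 (fun h : cmor (unroll M) N => h j y) e.
Qed.

Definition sheet0_part X Y (f : cmor (F X) (F Y)) : cmor X Y :=
  cmor_comp (sheet0_out Y) (cmor_comp (unroll_mor f) (sheet0_in X)).

Lemma sheet0_in_nat X Y (f : cmor X Y) :
  cmor_comp (unroll_mor (compr m (f : @homset (Cb A) X Y))) (sheet0_in X) = cmor_comp (sheet0_in Y) f.
Proof.
apply: cmorP => i x; apply: dsumP => j /=; have [<-|nj] := eqVneq i j.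
  by rewrite !dfwith_in eqxx.
by rewrite !dfwith_out // linear0.
Qed.

Lemma sheet0_inK X : cmor_comp (sheet0_out X) (sheet0_in X) = cmor_id X.
Proof. by apply: cmorP => i x /=; rewrite dfwith_in eqxx. Qed.

End Unroll.

(** * Shifts and sheets *)

Section Shift.
Variables (k : fieldType) (A : falgType k).
Implicit Types X Y : bcplx A.

Program Definition shift_cplx (c : int) X : cplx A int :=
  @Cplx A int (fun i => X (i + c)) (fun i j => diff X (i + c) (j + c)) _ _ _ _.
Next Obligation.
move=> c X i j x nj; apply: diff_shape; apply: contraNneq nj => e.
by apply/eqP/(addIr c); rewrite e addrAC.
Qed.
Next Obligation. by move=> c X i j l x; apply: diff_comp. Qed.
Next Obligation. by move=> c X i; apply: cob_fg. Qed.
Next Obligation. by move=> c X i; apply: cob_proj. Qed.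

Lemma shift_bounded c X : exists a b, concentrated (shift_cplx c X) a b.
Proof.
by have [a [b ab]] := bcob_bounded X; exists (a - c), (b - c) => i h x; apply: ab; lia.
Qed.
Definition shift c X : bcplx A := BCplx (shift_bounded c X).

Program Definition shift_mor c X Y (f : cmor X Y) : cmor (shift c X) (shift c Y) :=
  @CMor _ _ (shift c X) (shift c Y) (fun i => f (i + c)) _.
Next Obligation. by move=> c X Y f i j x; exact: (mor_comm f (j + c) (x : X (i + c))). Qed.

Definition nz X i := exists x : X i, x <> 0.

(** The support of X is bounded and nonempty; it has no period. *)
Lemma nz_translate X c : (exists i, nz X i) -> (forall i, nz X i <-> nz X (i + c)) -> c = 0.
Proof.
move=> [i ni] tr; apply/eqP/negPn/negP => c0.
have nzn n : nz X (i + c * n%:Z).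
  elim: n => [|n IH]; first by rewrite mulr0 addr0.
  by rewrite (_ : i + c * n.+1%:Z = i + c * n%:Z + c) -?tr //; lia.
have [a [b ab]] := bcob_bounded X.
have [x []] := nzn (`|b - i| + `|a - i|).+1%N; apply: ab.
by move: c0; nia.
Qed.

Lemma nonzero_nz X : lid (X : bndL A) <> 0 -> exists i, nz X i.
Proof.
move=> X0; apply: contrapT => /forallNP h; apply: X0; apply: cmorP => i x.
by apply: contrapT => x0; apply: (h i); exists x.
Qed.

Lemma liso_nz X Y (f : @lhom k (bndL A) X Y) : liso f -> forall i, nz X i <-> nz Y i.
Proof.
move=> [g [/cmor_isoP gf /cmor_isoP fg]] i; split=> -[x x0].
  by exists ((f : cmor X Y) i x) => e; apply: x0; rewrite -(gf i x) e linear0.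
by exists ((g : cmor Y X) i x) => e; apply: x0; rewrite -(fg i x) e linear0.
Qed.

Lemma shift_liso_eq c c' X (f : @lhom k (bndL A) (shift c X) (shift c' X)) :
  lid (X : bndL A) <> 0 -> liso f -> c = c'.
Proof.
move=> /nonzero_nz nX /liso_nz h; apply/esym/subr0_eq/(nz_translate nX) => i.
have := h (i - c); rewrite /nz /= subrK.
by rewrite (_ : i - c + c' = i + (c' - c)) // addrAC addrA.
Qed.

Lemma shift_liso0 c X (f : @lhom k (bndL A) X (shift c X)) :
  lid (X : bndL A) <> 0 -> liso f -> c = 0.
Proof. by move=> /nonzero_nz nX /liso_nz h; apply: (nz_translate nX) => i; apply: h. Qed.

Section Unshift.
Variables (c : int) (X : bcplx A) (e : cmor (shift c X) (shift c X)).
Let E (i : int) : {linear X (i - c + c) -> X (i - c + c)} := e (i - c).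
Definition unshift_fun i : {linear X i -> X i} :=
  ccast (i - c + c) i \o (E i \o ccast i (i - c + c)).
Lemma unshift_comm i j x : unshift_fun j (diff X i j x) = diff X i j (unshift_fun i x).
Proof.
rewrite /unshift_fun /E /=.
have ei : i = i - c + c by rewrite subrK.
have ej : j = j - c + c by rewrite subrK.
have cd i1 i2 j1 j2 (y : X i1) : i1 = i2 -> j1 = j2 ->
    ccast_fun j2 (diff X i1 j1 y) = diff X i2 j2 (ccast_fun i2 y).
  by move=> <- <-; rewrite !ccast_fun_id.
rewrite (cd _ _ _ _ _ ei ej) -(cd _ _ _ _ _ (esym ei) (esym ej)); congr (ccast_fun _ _).
exact: (mor_comm e (j - c) (@ccast_fun A _ X i (i - c + c) x : shift c X (i - c))).
Qed.
Definition unshift : cmor X X := CMor unshift_comm.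
Lemma unshiftK : shift_mor c unshift = e.
Proof.
apply: cmorP => i x /=.
have gen i' (y : X (i + c)) : i' = i ->
    @ccast_fun A _ X (i' + c) (i + c) (e i' (@ccast_fun A _ X (i + c) (i' + c) y)) = e i y.
  by move=> ->; rewrite !ccast_fun_id.
by apply: gen; rewrite addrK.
Qed.
End Unshift.

Lemma shift_mor_inj c X (f g : cmor X X) : shift_mor c f = shift_mor c g -> f = g.
Proof.
move=> e; apply: cmorP => i x; have h j y : f (j + c) y = g (j + c) y.
  by have := congr1 (fun u : cmor (shift c X) (shift c X) => u j y) e.
by have := h (i - c); rewrite subrK; apply.
Qed.

Lemma shift_mor_comp c X (f g : cmor X X) :
  shift_mor c (cmor_comp g f) = cmor_comp (shift_mor c g) (shift_mor c f).
Proof. exact: cmorP. Qed.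

Lemma shift_indec c X : lindec (bndL A) X -> lindec (bndL A) (shift c X).
Proof.
move=> iX; apply: idem_indec => [e0|e ee].
  apply: (indec_nonzero iX); apply: (@shift_mor_inj c); apply: etrans (etrans e0 _); exact: cmorP.
have [|h|h] := @indec_idem k (bndL A) (@bndL_splits k A) X (unshift (e : cmor (shift c X) (shift c X))) iX.
- apply: (@shift_mor_inj c); rewrite shift_mor_comp unshiftK; exact: ee.
- by left; rewrite -[e]unshiftK h; apply: cmorP.
by right; rewrite -[e]unshiftK h; apply: cmorP.
Qed.

Lemma shift_mor_liso c X (u : cmor X X) :
  liso (shift_mor c u : @lhom k (bndL A) (shift c X) (shift c X)) -> liso (u : @lhom k (bndL A) X X).
Proof.
move=> [g [gu ug]]; exists (unshift g); split; apply: (@shift_mor_inj c);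
  rewrite shift_mor_comp unshiftK; [apply: etrans gu _|apply: etrans ug _]; exact: cmorP.
Qed.

End Shift.

Section Components.
Variables (k : fieldType) (A : falgType k) (m : nat).
Implicit Types X Y W : bcplx A.
Notation F X := (compr_ob m X : cplx A 'Z_m).
Notation U M := (unroll M).

Section JQ.
Variables (X : bcplx A) (c : int).
Lemma sheet_in_comm i j (x : shift c X i) :
  @dsum_inj A m X j%:~R (j + c) (diff (shift c X) i j x) =
  diff (U (F X)) i j (@dsum_inj A m X i%:~R (i + c) x).
Proof.
rewrite unroll_diff; case: eqP => [->|/eqP nj]; last by rewrite (diff_shape _ nj) linear0.
apply/esym; rewrite [LHS]compr_diff_inj ?int_modS // addrAC.
by [].
Qed.
Definition sheet_in : cmor (shift c X) (U (F X)) :=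
  @CMor _ _ (shift c X) (U (F X)) (fun i => @dsum_inj A m X i%:~R (i + c)) sheet_in_comm.
Fact sheet_out_subproof i : linear (fun x : dsum X (i%:~R : 'Z_m) => x (i + c)). Proof. by []. Qed.
Lemma sheet_out_comm i j (x : U (F X) i) :
  mklin (@sheet_out_subproof j) (diff (U (F X)) i j x) = diff (shift c X) i j (mklin (@sheet_out_subproof i) x).
Proof.
rewrite unroll_diff; case: eqP => [->|/eqP nj]; last by rewrite (diff_shape _ nj).
by rewrite /= int_modS eqxx addrAC addrK.
Qed.
Definition sheet_out : cmor (U (F X)) (shift c X) :=
  @CMor _ _ (U (F X)) (shift c X) (fun i => mklin (@sheet_out_subproof i)) sheet_out_comm.
End JQ.

Lemma sheet_in_zero X c : c%:~R != 0 :> 'Z_m -> sheet_in X c = 0.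
Proof.
move=> c0; apply: cmorP => i x; apply: dsumP => l /=.
have [<-|nl] := eqVneq (i + c) l; last by rewrite dfwith_out.
rewrite dfwith_in intrD -subr_eq0 addrAC subrr add0r (negPf c0) //.
Qed.

(** The projections onto the sheets add up to the identity of U (F X); on the
image of a bounded complex W finitely many of them are nonzero.  Only sheets
with c divisible by m are nonzero ([sheet_in_zero]). *)
Lemma sheets_complete X W : exists K : nat, forall a : cmor W (U (F X)),
  a = \sum_(t < K.*2.+1) cmor_comp (sheet_in X (t%:Z - K%:Z)) (cmor_comp (sheet_out X (t%:Z - K%:Z)) a).
Proof.
have [a1 [b1 ab1]] := bcob_bounded W; have [a2 [b2 ab2]] := bcob_bounded X.
exists (`|a1 - a2| + `|a1 - b2| + `|b1 - a2| + `|b1 - b2|)%N => a.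
set K := (_ + _)%N; apply: cmorP => i x; rewrite cmor_sumE.
have [i_in|/ab1 x0] := boolP (a1 <= i <= b1); last first.
  by rewrite (x0 x) linear0 big1 // => t _; rewrite linear0.
apply: dsumP => l; rewrite dsum_sumE.
have [l_in|/ab2 y0] := boolP (a2 <= l <= b2); last first.
  by rewrite (y0 (a i x l)) big1 // => t _; apply: y0.
have t_lt : (absz (l - i + K%:Z)%R < K.*2.+1)%N by lia.
have et : i + ((absz (l - i + K%:Z))%:Z - K%:Z) = l by lia.
rewrite (bigD1 (Ordinal t_lt)) //= et big1 => [|t nt].
  rewrite addr0 dfwith_in; case: ifP => // /negbT ni.
  by rewrite fam_res.
rewrite dfwith_out //; apply: contraNneq nt => e.
by apply/eqP/val_inj => /=; lia.
Qed.

Definition sheet_part X Y c c' (f : cmor (F X) (F Y)) : cmor (shift c X) (shift c' Y) :=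
  cmor_comp (sheet_out Y c') (cmor_comp (unroll_mor f) (sheet_in X c)).

Lemma sheet_part_shift X c (f : cmor (F X) (F X)) : c%:~R = 0 :> 'Z_m -> sheet_part c c f = shift_mor c (sheet0_part f).
Proof.
move=> c0; apply: cmorP => i x.
change ((f i%:~R (@dsum_inj A m X i%:~R (i + c) x)) (i + c) =
  (f (i + c)%:~R (@dsum_inj A m X (i + c)%:~R (i + c) x)) (i + c)).
by rewrite [in RHS]intrD c0 addr0.
Qed.

End Components.

(** * Endomorphisms of a compression, and density *)

Section Density.
Variables (k : fieldType) (A : falgType k) (m : nat) (nu : nat).
Hypothesis hnu : sgldim A nu.
Implicit Types X Y Z N : bcplx A.
Implicit Types M : cplx A 'Z_m.
Notation F X := (compr_ob m X : cplx A 'Z_m).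
Notation U M := (unroll M).
Notation LB := (bndL A).
Notation LP := (perL A m).
Let splB := @bndL_splits k A.
Let splP := @perL_splits k A m.

Lemma cmor_compE (I : nzRingType) (X Y Z : cplx A I) (g : cmor Y Z) (f : cmor X Y) i x :
  cmor_comp g f i x = g i (f i x).
Proof. by []. Qed.

(** Truncate U M at distance nu + 2 on both sides of a degree d where M is not
zero.  Some indecomposable summand of the truncation is nonzero in degree d; it
has width at most nu + 1, hence it does not reach the cuts and is a summand of
U M. *)
Lemma unroll_summand M : lid (M : LP) <> 0 -> exists N (i : cmor N (U M)) (p : cmor (U M) N),
  lindec LB N /\ cmor_comp p i = cmor_id N.
Proof.
move=> M0; have [i0 [x x0]] : exists i0, exists x : M i0, x <> 0.
  apply: contrapT => /forallNP h; apply: M0; apply: cmorP => i x.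
  by apply: contrapT => x0; apply: (h i); exists x.
have [d ed] := int_surj i0; subst i0.
pose a := d - nu.+2%:Z; pose b := d + nu.+2%:Z.
have da : a <= d <= b by rewrite /a /b; lia.
have [n [Y [[i [p [pi ort tot]]] iY]]] := decomposition splB (trunc (U M) a b : LB).
pose y : trunc (U M) a b d := fix_pr (@tr_idemK _ _ (U M) a b d) (x : U M d).
have y0 : y <> 0.
  move=> e; apply: x0; have := congr1 (fun z : trunc (U M) a b d => fval z) e.
  by rewrite /y /= tr_idemE da.
have ey : y = \sum_(j < n) (i j : cmor _ _) d ((p j : cmor _ _) d y).
  have tot' : \sum_(j < n) cmor_comp (i j) (p j) = cmor_id (trunc (U M) a b) := tot.
  have := congr1 (fun f : cmor (trunc (U M) a b) (trunc (U M) a b) => f d y) tot'.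
  by rewrite cmor_sumE => h; apply: esym h.
have [j pj0] : exists j, (p j : cmor _ _) d y <> 0.
  apply: contrapT => /forallNP h; apply: y0; rewrite ey big1 // => j _.
  by have /contrapT -> := h j; rewrite linear0.
have [a' ca'] := bounded_support hnu (iY j).
have d_in : a' <= d <= a' + nu.+1%:Z.
  by apply/negPn/negP => nd; apply: pj0; apply: ca'.
have cN : concentrated (Y j : bcplx A) (a + 1) (b - 1).
  by move=> l nl z; apply: ca'; move: nl; rewrite /a /b; lia.
have [f fP] := from_trunc cN (i j : cmor _ _).
have [g gP] := trunc_from cN (p j : cmor _ _).
exists (Y j), f, g; split=> //; apply: cmorP => l z; rewrite cmor_compE gP fP fix_prK.
by have := congr1 (fun f : cmor (Y j) (Y j) => f l z) (pi j).
Qed.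

Lemma cmor_compDl (I : nzRingType) (X Y Z : cplx A I) (g : cmor Y Z) T (r : seq T) (h : T -> cmor X Y) :
  cmor_comp g (\sum_(t <- r) h t) = \sum_(t <- r) cmor_comp g (h t).
Proof. by apply: cmorP => i x; rewrite /= !cmor_sumE linear_sum. Qed.

Section Unit.
Variable X : bcplx A.
Hypothesis iX : lindec LB X.
Notation is_liso f := (liso (f : @lhom k LB _ _)).

(** The component of f g is the sum over c of the composites through the sheet c.
For c <> 0 the composite is not invertible, as the shift of X by c is
indecomposable and not isomorphic to X; the term c = 0 is invertible. *)
Lemma sheet0_part_mul (f g : cmor (F X) (F X)) : is_liso (sheet0_part f) -> is_liso (sheet0_part g) ->
  is_liso (sheet0_part (cmor_comp f g)).
Proof.
move=> hf hg; have [K cK] := sheets_complete m X X.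
pose G c : cmor X X := cmor_comp (cmor_comp (sheet0_out m X) (cmor_comp (unroll_mor f) (sheet_in m X c)))
  (cmor_comp (sheet_out m X c) (cmor_comp (unroll_mor g) (sheet0_in m X))).
have e : sheet0_part (cmor_comp f g) = \sum_(t < K.*2.+1) G (t%:Z - K%:Z).
  transitivity (cmor_comp (sheet0_out m X) (cmor_comp (unroll_mor f) (cmor_comp (unroll_mor g) (sheet0_in m X)))).
    exact: cmorP.
  rewrite [in LHS](cK (cmor_comp (unroll_mor g) (sheet0_in m X))) !cmor_compDl.
  by apply: eq_bigr => t _; apply: cmorP.
have G0 : G 0 = cmor_comp (sheet0_part f) (sheet0_part g).
  apply: cmorP => i x.
  change ((f i%:~R (@dsum_inj A m X i%:~R (i + 0)
      ((g i%:~R (@dsum_inj A m X i%:~R i x)) (i + 0)))) i =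
    (f i%:~R (@dsum_inj A m X i%:~R i ((g i%:~R (@dsum_inj A m X i%:~R i x)) i))) i).
  by rewrite addr0.
have K_lt : (K < K.*2.+1)%N by lia.
have : is_liso (sheet0_part (cmor_comp f g) + \sum_(t < K.*2.+1 | t != Ordinal K_lt) - G (t%:Z - K%:Z)).
  rewrite e (bigD1 (Ordinal K_lt)) //= subrr G0 sumrN addrK.
  exact: (@liso_comp k LB _ _ _ (sheet0_part f) (sheet0_part g)).
case/(indec_liso_add splB iX) => // /(indec_liso_sum splB iX) [t nt].
rewrite /G; set c := _ - _ => h.
have c0 : c = 0.
  have : is_liso (cmor_comp (- cmor_comp (sheet0_out m X) (cmor_comp (unroll_mor f) (sheet_in m X c)))
    (cmor_comp (sheet_out m X c) (cmor_comp (unroll_mor g) (sheet0_in m X)))).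
    by move: h; congr liso; apply: cmorP.
  case/(@retract_indec k LB splB X (shift c X) _ _ (indec_nonzero iX) (shift_indec c iX)) => h1 _.
  exact: shift_liso0 (indec_nonzero iX) h1.
by case/eqP: nt; apply/val_inj => /=; move: c0; rewrite /c; lia.
Qed.

Lemma sheet0_part_pow (f : cmor (F X) (F X)) n : is_liso (sheet0_part f) ->
  is_liso (sheet0_part (@lpow k LP (F X) f n)).
Proof.
move=> hf; elim: n => [|n IH]; last exact: sheet0_part_mul.
suff -> : sheet0_part (@lpow k LP (F X) f 0) = cmor_id X by apply: liso_id.
by apply: cmorP => i x /=; rewrite dfwith_in eqxx.
Qed.

(** Otherwise let e be the Fitting idempotent of th.  The image M of 1 - e is not
zero, and U M has an indecomposable bounded summand N, which is a summand of
U (F X) as well; one of its components, from the sheet c to the sheet c', is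
invertible through 1 - e.  Then c = c' and m divides c, so 1 - e has an
invertible component on the sheet 0, and so has every th^r (1 - e), by
[sheet0_part_mul].  But this product vanishes for large r. *)
Lemma sheet0_part_liso (th : cmor (F X) (F X)) : sheet0_part th = cmor_id X ->
  liso (th : @lhom k LP (F X) (F X)).
Proof.
move=> th1; have [e [v [r [ee vu uv ur]]]] := fitting (th : @lhom k LP (F X) (F X)).
have [e1|e1] := pselect (e = lid (F X : LP)); first by exists v; rewrite vu uv e1.
have [M [i [p [pi ip]]]] := splP (compl_idem ee).
have M0 : lid (M : LP) <> 0.
  move=> M0; apply: e1; apply/esym/subr0_eq; rewrite -ip -[p]lcomp1f M0.
  by rewrite lcomp0f lcompf0.
have [N [io [po [iN poio]]]] := unroll_summand M0.
pose e' : cmor (F X) (F X) := lid (F X : LP) - e.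
have {}pi l x : (p : cmor _ _) l ((i : cmor _ _) l x) = x.
  by have := congr1 (fun h : cmor M M => h l x) pi.
have {}ip l x : (i : cmor _ _) l ((p : cmor _ _) l x) = e' l x.
  by have := congr1 (fun h : cmor (F X) (F X) => h l x) ip.
pose al : cmor N (U (F X)) := cmor_comp (unroll_mor (i : cmor M (F X))) io.
pose be : cmor (U (F X)) N := cmor_comp po (unroll_mor (p : cmor (F X) M)).
have bea : cmor_comp be (cmor_comp (unroll_mor e') al) = cmor_id N.
  rewrite -poio; apply: cmorP => l x.
  change (po l ((p : cmor (F X) M) l%:~R (e' l%:~R ((i : cmor M (F X)) l%:~R (io l x)))) =
    po l (io l x)).
  by rewrite -ip !pi.
have [K cK] := sheets_complete m X N; pose cc (t : 'I_K.*2.+1) : int := t%:Z - K%:Z.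
have ebe : cmor_id N = \sum_t \sum_s cmor_comp (cmor_comp be (sheet_in m X (cc s)))
    (cmor_comp (sheet_part (cc t) (cc s) e') (cmor_comp (sheet_out m X (cc t)) al)).
  rewrite -bea {1}[al]cK !cmor_compDl; apply: eq_bigr => t _.
  rewrite {1}[cmor_comp (unroll_mor e') _]cK cmor_compDl; apply: eq_bigr => s _.
  exact: cmorP.
have : is_liso (cmor_id N) by apply: liso_id.
rewrite ebe => /(indec_liso_sum splB iN) [t _] /(indec_liso_sum splB iN) [s _] h.
have [h1 h2] := @retract_indec k LB splB N (shift (cc s) X)
  (cmor_comp (sheet_part (cc t) (cc s) e') (cmor_comp (sheet_out m X (cc t)) al))
  (cmor_comp be (sheet_in m X (cc s))) (indec_nonzero iN) (shift_indec (cc s) iX) h.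
have h' : is_liso (cmor_comp (cmor_comp (cmor_comp be (sheet_in m X (cc s))) (sheet_part (cc t) (cc s) e'))
    (cmor_comp (sheet_out m X (cc t)) al)) by move: h; congr liso; apply: cmorP.
have [h3 h4] := @retract_indec k LB splB N (shift (cc t) X) (cmor_comp (sheet_out m X (cc t)) al)
  (cmor_comp (cmor_comp be (sheet_in m X (cc s))) (sheet_part (cc t) (cc s) e'))
  (indec_nonzero iN) (shift_indec (cc t) iX) h'.
have hk : is_liso (sheet_part (cc t) (cc s) e').
  have [g [g1 g2]] := h3.
  suff -> : sheet_part (cc t) (cc s) e' =
     cmor_comp (cmor_comp (sheet_part (cc t) (cc s) e') (cmor_comp (sheet_out m X (cc t)) al)) (g : cmor _ _).
    by apply: (@liso_comp k LB _ _ _ _ g h1); exists (cmor_comp (sheet_out m X (cc t)) al).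
  rewrite -[LHS](@lcompf1 k LB (shift (cc t) X) (shift (cc s) X)) -g2; exact: cmorP.
have ets := shift_liso_eq (indec_nonzero iX) hk; rewrite -ets in hk.
have c0 : (cc t)%:~R = 0 :> 'Z_m.
  apply/eqP/negPn/negP => /(@sheet_in_zero k A m X) j0.
  have [g [g1 _]] := hk; apply: (indec_nonzero (shift_indec (cc t) iX)).
  rewrite -g1 (_ : sheet_part _ _ _ = 0); first exact: (lcompf0 (L := LB)).
  by rewrite /sheet_part j0; apply: cmorP => l x; rewrite !cmor_compE cmor_zeroE !linear0.
rewrite (sheet_part_shift _ c0) in hk; move/shift_mor_liso in hk.
have := sheet0_part_mul (sheet0_part_pow r (f := th) _) hk; rewrite th1.
have -> : sheet0_part (cmor_comp (@lpow k LP (F X) th r) e') = 0.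
  have : lpow (th : @lhom k LP (F X) (F X)) r ** (lid (F X : LP) - e) = 0.
    by rewrite lcompBr lcompf1 ur subrr.
  rewrite -/e' => /= ->; exact: cmorP.
case; first exact: liso_id.
move=> g [g1 _]; case: (indec_nonzero iX); rewrite -g1.
exact: (lcompf0 (L := LB)).
Qed.

End Unit.

Lemma concentrated_widen X a b a' b' : a' <= a -> b <= b' ->
  concentrated X a b -> concentrated X a' b'.
Proof. by move=> aa bb cX i ni; apply: cX; apply: contra ni => /andP[h1 h2]; lia. Qed.

Lemma common_range X Y : exists a b, concentrated X (a + 1) (b - 1) /\ concentrated Y (a + 1) (b - 1).
Proof.
have [a1 [b1 c1]] := bcob_bounded X; have [a2 [b2 c2]] := bcob_bounded Y.
exists (Num.min a1 a2 - 1), (Num.max b1 b2 + 1).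
by split; [apply: concentrated_widen c1|apply: concentrated_widen c2]; lia.
Qed.

Lemma sheet0_part_sharp_flat N M (p : cmor (U M) N) (i : cmor N (U M)) :
  cmor_comp p i = cmor_id N -> sheet0_part (cmor_comp (sharp p) (flat i)) = cmor_id N.
Proof.
move=> pi; rewrite -pi -{2}(sharpK p) -{2}(flatK i); exact: cmorP.
Qed.

Lemma sheet0_part_compl X Y Z (g : cmor Y Z) (r : cmor (F X) (F Y)) :
  sheet0_part (cmor_comp (compr m (g : @homset (Cb A) Y Z)) r) = cmor_comp g (sheet0_part r).
Proof. exact: cmorP. Qed.

Lemma sheet0_part_compr X Y Z (f : cmor X Y) (r : cmor (F Y) (F Z)) :
  sheet0_part (cmor_comp r (compr m (f : @homset (Cb A) X Y))) = cmor_comp (sheet0_part r) f.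
Proof.
transitivity (cmor_comp (sheet0_out m Z) (cmor_comp (unroll_mor r) (cmor_comp (sheet0_in m Y) f))).
  by rewrite -sheet0_in_nat; apply: cmorP.
exact: cmorP.
Qed.

Lemma sheet0_part_id X : sheet0_part (cmor_id (F X)) = cmor_id X.
Proof. by rewrite -(sheet0_inK m X); apply: cmorP. Qed.

Lemma sheet0_part_comprE X Y (f : cmor X Y) : sheet0_part (compr m (f : @homset (Cb A) X Y)) = f.
Proof.
apply: etrans (_ : sheet0_part (cmor_comp (compr m (f : @homset (Cb A) X Y)) (cmor_id (F X))) = f).
  by congr sheet0_part; apply: cmorP.
by rewrite sheet0_part_compl sheet0_part_id; apply: cmorP.
Qed.

Lemma compr_smono X Y (f : @lhom k LB X Y) :
  smono LP (compr m f : @lhom k LP (F X) (F Y)) <-> smono LB f.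
Proof.
split=> -[r rf]; last first.
  exists (compr m (r : cmor Y X)); apply: cmorP => i x; apply: dsumP => j.
  exact: (congr1 (fun h : cmor X X => h j (x j)) rf).
exists (sheet0_part (r : cmor (F Y) (F X))); apply: etrans (esym (sheet0_part_compr f _)) _.
by rewrite [cmor_comp _ _]rf; apply: sheet0_part_id.
Qed.

Lemma compr_sepi X Y (f : @lhom k LB X Y) :
  sepi LP (compr m f : @lhom k LP (F X) (F Y)) <-> sepi LB f.
Proof.
split=> -[r fr]; last first.
  exists (compr m (r : cmor Y X)); apply: cmorP => i x; apply: dsumP => j.
  exact: (congr1 (fun h : cmor Y Y => h j (x j)) fr).
exists (sheet0_part (r : cmor (F Y) (F X))); apply: etrans (esym (sheet0_part_compl f _)) _.
by rewrite [cmor_comp _ _]fr; apply: sheet0_part_id.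
Qed.

Lemma compr_liso X (u : @lhom k LB X X) :
  liso (compr m u : @lhom k LP (F X) (F X)) -> liso u.
Proof.
move=> [v [vu uv]]; exists (sheet0_part (v : cmor (F X) (F X))); split.
  by apply: etrans (esym (sheet0_part_compr u _)) _; rewrite [cmor_comp _ _]vu; apply: sheet0_part_id.
by apply: etrans (esym (sheet0_part_compl u _)) _; rewrite [cmor_comp _ _]uv; apply: sheet0_part_id.
Qed.

(** A map phi from F X to M is adjoint to a map X -> U M, which lands in a
truncation T of U M as X is bounded.  If al : X -> T is a split monomorphism,
its retraction gives by adjunction a map M -> F X whose composite with phi has
component 1 on the sheet 0, so that phi is split.  Otherwise al factors through
f, and the factorization is transported back. *)
Lemma compr_las X E (f : @lhom k LB X E) : lindec LB X -> las LB f ->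
  las LP (compr m f : @lhom k LP (F X) (F E)).
Proof.
move=> iX [ns lift]; split.
  by move/compr_smono.
move=> M phi nphi; pose phi' : cmor (F X) M := phi.
have [a [b [cX cE]]] := common_range X E.
have [al alP] := to_trunc cX (cmor_comp (unroll_mor phi') (sheet0_in m X)).
have [[r /= ral]|nal] := pselect (smono LB (al : @lhom k LB X (trunc (U M) a b))).
  have [p pP] := trunc_from cX (r : cmor (trunc (U M) a b) X).
  have : sheet0_part (cmor_comp (sharp p) phi') = cmor_id X.
    rewrite -ral; transitivity (cmor_comp p (cmor_comp (unroll_mor phi') (sheet0_in m X))).
      by rewrite -[in RHS](sharpK p); apply: cmorP.
    apply: cmorP => i x; apply: etrans (congr1 (p i) (esym (alP i x))) _.
    by rewrite pP fix_prK.
  case/(sheet0_part_liso iX) => t [tp _]; case: nphi.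
  exists (t ** (sharp p : @lhom k LP M (F X))); apply: etrans tp; exact: cmorP.
have [al' /= eal] := lift _ _ nal.
have [be beP] := from_trunc cE (al' : cmor E (trunc (U M) a b)).
exists (flat be : @lhom k LP (F E) M); apply: (@flat_unique k A m).
transitivity (cmor_comp (cmor_comp (unroll_mor (flat be)) (sheet0_in m E)) (f : cmor X E)).
  apply: etrans (_ : cmor_comp (unroll_mor (flat be))
    (cmor_comp (unroll_mor (compr m f : cmor (F X) (F E))) (sheet0_in m X)) = _); first exact: cmorP.
  by rewrite sheet0_in_nat; apply: cmorP.
rewrite flatK; apply: cmorP => i x; apply: etrans (beP _ _) _; apply: etrans (alP i x).
by rewrite -eal.
Qed.

Lemma compr_ras E Z (g : @lhom k LB E Z) : lindec LB Z -> ras LB g ->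
  ras LP (compr m g : @lhom k LP (F E) (F Z)).
Proof.
move=> iZ [ns lift]; split.
  by move/compr_sepi.
move=> M psi npsi; pose psi' : cmor M (F Z) := psi.
have [a [b [cZ cE]]] := common_range Z E.
have [ga gaP] := trunc_to cZ (cmor_comp (sheet0_out m Z) (unroll_mor psi')).
have [[s /= gas]|nga] := pselect (sepi LB (ga : @lhom k LB (trunc (U M) a b) Z)).
  have [p pP] := from_trunc cZ (s : cmor Z (trunc (U M) a b)).
  have : sheet0_part (cmor_comp psi' (flat p)) = cmor_id Z.
    rewrite -gas; transitivity (cmor_comp (cmor_comp (sheet0_out m Z) (unroll_mor psi')) p).
      by rewrite -[in RHS](flatK p); apply: cmorP.
    apply: cmorP => i x; apply: etrans (esym (gaP _ _)).
    exact: (congr1 (cmor_comp (sheet0_out m Z) (unroll_mor psi') i) (pP i x)).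
  case/(sheet0_part_liso iZ) => t [_ pt]; case: npsi.
  exists ((flat p : @lhom k LP (F Z) M) ** t); apply: etrans pt; exact: cmorP.
have [ga' /= ega] := lift _ _ nga.
have [de deP] := trunc_from cE (ga' : cmor (trunc (U M) a b) E).
exists (sharp de : @lhom k LP M (F E)); apply: (@sharp_unique k A m).
transitivity (cmor_comp (g : cmor E Z) (cmor_comp (sheet0_out m E) (unroll_mor (sharp de)))).
  by apply: cmorP.
rewrite sharpK; apply: cmorP => i x.
apply: etrans (congr1 ((g : cmor E Z) i) (deP i x)) _.
have [i_in|i_out] := boolP (a + 1 <= i <= b - 1); last by apply: etrans (cZ i i_out _) (esym (cZ i i_out _)).
have -> : (g : cmor E Z) i ((ga' : cmor _ E) i (fix_pr (@tr_idemK _ _ (U M) a b i) x)) =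
    ga i (fix_pr (@tr_idemK _ _ (U M) a b i) x) by rewrite -ega.
rewrite gaP; apply: (congr1 (fun y : M i%:~R => psi' i%:~R y i)); rewrite /= tr_idemE.
by have -> : a <= i <= b by move: i_in; lia.
Qed.

Lemma compr_nonzero N : lid (N : LB) <> 0 -> lid (F N : LP) <> 0.
Proof.
move=> N0 e; apply: N0; apply: etrans (esym (sheet0_part_id N)) _.
rewrite [cmor_id _]e; exact: cmorP.
Qed.

(** A summand N of U M gives maps F N -> M -> F N by adjunction, with composite of
component 1 on the sheet 0. *)
Lemma compr_dense (M : LP) : lindec LP M -> exists2 N, lindec LB N &
  exists f : @lhom k LP (F N) M, liso f.
Proof.
move=> iM; have [N [i [p [iN pi]]]] := unroll_summand (indec_nonzero iM).
exists N => //; exists (flat i).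
have h := sheet0_part_liso iN (sheet0_part_sharp_flat pi).
by case: (@retract_indec k LP splP (F N) M (flat i) (sharp p) (compr_nonzero (indec_nonzero iN)) iM h).
Qed.

End Density.

(** * Degreewise split sequences *)

Section TwistedSum.
Variables (k : fieldType) (A : falgType k) (I : nzRingType).
Variables (X W : cplx A I) (tau : forall i j, {linear W i -> X j}).
Hypothesis tau_shape : forall i j x, j != i + 1 -> tau i j x = 0.
Hypothesis tau_comp : forall i j l w, diff X j l (tau i j w) + tau j l (diff W i j w) = 0.

(** Every degreewise split sequence with ends X and W is of this form; its class is
that of the cocycle tau. *)
Definition twisted_fun i j (p : (X i * W i)%type) : (X j * W j)%type :=
  (diff X i j p.1 + tau i j p.2, diff W i j p.2).
Fact tw_subproof i j : linear (@twisted_fun i j).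
Proof.
move=> c [x w] [x' w']; congr pair => /=; rewrite !linearP // scalerDr.
by rewrite addrACA.
Qed.
Fact tw_shape i j p : j != i + 1 -> mklin (@tw_subproof i j) p = 0.
Proof. by move=> ij; congr pair; rewrite /= !diff_shape // tau_shape // addr0. Qed.
Fact tw_comp i j l p : mklin (@tw_subproof j l) (mklin (@tw_subproof i j) p) = 0.
Proof. by congr pair => /=; rewrite ?linearD !diff_comp ?add0r ?tau_comp. Qed.
Fact tw_dual i : dual_basis (X i * W i)%type.
Proof. by apply: dual_basis_pair; apply: cob_dual. Qed.
Definition twisted : cplx A I := @cplx_of k A I (fun i => (X i * W i)%type)
  (fun i j => mklin (@tw_subproof i j)) tw_shape tw_comp tw_dual.

Fact tw_in_subproof i : linear (fun x : X i => (x, 0) : (X i * W i)%type).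
Proof. by move=> c x y; congr pair; rewrite /= scaler0 addr0. Qed.
Fact tw_in_comm i j (x : X i) :
  mklin (@tw_in_subproof j) (diff X i j x) = diff twisted i j (mklin (@tw_in_subproof i) x).
Proof. by congr pair; rewrite /= !linear0 ?addr0. Qed.
Definition twisted_in : cmor X twisted := @CMor _ _ X twisted (fun i => mklin (@tw_in_subproof i)) tw_in_comm.
Fact tw_out_comm i j (p : twisted i) :
  (snd : {linear (X j * W j)%type -> W j}) (diff twisted i j p) = diff W i j ((snd : {linear (X i * W i)%type -> W i}) p).
Proof. by []. Qed.
Definition twisted_out : cmor twisted W := @CMor _ _ twisted W (fun i => (snd : {linear (X i * W i)%type -> W i})) tw_out_comm.

Fact tw_sec_subproof i : linear (fun w : W i => (0, w) : (X i * W i)%type).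
Proof. by move=> c x y; congr pair; rewrite /= scaler0 addr0. Qed.
Lemma twisted_ses : degreewise_split twisted_in twisted_out.
Proof.
move=> i; split; first by move=> x y [].
  move=> [x w]; split=> /= [->|[x' [_ ->]] //]; by exists x.
by exists (mklin (@tw_sec_subproof i)).
Qed.
End TwistedSum.

Section SplitFacts.
Variables (k : fieldType) (A : falgType k) (I : nzRingType).
Implicit Types X Y Z W E : cplx A I.

Lemma ses_comp0 X Y Z (f : cmor X Y) (g : cmor Y Z) : degreewise_split f g ->
  cmor_comp g f = 0.
Proof.
by move=> s; apply: cmorP => i x; have [_ h _] := s i; apply/(h (f i x)); exists x.
Qed.

Lemma ses_mono X Y Z (f : cmor X Y) (g : cmor Y Z) : degreewise_split f g ->
  forall W (h : cmor W X), cmor_comp f h = 0 -> h = 0.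
Proof.
move=> s W h e; apply: cmorP => i x; have [fI _ _] := s i; apply: fI.
by rewrite [RHS]linear0; have := congr1 (fun u : cmor W Y => u i x) e.
Qed.

Lemma ses_epi X Y Z (f : cmor X Y) (g : cmor Y Z) : degreewise_split f g ->
  forall W (h : cmor Z W), cmor_comp h g = 0 -> h = 0.
Proof.
move=> s W h e; apply: cmorP => i z; have [_ _ [t gt]] := s i.
by rewrite -(gt z); have := congr1 (fun u : cmor Y W => u i (t z)) e.
Qed.

Lemma ses_ker X Y Z (f : cmor X Y) (g : cmor Y Z) : degreewise_split f g ->
  forall W (h : cmor W Y), cmor_comp g h = 0 -> exists h', cmor_comp f h' = h.
Proof.
move=> s W h e; have fI i : injective (f i) by have [] := s i.
have ex i x : exists y, h i x = f i y.
  have [_ im _] := s i; apply/(im (h i x)).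
  by have := congr1 (fun u : cmor W Z => u i x) e.
pose h' i x := sval (cid (ex i x)); have h'P i x : f i (h' i x) = h i x := esym (svalP (cid (ex i x))).
have hl i : linear (h' i) by move=> c x y; apply: fI; rewrite linearP !h'P linearP.
have hc i j x : mklin (hl j) (diff W i j x) = diff X i j (mklin (hl i) x).
  by apply: (fI j); rewrite /= h'P !mor_comm h'P.
by exists (@CMor _ _ W X (fun i => mklin (hl i)) hc); apply: cmorP => i x; apply: h'P.
Qed.

Lemma ses_coker X Y Z (f : cmor X Y) (g : cmor Y Z) : degreewise_split f g ->
  forall W (h : cmor Y W), cmor_comp h f = 0 -> exists h', cmor_comp h' g = h.
Proof.
move=> s W h e.
have ex i : exists t : {linear Z i -> Y i}, forall z, g i (t z) = z by have [] := s i.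
pose t i := sval (cid (ex i)); have tP i z : g i (t i z) = z := svalP (cid (ex i)) z.
have hg i y : g i y = 0 -> h i y = 0.
  have [_ im _] := s i => /(im y)[x ->].
  by have := congr1 (fun u : cmor X W => u i x) e.
have hc i j z : (h j \o t j) (diff Z i j z) = diff W i j ((h i \o t i) z).
  rewrite /= -mor_comm; apply/subr0_eq; rewrite -linearB; apply: hg.
  by rewrite linearB mor_comm !tP subrr.
exists (@CMor _ _ Z W (fun i => h i \o t i) hc); apply: cmorP => i y /=.
by apply/subr0_eq; rewrite -linearB; apply: hg; rewrite linearB tP subrr.
Qed.

Lemma ses_twist X Y Z (f : cmor X Y) (g : cmor Y Z) : degreewise_split f g ->
  exists (t : forall i, {linear Z i -> Y i}) (r : forall i, {linear Y i -> X i}),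
  [/\ forall i z, g i (t i z) = z, forall i x, r i (f i x) = x
    & forall i y, f i (r i y) = y - t i (g i y)].
Proof.
move=> s.
have ex i : exists t : {linear Z i -> Y i}, forall z, g i (t z) = z by have [] := s i.
pose t i := sval (cid (ex i)); have tP i z : g i (t i z) = z := svalP (cid (ex i)) z.
have fI i : injective (f i) by have [] := s i.
have ex' i y : exists x, y - t i (g i y) = f i x.
  by have [_ im _] := s i; apply/(im (y - t i (g i y))); rewrite linearB tP subrr.
pose r i y := sval (cid (ex' i y)).
have rP i y : f i (r i y) = y - t i (g i y) := esym (svalP (cid (ex' i y))).
have rl i : linear (r i).
  move=> c x y; apply: fI; rewrite linearP !rP !linearP scalerDr.
  by rewrite addrACA.
exists t, (fun i => mklin (rl i)); split=> // i x; apply: fI; rewrite /= rP.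
have -> : g i (f i x) = 0 by have [_ im _] := s i; apply/(im (f i x)); exists x.
by rewrite linear0 subr0.
Qed.

(** The pushout is the twisted sum for the image of the twisting cocycle
r d t under h. *)
Lemma ses_push X Y Z (f : cmor X Y) (g : cmor Y Z) : degreewise_split f g ->
  forall W (h : cmor X W), exists E (f' : cmor W E) (h' : cmor Y E) (g' : cmor E Z),
    [/\ degreewise_split f' g', cmor_comp h' f = cmor_comp f' h & cmor_comp g' h' = g].
Proof.
move=> s W h; have [t [r [gt rf fr]]] := ses_twist s.
have fI i : injective (f i) by have [] := s i.
have gf i x : g i (f i x) = 0 by have := congr1 (fun u : cmor X Z => u i x) (ses_comp0 s).
pose sg i j : {linear Z i -> X j} := r j \o (diff Y i j \o t i).
have rd i j y : r j (diff Y i j y) = diff X i j (r i y) + sg i j (g i y).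
  apply: fI; rewrite linearD mor_comm /sg /= !fr !mor_comm gt linearB.
  by rewrite addrA subrK.
have sg_shape i j x : j != i + 1 -> sg i j x = 0 by move=> ij; rewrite /sg /= diff_shape // linear0.
have sg_comp i j l z : diff X j l (sg i j z) + sg j l (diff Z i j z) = 0.
  have := rd j l (diff Y i j (t i z)); rewrite diff_comp linear0 mor_comm gt.
  by rewrite /sg /= => <-.
pose tau i j : {linear Z i -> W j} := h j \o sg i j.
have ts i j x : j != i + 1 -> tau i j x = 0 by move=> ij; apply: etrans (congr1 (h j) (sg_shape i j x ij)) (linear0 _).
have tc i j l z : diff W j l (tau i j z) + tau j l (diff Z i j z) = 0.
  apply: etrans (etrans (congr1 (h l) (sg_comp i j l z)) (linear0 _)).
  by rewrite linearD mor_comm.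
pose E := twisted ts tc.
have hl i : linear (fun y : Y i => (h i (r i y), g i y) : (W i * Z i)%type).
  by move=> c x y; congr pair; rewrite /= !linearP.
have hc i j y : mklin (hl j) (diff Y i j y) = diff E i j (mklin (hl i) y).
  congr pair; rewrite /= ?mor_comm //.
  by rewrite rd linearD mor_comm.
exists E, (twisted_in ts tc), (@CMor _ _ Y E (fun i => mklin (hl i)) hc), (twisted_out ts tc); split.
- exact: twisted_ses.
- by apply: cmorP => i x; congr pair; rewrite /= ?rf ?gf.
exact: cmorP.
Qed.

Lemma ses_pull X Y Z (f : cmor X Y) (g : cmor Y Z) : degreewise_split f g ->
  forall W (h : cmor W Z), exists E (f' : cmor X E) (h' : cmor E Y) (g' : cmor E W),
    [/\ degreewise_split f' g', cmor_comp g h' = cmor_comp h g' & cmor_comp h' f' = f].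
Proof.
move=> s W h; have [t [r [gt rf fr]]] := ses_twist s.
have fI i : injective (f i) by have [] := s i.
have gf i x : g i (f i x) = 0 by have := congr1 (fun u : cmor X Z => u i x) (ses_comp0 s).
pose sg i j : {linear Z i -> X j} := r j \o (diff Y i j \o t i).
have fsg i j z : f j (sg i j z) = diff Y i j (t i z) - t j (diff Z i j z).
  by rewrite /sg /= fr mor_comm gt.
have sg_shape i j x : j != i + 1 -> sg i j x = 0 by move=> ij; rewrite /sg /= diff_shape // linear0.
have sg_comp i j l z : diff X j l (sg i j z) + sg j l (diff Z i j z) = 0.
  apply: fI; rewrite linear0 linearD mor_comm !fsg linearB !diff_comp linear0 subr0 sub0r.
  by rewrite addNr.
pose tau i j : {linear W i -> X j} := sg i j \o h i.
have ts i j x : j != i + 1 -> tau i j x = 0 by move=> ij; apply: sg_shape.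
have tc i j l z : diff X j l (tau i j z) + tau j l (diff W i j z) = 0.
  by rewrite /tau /= mor_comm; apply: sg_comp.
pose E := twisted ts tc.
have hl i : linear (fun p : (X i * W i)%type => f i p.1 + t i (h i p.2)).
  by move=> c p q; rewrite /= !linearP scalerDr addrACA.
have hc i j p : mklin (hl j) (diff E i j p) = diff Y i j (mklin (hl i) p).
  rewrite /= !linearD mor_comm -addrA; congr (_ + _).
  by rewrite -/(sg i j (h i p.2)) fsg mor_comm subrK.
exists E, (twisted_in ts tc), (@CMor _ _ E Y (fun i => mklin (hl i)) hc), (twisted_out ts tc); split.
- exact: twisted_ses.
- by apply: cmorP => i p; rewrite /= linearD gf gt add0r.
by apply: cmorP => i x; rewrite /= !linear0 addr0.
Qed.

(** The kernel of g is the image of the degreewise idempotent 1 - t g. *)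
Lemma split_epi_ses E Z (g : cmor E Z) :
  (forall i, exists t : {linear Z i -> E i}, forall z, g i (t z) = z) ->
  exists X (f : cmor X E), degreewise_split f g.
Proof.
move=> ex; pose t i := sval (cid (ex i)).
have tP i z : g i (t i z) = z := svalP (cid (ex i)) z.
have el i : linear (fun y : E i => y - t i (g i y)).
  by move=> c x y; rewrite !linearP scalerDr addrACA.
have [e eE] : exists e : forall i, {linear E i -> E i}, forall i y, e i y = y - t i (g i y).
  by exists (fun i => mklin (el i)).
have eg i y : g i y = 0 -> e i y = y by move=> gy; rewrite eE gy linear0 subr0.
have ge i y : g i (e i y) = 0 by rewrite eE linearB tP subrr.
have ee i y : e i (e i y) = e i y by apply/eg/ge.
have ded i j y : e j (diff E i j (e i y)) = diff E i j (e i y).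
  by apply: eg; rewrite mor_comm ge linear0.
have eDeD i j l y : e l (diff E j l (e j (diff E i j (e i y)))) = 0.
  by rewrite !ded diff_comp.
pose X := fix_cplx (cob_dual E) (@diff_shape _ _ E) ee eDeD.
have fc i j (x : X i) : fix_in (e j) (diff X i j x) = diff E i j (fix_in (e i) x).
  by have := ded i j (fval x); rewrite (fvalP x).
exists X, (@CMor _ _ X E (fun i => fix_in (e i)) fc) => i; split; first by move=> x y; apply: fixmodP.
  move=> y; split=> [gy|[x ->]]; first by exists (fix_pr (@ee i) y); rewrite /= -[LHS](eg _ _ gy).
  by rewrite -[mor _ i x]/(fval x) -(fvalP x) ge.
by exists (t i).
Qed.

(** The cokernel of f is carried by the image of the degreewise idempotent
1 - f r. *)
Lemma split_mono_ses X E (f : cmor X E) :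
  (forall i, exists r : {linear E i -> X i}, forall x, r (f i x) = x) ->
  exists Z (g : cmor E Z), degreewise_split f g.
Proof.
move=> ex; pose r i := sval (cid (ex i)).
have rP i z : r i (f i z) = z := svalP (cid (ex i)) z.
have el i : linear (fun y : E i => y - f i (r i y)).
  by move=> c x y; rewrite !linearP scalerDr addrACA.
have [e eE] : exists e : forall i, {linear E i -> E i}, forall i y, e i y = y - f i (r i y).
  by exists (fun i => mklin (el i)).
have ef i x : e i (f i x) = 0 by rewrite eE rP subrr.
have ee i y : e i (e i y) = e i y by rewrite [in LHS](eE i y) linearB ef subr0.
have ede i j y : e j (diff E i j (e i y)) = e j (diff E i j y).
  by rewrite (eE i y) !linearB /= -mor_comm ef subr0.
have eDeD i j l y : e l (diff E j l (e j (diff E i j (e i y)))) = 0.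
  by rewrite ede diff_comp linear0.
pose Z := fix_cplx (cob_dual E) (@diff_shape _ _ E) ee eDeD.
have gc i j (y : E i) : fix_pr (@ee j) (diff E i j y) = diff Z i j (fix_pr (@ee i) y).
  by apply: fixmodP; apply: esym (ede i j y).
exists Z, (@CMor _ _ E Z (fun i => fix_pr (@ee i)) gc) => i; split.
- by move=> x y h; rewrite -(rP i x) h rP.
- move=> y; split=> [h|[x ->]]; last by apply: fixmodP; apply: ef.
  by exists (r i y); apply/subr0_eq; rewrite -eE; apply: (congr1 (@fval _ _ _) h).
by exists (fix_in (e i)) => z; apply: fix_prK.
Qed.

(** If s contracts P and t is a degreewise section of g, then d (t h s) + (t h s) d
is a chain map which lifts h. *)
Lemma contractible_proj P : contractible P -> forall X Y Z (f : cmor X Y) (g : cmor Y Z),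
  degreewise_split f g -> forall h : cmor P Z, exists h', cmor_comp g h' = h.
Proof.
move=> [s sP] X Y Z f g ses h; have [t [r [gt rf fr]]] := ses_twist ses.
exists (null_cmor (fun i j => t j \o (h j \o s i j))); apply: cmorP => i x.
rewrite /= /hmap /= linearD mor_comm !gt -mor_comm -linearD; congr (h i _).
exact: esym (sP i x).
Qed.

Lemma contractible_inj J : contractible J -> forall X Y Z (f : cmor X Y) (g : cmor Y Z),
  degreewise_split f g -> forall h : cmor X J, exists h', cmor_comp h' f = h.
Proof.
move=> [s sP] X Y Z f g ses h; have [t [r [gt rf fr]]] := ses_twist ses.
exists (null_cmor (fun i j => s i j \o (h i \o r i))); apply: cmorP => i x.
by rewrite /= /hmap /= -mor_comm !rf mor_comm; apply: esym (sP i (h i x)).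
Qed.

Lemma contractible_retract X Y (i : cmor X Y) (p : cmor Y X) :
  cmor_comp p i = cmor_id X -> contractible Y -> contractible X.
Proof.
rewrite /contractible => <- cY.
have -> : cmor_comp p i = cmor_comp p (cmor_comp (cmor_id Y) i) by apply: cmorP.
by apply: nullh_compl; apply: nullh_compr.
Qed.

Section Cover.
Variable Z : cplx A I.
Fact cov_subproof i j : linear (fun p : (Z (i - 1)%R * Z i)%type => (ccast i (j - 1) p.2, 0) : (Z (j - 1)%R * Z j)%type).
Proof. by move=> c p q; congr pair; rewrite ?linearP //= scaler0 addr0. Qed.
Fact cov_shape i j p : j != i + 1 -> mklin (@cov_subproof i j) p = 0.
Proof.
by move=> ij; congr pair; apply: ccast_ne; apply: contraNneq ij => ->; rewrite subrK.
Qed.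
Fact cov_comp i j l p : mklin (@cov_subproof j l) (mklin (@cov_subproof i j) p) = 0.
Proof. by congr pair; apply: linear0. Qed.
Fact cov_dual i : dual_basis (Z (i - 1)%R * Z i)%type.
Proof. by apply: dual_basis_pair; apply: cob_dual. Qed.
Definition disk_cover : cplx A I := @cplx_of k A I (fun i => (Z (i - 1)%R * Z i)%type)
  (fun i j => mklin (@cov_subproof i j)) cov_shape cov_comp cov_dual.
Fact covmap_subproof i : linear (fun p : (Z (i - 1)%R * Z i)%type => diff Z (i - 1) i p.1 + p.2).
Proof. by move=> c p q; rewrite /= linearP scalerDr addrACA. Qed.
Fact covmap_comm i j (p : disk_cover i) :
  mklin (@covmap_subproof j) (diff disk_cover i j p) = diff Z i j (mklin (@covmap_subproof i) p).
Proof.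
rewrite /= addr0 linearD diff_comp add0r.
have [->|ij] := eqVneq j (i + 1).
  have e : i = i + 1 - 1 by rewrite addrK.
  rewrite -[in RHS](ccast_id (M := Z) p.2); rewrite -/(ccast i (i + 1 - 1) p.2).
  by move: (i + 1) (i + 1 - 1) e => a b <-.
rewrite [RHS]diff_shape // ccast_fun_ne ?linear0 //; apply: contraNneq ij => ->; by rewrite subrK.
Qed.
Definition disk_cover_map : cmor disk_cover Z := @CMor _ _ disk_cover Z (fun i => mklin (@covmap_subproof i)) covmap_comm.
Fact cov_s_subproof i j : linear (fun p : (Z (i - 1)%R * Z i)%type => (0, ccast (i - 1) j p.1) : (Z (j - 1)%R * Z j)%type).
Proof. by move=> c p q; congr pair; rewrite ?linearP //= scaler0 addr0. Qed.
(** In degree i the cover is Z (i - 1) + Z i, the sum over all degrees of the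
complexes with an identity as only differential. *)
Lemma disk_cover_contractible : contractible disk_cover.
Proof.
exists (fun i j => mklin (@cov_s_subproof i j)) => i [x y].
congr pair; rewrite /= ?addr0 ?add0r ?ccast_fun_id //.
have e : i = i + 1 - 1 by rewrite addrK.
by move: (i + 1 - 1) e => b <-; rewrite !ccast_fun_id.
Qed.
Lemma disk_cover_deflation E (g : cmor E Z) p' : cmor_comp g p' = disk_cover_map -> exists X (f : cmor X E), degreewise_split f g.
Proof.
move=> e; apply: split_epi_ses => i.
have il : linear (fun y : Z i => (0, y) : (Z (i - 1)%R * Z i)%type).
  by move=> c x y; congr pair; rewrite /= scaler0 addr0.
exists (p' i \o mklin il) => z; have := congr1 (fun u : cmor disk_cover Z => u i (0, z)) e.
by rewrite /= linear0 add0r.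
Qed.
End Cover.

Section Hull.
Variable Z : cplx A I.
Fact hul_subproof i j : linear (fun p : (Z i * Z (i + 1)%R)%type => (ccast (i + 1) j p.2, 0) : (Z j * Z (j + 1)%R)%type).
Proof. by move=> c p q; congr pair; rewrite ?linearP //= scaler0 addr0. Qed.
Fact hul_shape i j p : j != i + 1 -> mklin (@hul_subproof i j) p = 0.
Proof. by move=> ij; congr pair; apply: ccast_ne; rewrite eq_sym. Qed.
Fact hul_comp i j l p : mklin (@hul_subproof j l) (mklin (@hul_subproof i j) p) = 0.
Proof. by congr pair; apply: linear0. Qed.
Fact hul_dual i : dual_basis (Z i * Z (i + 1)%R)%type.
Proof. by apply: dual_basis_pair; apply: cob_dual. Qed.
Definition disk_hull : cplx A I := @cplx_of k A I (fun i => (Z i * Z (i + 1)%R)%type)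
  (fun i j => mklin (@hul_subproof i j)) hul_shape hul_comp hul_dual.
Fact hulmap_subproof i : linear (fun x : Z i => (x, diff Z i (i + 1) x) : (Z i * Z (i + 1)%R)%type).
Proof. by move=> c p q; congr pair; rewrite linearP. Qed.
Fact hulmap_comm i j (x : Z i) :
  mklin (@hulmap_subproof j) (diff Z i j x) = diff disk_hull i j (mklin (@hulmap_subproof i) x).
Proof.
congr pair; rewrite /= ?diff_comp //.
have [->|ij] := eqVneq j (i + 1); first by rewrite ccast_fun_id.
by rewrite diff_shape // ccast_fun_ne // eq_sym.
Qed.
Definition disk_hull_map : cmor Z disk_hull := @CMor _ _ Z disk_hull (fun i => mklin (@hulmap_subproof i)) hulmap_comm.
Fact hul_s_subproof i j : linear (fun p : (Z i * Z (i + 1)%R)%type => (0, ccast i (j + 1) p.1) : (Z j * Z (j + 1)%R)%type).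
Proof. by move=> c p q; congr pair; rewrite ?linearP //= scaler0 addr0. Qed.
Lemma disk_hull_contractible : contractible disk_hull.
Proof.
exists (fun i j => mklin (@hul_s_subproof i j)) => i [x y].
congr pair; rewrite /= ?addr0 ?add0r ?ccast_fun_id //.
have e : i = i - 1 + 1 by rewrite subrK.
by move: (i - 1 + 1) e => b <-; rewrite !ccast_fun_id.
Qed.
Lemma disk_hull_inflation E (f : cmor Z E) j' : cmor_comp j' f = disk_hull_map -> exists Y (g : cmor E Y), degreewise_split f g.
Proof.
move=> e; apply: split_mono_ses => i.
exists ((fst : {linear (Z i * Z (i + 1)%R)%type -> Z i}) \o j' i) => z.
by have := congr1 (fun u : cmor Z disk_hull => (u i z).1) e.
Qed.
End Hull.

End SplitFacts.

(** * Almost split maps of bounded complexes *)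

Section AlmostSplitBounded.
Variables (k : fieldType) (A : falgType k) (nu : nat).
Hypothesis hnu : sgldim A nu.
Implicit Types X Y N W Q : bcplx A.
Notation LB := (bndL A).
Notation is_liso f := (liso (f : @lhom k LB _ _)).
Let splB := @bndL_splits k A.

Definition obj_at X i : projL A := FGProj (cob_dual X i).

(** The space J of [radical_cocycle]: the chain maps among the graded
endomorphisms of N that are not invertible. *)
Definition nonunit N (u : forall i, linT (N i) (N i)) :=
  exists f : cmor N N, (forall i, u i = f i) /\ ~ is_liso f.

Lemma nonunit_lin N c u v : lindec LB N -> @nonunit N u -> @nonunit N v ->
  @nonunit N (fun i => c *: u i + v i).
Proof.
move=> iN [f [fu nf]] [g [gv ng]]; exists (c *: f + g); split.
  by move=> i; rewrite fu gv; apply: linear_ext.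
case/(indec_liso_add splB iN) => // -[h [hf fh]]; apply: nf.
exists (c *: (h : @lhom k LB N N)); split.
  by rewrite lcompZl -lcompZr.
by rewrite lcompZr -lcompZl.
Qed.

Lemma nonunit_one N : ~ nonunit (fun i => (idfun : {linear N i -> N i}) : linT _ _).
Proof.
move=> [f [fE nf]]; apply: nf; have -> : f = cmor_id N; last exact: liso_id.
by apply: cmorP => i x; rewrite -(fE i).
Qed.

(** A contractible complex is excluded because its identity is null-homotopic. *)
Lemma nonunit_null N (s : forall i j, {linear N i -> N j}) u : ~ contractible N ->
  (forall i x, (u i : {linear _ -> _}) x = hmap s x) -> @nonunit N u.
Proof.
move=> nN us; exists (null_cmor s); split; first by move=> i; apply: linear_ext => x; apply: us.
by move/liso_nullh => h; apply: nN; apply: h; apply: null_cmor_nullh.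
Qed.

Lemma indec_near a b W i (x : W i) : a <= i <= b -> lindec LB W -> x <> 0 ->
  concentrated W (a - nu.+1%:Z) (b + nu.+1%:Z).
Proof.
move=> i_in iW x0; have [c cW] := bounded_support hnu iW.
have i2 : c <= i <= c + nu.+1%:Z by apply/negPn/negP => /cW/(_ x).
by move=> j nj; apply: cW; move: nj; lia.
Qed.

Lemma cmor_neq0 (X Y : cplx A int) (h : cmor X Y) : h <> 0 -> exists i x, h i x <> 0.
Proof.
move=> h0; apply: contrapT => nh; apply: h0; apply: cmorP => i x.
by apply: contrapT => hx; apply: nh; exists i, x.
Qed.

Lemma split_epi_of_liso W N (h : cmor W N) (v : cmor N W) :
  is_liso (cmor_comp h v) -> sepi LB (h : @lhom k LB W N).
Proof. by move=> [g [_ hvg]]; exists ((v : @lhom k LB N W) ** g); apply: etrans hvg; apply: cmorP. Qed.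

Lemma split_mono_of_liso W N (h : cmor N W) (v : cmor W N) :
  is_liso (cmor_comp v h) -> smono LB (h : @lhom k LB N W).
Proof. by move=> [g [gvh _]]; exists (g ** (v : @lhom k LB W N)); apply: etrans gvh; apply: cmorP. Qed.

(** If h is not a split epimorphism no composite h v is invertible.  The
indecomposable complexes W with a nonzero map to N stay within distance nu + 1
of the support of N, which determines where Q may be cut off. *)
Lemma right_cocycle N : lindec LB N -> ~ contractible N -> exists Q (w : cmor N Q),
  ~ nullh w /\ forall W (h : cmor W N), lindec LB W -> ~ sepi LB (h : @lhom k LB W N) ->
    nullh (cmor_comp w h).
Proof.
move=> iN nN; have [a [b cN]] := bcob_bounded N.
pose B := (`|b - a| + 2)%N; pose T := (`|b - a| + nu + 6)%N.
have ZB i : lid (obj_at N i) = 0 \/ exists t, (0 < t < B)%N /\ i = deg_at 1 (b + 1) t.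
  have [i_in|/cN x0] := boolP (a <= i <= b); [right|left].
    by exists (absz (b + 1 - i)%R); rewrite /B /deg_at; lia.
  by apply: linear_ext => x; apply: x0.
have cZ : is_pcx 1 (fun i j => diff N i j : @lhom k (projL A) (obj_at N i) (obj_at N j)).
  by split=> [i j nj|i j l]; apply: linear_ext => x; [apply: diff_shape|apply: diff_comp].
have BT : (B <= T)%N by rewrite /B /T; lia.
have T0 : (0 < T)%N by rewrite /T; lia.
have [|||Q [dQ [w [[[Qs Qd] QT] wch wn wh]]]] := @radical_cocycle k (projL A) (proj_generator A) 1 (b + 1)
  (or_introl erefl) (obj_at N) _ B T cZ ZB BT T0 (@nonunit N).
- by move=> c u v; apply: nonunit_lin.
- by move=> s; apply: (nonunit_null (s := s)).
- exact: nonunit_one.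
pose Qc := @cplx_of k A int (fun i => Q i) (fun i j => dQ i j)
  (fun i j x nj => congr1 (linT_at x) (Qs i j nj))
  (fun i j l x => congr1 (linT_at x) (Qd i j l)) (fun i => pmodP (Q i)).
have Qb : exists a b, concentrated Qc a b.
  exists (b + 1 - T%:Z), (b + 1) => i ni x; have [Q0|[t [tT ei]]] := QT i.
    exact: (congr1 (linT_at x) Q0).
  by case/negP: ni; move: ei tT; rewrite /deg_at; lia.
have wc i j x : (w j : {linear _ -> _}) (diff N i j x) = diff Qc i j ((w i : {linear _ -> _}) x).
  exact: esym (congr1 (linT_at x) (wch i j)).
exists (BCplx Qb), (@CMor _ _ N Qc (fun i => w i) wc); split.
  by move=> [s sP]; apply: wn; exists s => i; apply: linear_ext => x; apply: sP.
move=> W h iW nh; have [h0|h0] := pselect (h = 0).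
  by rewrite h0; have -> : cmor_comp (@CMor _ _ N Qc (fun i => w i) wc) (0 : cmor W N) = 0; [apply: cmorP => i x; apply: linear0|apply: nullh0].
have cW : concentrated W (a - nu.+1%:Z) (b + nu.+1%:Z).
  have [i [x hx]] := cmor_neq0 h0; apply: (@indec_near a b W i x _ iW).
    by apply/negPn/negP => /cN/(_ (h i x)).
  by move=> x0; apply: hx; rewrite x0 linear0.
have [||||s sP] := wh (obj_at W) (fun i j => diff W i j : @lhom k (projL A) (obj_at W i) (obj_at W j)) (fun i => h i).
- by split=> [i j nj|i j l]; apply: linear_ext => x; [apply: diff_shape|apply: diff_comp].
- by move=> i j; apply: linear_ext => x; apply: esym (mor_comm h j x).
- move=> t tT; apply: linear_ext => x; apply: cW; move: tT; rewrite /T /deg_at; lia.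
- move=> v vch.
  have vc i j x : (v j : {linear _ -> _}) (diff N i j x) = diff W i j ((v i : {linear _ -> _}) x).
    exact: esym (congr1 (linT_at x) (vch i j)).
  exists (cmor_comp h (@CMor _ _ N W (fun i => v i) vc)); split; first by [].
  by move/split_epi_of_liso.
by exists s => i x; apply: (congr1 (linT_at x) (sP i)).
Qed.

(** The opposite of the category of projective modules has a generator too; degrees
are run through upwards, with eps = -1. *)
Lemma left_cocycle N : lindec LB N -> ~ contractible N -> exists Q (w : cmor Q N),
  ~ nullh w /\ forall W (h : cmor N W), lindec LB W -> ~ smono LB (h : @lhom k LB N W) ->
    nullh (cmor_comp h w).
Proof.
move=> iN nN; have [a [b cN]] := bcob_bounded N.
pose B := (`|b - a| + 2)%N; pose T := (`|b - a| + nu + 6)%N.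
pose PO := opL (projL A).
have ZB i : @lid k PO (obj_at N i) = 0 \/ exists t, (0 < t < B)%N /\ i = deg_at (-1) (a - 1) t.
  have [i_in|/cN x0] := boolP (a <= i <= b); [right|left].
    by exists (absz (i - a + 1)%R); rewrite /B /deg_at; lia.
  by apply: linear_ext => x; apply: x0.
pose opdiff X (i j : int) : @lhom k PO (obj_at X i) (obj_at X j) := diff X j i.
have cop X : is_pcx (-1) (opdiff X).
  split=> [i j nj|i j l]; apply: linear_ext => x; last exact: diff_comp.
  by apply: diff_shape; apply: contraNneq nj => ->; rewrite addrK.
have BT : (B <= T)%N by rewrite /B /T; lia.
have T0 : (0 < T)%N by rewrite /T; lia.
have [|||Q [dQ [w [[[Qs Qd] QT] wch wn wh]]]] := @radical_cocycle k PO
  (op_generator (proj_generator A)) (-1) (a - 1)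
  (or_intror erefl) (obj_at N) (opdiff N) B T (cop N) ZB BT T0 (@nonunit N).
- by move=> c u v; apply: nonunit_lin.
- move=> s; apply: (nonunit_null (s := fun i j => s j i)) => // i x.
  by rewrite /phomot opprK /hmap addrC.
- exact: nonunit_one.
have Qs' i j x : j != i + 1 -> (dQ j i : {linear Q i -> Q j}) x = 0.
  move=> nj; have e : dQ j i = 0 by apply: Qs; apply: contraNneq nj => ->; rewrite subrK.
  by rewrite e.
pose Qc := @cplx_of k A int (fun i => Q i) (fun i j => dQ j i) Qs'
  (fun i j l x => congr1 (linT_at x) (Qd l j i)) (fun i => pmodP (Q i)).
have Qb : exists a b, concentrated Qc a b.
  exists (a - 1), (a - 1 + T%:Z) => i ni x; have [Q0|[t [tT ei]]] := QT i.
    exact: (congr1 (linT_at x) Q0).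
  by case/negP: ni; move: ei tT; rewrite /deg_at; lia.
have wc i j x : (w j : {linear Q j -> N j}) (diff Qc i j x) = diff N i j ((w i : {linear Q i -> N i}) x).
  exact: (congr1 (linT_at x) (wch j i)).
exists (BCplx Qb), (@CMor _ _ Qc N (fun i => w i) wc); split.
  move=> [s sP]; apply: wn; exists (fun i j => s j i) => i; apply: linear_ext => x.
  by rewrite /phomot opprK; apply: etrans (sP i x) _; rewrite /hmap addrC.
move=> W h iW nh; have [h0|h0] := pselect (h = 0).
  rewrite h0; have -> : cmor_comp (0 : cmor N W) (@CMor _ _ Qc N (fun i => w i) wc) = 0; last exact: nullh0.
  exact: cmorP.
have cW : concentrated W (a - nu.+1%:Z) (b + nu.+1%:Z).
  have [i [x hx]] := cmor_neq0 h0; apply: (indec_near _ iW hx).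
  by apply/negPn/negP => /cN/(_ x) x0; apply: hx; rewrite x0 linear0.
have [||||s sP] := wh (obj_at W) (opdiff W) (fun i => h i).
- exact: cop.
- by move=> i j; apply: linear_ext => x; apply: (mor_comm h i x).
- move=> t tT; apply: linear_ext => x; apply: cW; move: tT; rewrite /T /deg_at; lia.
- move=> v vch.
  have vc i j x : (v j : {linear W j -> N j}) (diff W i j x) = diff N i j ((v i : {linear W i -> N i}) x).
    exact: (congr1 (linT_at x) (vch j i)).
  exists (cmor_comp (@CMor _ _ W N (fun i => v i) vc) h); split; first by [].
  by move/split_mono_of_liso.
exists (fun i j => s j i) => i x.
apply: etrans (congr1 (linT_at x) (sP i)) _.
by rewrite /phomot opprK /hmap addrC.
Qed.

Section NegShift.
Variables (c : int) (Q : bcplx A).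

Fact nshift_shape (i j : int) x : j != i + 1 -> (\- diff Q (i + c) (j + c)) x = 0.
Proof.
move=> nj; rewrite /= diff_shape ?oppr0 //; apply: contraNneq nj => e.
by apply/eqP/(addIr c); rewrite e addrAC.
Qed.
Fact nshift_comp (i j l : int) x : (\- diff Q (j + c) (l + c)) ((\- diff Q (i + c) (j + c)) x) = 0.
Proof. by rewrite /= linearN diff_comp !oppr0. Qed.
Definition nshift : cplx A int := @Cplx A int (fun i => Q (i + c)) (fun i j => \- diff Q (i + c) (j + c))
  nshift_shape nshift_comp (fun i => cob_fg Q (i + c)) (fun i => @cob_proj _ _ Q (i + c)).
End NegShift.

Section RightCone.
Variables (N Q : bcplx A) (w : cmor N Q).

(** The cocone of w: N extended by Q shifted by -1, with w as the twist. *)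
Definition rtau (i j : int) : {linear N i -> nshift (-1) Q j} := ccast i (j - 1) \o w i.
Lemma rtau_shape i j x : j != i + 1 -> rtau i j x = 0.
Proof. by move=> nj; rewrite /rtau /= ccast_fun_ne //; apply: contraNneq nj => ->; rewrite subrK. Qed.
Lemma rtau_comp i j l x : diff (nshift (-1) Q) j l (rtau i j x) + rtau j l (diff N i j x) = 0.
Proof.
have [ej|nj] := eqVneq j (i + 1); last first.
  by rewrite rtau_shape // (diff_shape x nj) !linear0 addr0.
have [el|nl] := eqVneq l (j + 1); last by rewrite (diff_shape _ nl) rtau_shape // addr0.
have e1 : i = j - 1 by rewrite ej addrK.
have e2 : j = l - 1 by rewrite el addrK.
rewrite /rtau /= mor_comm; move: (j - 1) (l - 1) e1 e2 => j' l' <- <-.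
by rewrite !ccast_fun_id addNr.
Qed.
Definition rcone_cplx := twisted rtau_shape rtau_comp.
Lemma rcone_bounded : exists a b, concentrated rcone_cplx a b.
Proof.
have [a [b cN]] := bcob_bounded N; have [c [d cQ]] := bcob_bounded Q.
exists (Num.min a c - 1), (Num.max b d + 1) => i ni [x y]; congr pair.
  by apply: cQ; move: ni; lia.
by apply: cN; move: ni; lia.
Qed.
Definition rcone : bcplx A := BCplx rcone_bounded.
Definition rcone_out : cmor rcone N := twisted_out rtau_shape rtau_comp.

Lemma rcone_lift W (h : cmor W N) : nullh (cmor_comp w h) ->
  exists h' : cmor W rcone, cmor_comp rcone_out h' = h.
Proof.
move=> [s sP].
have hl i : linear (fun x : W i => (s i (i - 1) x, h i x) : (Q (i - 1)%R * N i)%type).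
  by move=> c x y; congr pair; rewrite !linearP.
have hc i j x : mklin (hl j) (diff W i j x) = diff rcone i j (mklin (hl i) x).
  congr pair; rewrite /= ?mor_comm //.
  have [ej|nj] := eqVneq j (i + 1); last first.
    rewrite (diff_shape x nj) linear0 ccast_fun_ne; last by apply: contraNneq nj => ->; rewrite subrK.
    rewrite addr0 diff_shape ?oppr0 //; apply: contraNneq nj => e.
    by apply/eqP/(addIr (-1)); rewrite e addrAC.
  have := sP i x; rewrite /= /hmap -ej => ->.
  have e1 : i = j - 1 by rewrite ej addrK.
  move: (j - 1) e1 => j' <-.
  by rewrite ccast_fun_id addKr.
by exists (@CMor _ _ W rcone (fun i => mklin (hl i)) hc); apply: cmorP.
Qed.

Lemma rcone_section (s : cmor N rcone) : cmor_comp rcone_out s = cmor_id N -> nullh w.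
Proof.
move=> os; have s2 i x : (s i x).2 = x by have := congr1 (fun u : cmor N N => u i x) os.
pose s1 i : {linear N i -> Q (i - 1)} := (fst : {linear (Q (i - 1)%R * N i)%type -> Q (i - 1)}) \o s i.
exists (fun i j => ccast (i - 1) j \o s1 i) => i x; rewrite /hmap /= ccast_fun_id.
have := congr1 fst (mor_comm s (i + 1) x); rewrite /= s2 => ->.
have e1 : i = i + 1 - 1 by rewrite addrK.
move: (i + 1 - 1) e1 => j' <-.
by rewrite !ccast_fun_id addrA addrN add0r.
Qed.
End RightCone.

Section LeftCone.
Variables (N Q : bcplx A) (w : cmor Q N).

Definition ltau (i j : int) : {linear nshift 1 Q i -> N j} := w j \o ccast (i + 1) j.
Lemma ltau_shape i j x : j != i + 1 -> ltau i j x = 0.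
Proof. by move=> nj; rewrite /ltau /= ccast_fun_ne ?linear0 // eq_sym. Qed.
Lemma ltau_comp i j l x : diff N j l (ltau i j x) + ltau j l (diff (nshift 1 Q) i j x) = 0.
Proof.
have [ej|nj] := eqVneq j (i + 1); last first.
  by rewrite ltau_shape // (diff_shape (c := nshift 1 Q) x nj) !linear0 addr0.
have [el|nl] := eqVneq l (j + 1); last by rewrite (diff_shape _ nl) ltau_shape // addr0.
rewrite /ltau [X in X + _]/= -mor_comm.
rewrite -/(ccast (i + 1) j x) (@ccast_diff _ _ Q _ _ _ _ x (esym ej) (esym el)).
change (w l (ccast (j + 1) l (diff Q (i + 1) (j + 1) x))
  + w l (ccast (j + 1) l (- diff Q (i + 1) (j + 1) x)) = 0).
by rewrite !linearN addrN.
Qed.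
Definition lcone_cplx := twisted ltau_shape ltau_comp.
Lemma lcone_bounded : exists a b, concentrated lcone_cplx a b.
Proof.
have [a [b cN]] := bcob_bounded N; have [c [d cQ]] := bcob_bounded Q.
exists (Num.min a c - 1), (Num.max b d + 1) => i ni [x y]; congr pair.
  by apply: cN; move: ni; lia.
by apply: cQ; move: ni; lia.
Qed.
Definition lcone : bcplx A := BCplx lcone_bounded.
Definition lcone_in : cmor N lcone := twisted_in ltau_shape ltau_comp.

Lemma lcone_ext W (h : cmor N W) : nullh (cmor_comp h w) ->
  exists h' : cmor lcone W, cmor_comp h' lcone_in = h.
Proof.
move=> [s sP].
have hl i : linear (fun p : (N i * Q (i + 1)%R)%type => h i p.1 + s (i + 1) i p.2).
  by move=> c x y; rewrite /= !linearP scalerDr addrACA.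
have hc i j x : mklin (hl j) (diff lcone i j x) = diff W i j (mklin (hl i) x).
  rewrite /= !linearD mor_comm -addrA; congr (_ + _); rewrite /= linearN /=.
  have [ej|nj] := eqVneq j (i + 1); last first.
    rewrite ccast_fun_ne ?linear0 1?eq_sym // (diff_shape (c := W)) // diff_shape ?linear0 ?subr0 ?addr0 //.
    by apply: contraNneq nj => e; apply/eqP/(addIr 1).
  have := sP j (ccast (i + 1) j x.2); rewrite /= /hmap => ->.
  have e1 : i = j - 1 by rewrite ej addrK.
  move: (j - 1) e1 => j' <-.
  suff gen i' (y : Q i') : j = i' -> diff W i j (s j i (ccast_fun j y)) +
      s (j + 1) j (diff Q j (j + 1) (ccast_fun j y)) - s (j + 1) j (diff Q i' (j + 1) y) =
      diff W i j (s i' i y) by apply: gen.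
  by move=> e; subst i'; rewrite !ccast_fun_id addrK.
by exists (@CMor _ _ lcone W (fun i => mklin (hl i)) hc); apply: cmorP => i x; rewrite /= linear0 addr0.
Qed.

Lemma lcone_retraction (r : cmor lcone N) : cmor_comp r lcone_in = cmor_id N -> nullh w.
Proof.
move=> ri; have r1 i x : r i (x, 0) = x by have := congr1 (fun u : cmor N N => u i x) ri.
have rl i : linear (fun q : Q (i + 1) => r i (0, q)).
  by move=> c x y; rewrite -linearP; congr (r i _); congr pair; rewrite /= scaler0 addr0.
exists (fun i j => mklin (rl j) \o ccast i (j + 1)) => i x; rewrite /hmap /= ccast_fun_id.
have rD l x' y : r l (x', y) = x' + r l (0, y).
  by rewrite -{2}(r1 l x') -linearD; congr (r l _); congr pair; rewrite /= ?addr0 ?add0r.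
pose q := ccast i (i - 1 + 1) x.
have dE : diff lcone (i - 1) i (0, q) =
    (w i (ccast (i - 1 + 1) i q), - diff Q (i - 1 + 1) (i + 1) q) :> lcone i.
  by congr pair; rewrite /= ?linear0 ?add0r.
have := mor_comm r i ((0, q) : lcone (i - 1)); rewrite dE rD /q /= => <-.
have e1 : i = i - 1 + 1 by rewrite subrK.
move: (i - 1 + 1) e1 => i' <-; rewrite !ccast_fun_id -addrA -linearD.
rewrite [X in r i X](_ : _ = 0) ?linear0 ?addr0 //.
by congr pair; rewrite /= ?addr0 // addNr.
Qed.
End LeftCone.

End AlmostSplitBounded.

Section AlmostSplitMaps.
Variables (k : fieldType) (A : falgType k) (nu : nat).
Hypothesis hnu : sgldim A nu.
Notation LB := (bndL A).
Let splB := @bndL_splits k A.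

(** The cocone of w.  A map into N lifts to it when its composite with w is
null-homotopic, which is tested on the indecomposable summands of W. *)
Lemma bnd_ras (N : LB) : lindec LB N -> ~ contractible (N : bcplx A) ->
  exists E (g : @lhom k LB E N), ras LB g.
Proof.
move=> iN nN; have [Q [w [wn wh]]] := right_cocycle hnu iN nN.
exists (rcone w), (rcone_out w); split; first by move=> [s /rcone_section].
move=> W h nh; have [n [Y [[i [p [pi ort tot]]] iY]]] := decomposition splB W.
have lift j : exists h' : @lhom k LB (Y j) (rcone w), (rcone_out w : @lhom k LB _ _) ** h' = h ** i j.
  apply: (rcone_lift (h := h ** i j : cmor (Y j : bcplx A) N)); apply: wh => // -[s hs].
  apply: nh; exists ((i j : @lhom k LB _ _) ** s).
  exact: (etrans (lcompA (h : @lhom k LB _ _) _ _) hs).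
exists (\sum_(j < n) sval (cid (lift j)) ** p j).
apply: etrans (@lcomp_sumr k LB _ _ _ _ _ _ _ _) _; transitivity (\sum_(j < n) h ** i j ** p j).
  by apply: eq_bigr => j _; rewrite (lcompA (rcone_out w : @lhom k LB _ _)) (svalP (cid (lift j))).
transitivity (h ** \sum_(j < n) (i j : @lhom k LB _ _) ** (p j : @lhom k LB _ _)).
  by rewrite lcomp_sumr; apply: eq_bigr => j _; rewrite lcompA.
by rewrite [X in h ** X]tot; apply: lcompf1.
Qed.

Lemma bnd_las (N : LB) : lindec LB N -> ~ contractible (N : bcplx A) ->
  exists E (f : @lhom k LB N E), las LB f.
Proof.
move=> iN nN; have [Q [w [wn wh]]] := left_cocycle hnu iN nN.
exists (lcone w), (lcone_in w); split; first by move=> [s /lcone_retraction].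
move=> W h nh; have [n [Y [[i [p [pi ort tot]]] iY]]] := decomposition splB W.
have ext j : exists h' : @lhom k LB (lcone w) (Y j), h' ** (lcone_in w : @lhom k LB _ _) = (p j : @lhom k LB _ _) ** h.
  apply: (lcone_ext (h := (p j : @lhom k LB _ _) ** h : cmor (N : bcplx A) (Y j))); apply: wh => // -[s hs].
  apply: nh; exists (s ** (p j : @lhom k LB _ _)).
  exact: (etrans (esym (lcompA (s : @lhom k LB _ _) _ _)) hs).
exists (\sum_(j < n) (i j : @lhom k LB _ _) ** sval (cid (ext j))).
apply: etrans (@lcomp_suml k LB _ _ _ _ _ _ _ _) _; transitivity (\sum_(j < n) (i j : @lhom k LB _ _) ** ((p j : @lhom k LB _ _) ** h)).
  by apply: eq_bigr => j _; rewrite -lcompA (svalP (cid (ext j))).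
transitivity ((\sum_(j < n) (i j : @lhom k LB _ _) ** (p j : @lhom k LB _ _)) ** h).
  by rewrite lcomp_suml; apply: eq_bigr => j _; rewrite lcompA.
by rewrite [X in X ** h]tot; apply: lcomp1f.
Qed.

End AlmostSplitMaps.

(** * Contractible periodic complexes *)

Section CompressContractible.
Variables (k : fieldType) (A : falgType k) (m : nat) (N : bcplx A).
Variable s : forall i j, {linear N i -> N j}.

Program Definition compr_homotopy (i i' : 'Z_m) (x : dsum N i) : dsum N i' :=
  @DSum _ _ _ _ (fun j => if j%:~R == i' then s (j + 1) j (x (j + 1)) else 0) _ _.
Next Obligation.
move=> i i' x; have [a [b ab]] := bcob_bounded N.
by exists a, b => j jn; case: ifP => // _; apply: ab.
Qed.
Next Obligation. by move=> i i' x j /negPf ->. Qed.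
Fact compr_homotopy_linear i i' : linear (@compr_homotopy i i').
Proof.
move=> c x y; apply: dsumP => j /=; case: ifP => _; last by rewrite scaler0 addr0.
by rewrite linearP.
Qed.

Lemma compr_contractible_aux : (forall i x, x = hmap s x :> N i) ->
  contractible (compr_ob m N : cplx A 'Z_m).
Proof.
move=> sh; exists (fun i i' => mklin (@compr_homotopy_linear i i')) => i x.
apply: dsumP => j; rewrite /= /hmap.
change (x j = (if i == i - 1 + 1 then diff N (j - 1) j
      (if (j - 1)%:~R == i - 1 :> 'Z_m then s (j - 1 + 1) (j - 1) (x (j - 1 + 1)) else 0) else 0)
   + (if j%:~R == i :> 'Z_m then s (j + 1) j
      (if i + 1 == i + 1 then diff N (j + 1 - 1) (j + 1) (x (j + 1 - 1)) else 0) else 0)).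
rewrite subrK !eqxx intrB mulr1z (inj_eq (addIr _)) subrK addrK.
case: eqP => [_|/eqP nj]; last by rewrite linear0 addr0 (fam_res _ nj).
exact: sh.
Qed.
End CompressContractible.

Lemma compr_contractible (k : fieldType) (A : falgType k) m (N : bcplx A) :
  contractible N -> contractible (compr_ob m N : cplx A 'Z_m).
Proof. by move=> [s sh]; apply: compr_contractible_aux sh. Qed.

(** An irreducible map f between indecomposable contractible complexes V, in the
degrees i and i + 1, and W, in the degrees i' and i' + 1, is factored through a
complex U such that a splitting of either factor splits f or kills V or W. *)
Section NoIrreducible.
Variables (k : fieldType) (A : falgType k) (m : nat).
Notation LP := (perL A m).
Notation I := 'Z_m.
Variables (V W : cplx A I) (f : cmor V W).
Variables (i : I) (s : {linear V (i + 1) -> V i}).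
Hypothesis V_out : forall j, j != i -> j != i + 1 -> forall x : V j, x = 0.
Hypothesis sd : forall x, s (diff V i (i + 1) x) = x.
Hypothesis ds : forall x, diff V i (i + 1) (s x) = x.
Hypotheses (V0 : lid (V : LP) <> 0) (W0 : lid (W : LP) <> 0).

Lemma succ_ne (j : I) : j + 1 != j.
Proof. by rewrite -subr_eq0 addrAC subrr add0r oner_neq0. Qed.

Let V_diff0 j l x : j != i -> diff V j l x = 0.
Proof.
move=> ji; have [ej|nj] := eqVneq j (i + 1); last by rewrite (V_out ji nj x) linear0.
by subst j; rewrite -(ds x) diff_comp.
Qed.

Variables (i' : I) (t : {linear W (i' + 1) -> W i'}).
Hypothesis W_out : forall j, j != i' -> j != i' + 1 -> forall x : W j, x = 0.
Hypothesis td : forall x, t (diff W i' (i' + 1) x) = x.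
Hypothesis dt : forall x, diff W i' (i' + 1) (t x) = x.

Let W_diff0 j l x : j != i' -> diff W j l x = 0.
Proof.
move=> ji; have [ej|nj] := eqVneq j (i' + 1); last by rewrite (W_out ji nj x) linear0.
by subst j; rewrite -(dt x) diff_comp.
Qed.


Section SameDegree.
Hypothesis ii' : i' = i.

(** As the differentials are invertible, a chain map is determined by its
component in degree i + 1. *)
Lemma two_term_mor (P : {linear W (i + 1) -> V (i + 1)}) : exists g : cmor W V,
  (forall y, g (i + 1) y = P y) /\ (forall y, g i y = s (P (diff W i (i + 1) y))).
Proof.
pose u1 j : {linear W j -> V j} := (ccast (i + 1) j : {linear V (i + 1) -> V j}) \o (P \o (ccast j (i + 1) : {linear W j -> W (i + 1)})).
pose u0 j : {linear W j -> V j} := (ccast i j : {linear V i -> V j}) \o (s \o (P \o diff W j (i + 1))).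
have gc j l x : (u1 l \+ u0 l) (diff W j l x) = diff V j l ((u1 j \+ u0 j) x).
  change (ccast (i + 1) l (P (ccast l (i + 1) (diff W j l x))) + ccast i l (s (P (diff W l (i + 1) (diff W j l x)))) =
   diff V j l (ccast (i + 1) j (P (ccast j (i + 1) x)) + ccast i j (s (P (diff W j (i + 1) x))))).
  rewrite diff_comp !linear0 addr0.
  have [ji|ji] := eqVneq j i; last by rewrite W_diff0 ?ii' // V_diff0 // !linear0.
  subst j; have [li|li] := eqVneq l (i + 1); last by rewrite !diff_shape // !linear0.
  by subst l; rewrite !ccast_id linearD (ccast_ne _ (succ_ne i)) linear0 add0r ds.
exists (@CMor _ _ W V (fun j => u1 j \+ u0 j) gc); split=> y.
  rewrite /= !ccast_fun_id ccast_fun_ne ?addr0 // eq_sym; exact: succ_ne.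
by rewrite /= ccast_fun_id ccast_fun_ne ?add0r //; apply: succ_ne.
Qed.

Let Bd (j : I) := (V j * W j)%type : lmodType A.
Fact mid_D_subproof j l : linear (fun p : Bd j => (0, diff W j l (f j p.1)) : Bd l).
Proof. by move=> c p q; congr pair; rewrite /= ?scaler0 ?addr0 // !linearP. Qed.
Fact mid_e_subproof j : linear (fun p : Bd j => (if j == i then (p.1, 0) else if j == i + 1 then (0, p.2) else 0) : Bd j).
Proof.
move=> c p q; case: ifP => _; last case: ifP => _; congr pair; rewrite /= ?scaler0 ?addr0 //.
Qed.
Let D j l : {linear Bd j -> Bd l} := mklin (@mid_D_subproof j l).
Let e j : {linear Bd j -> Bd j} := mklin (@mid_e_subproof j).

(** U is the complex V i -> W (i + 1), cut out of V + W by the idempotent e. *)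
Lemma same_degree_reducible : ~ @irreducible (acat LP) V W f.
Proof.
move=> [nm ne fac].
have ei p : e i p = (p.1, 0) by rewrite /e /= eqxx.
have ei1 p : e (i + 1) p = (0, p.2) by rewrite /e /= (negPf (succ_ne i)) eqxx.
have eo j p : j != i -> j != i + 1 -> e j p = 0 by rewrite /e /= => /negPf-> /negPf->.
have ee j p : e j (e j p) = e j p.
  by rewrite /e /=; case: (j == i); last case: (j == i + 1).
have eDeD j l r p : e r (D l r (e l (D j l (e j p)))) = 0.
  have [li|li] := eqVneq l i; first by subst l; rewrite (ei (D _ _ _)) (_ : (_, _) = 0) ?linear0 ?[X in e r X]linear0 //.
  have -> : D l r (e l (D j l (e j p))) = 0.
    congr pair; rewrite [e l _]/=; have [ll|ll] := eqVneq l (i + 1).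
      by rewrite (negPf li) /= !linear0.
    by rewrite (negPf li) /= !linear0.
  exact: linear0.
have Ds j l p : l != j + 1 -> D j l p = 0 by move=> lj; congr pair; rewrite /= diff_shape.
(* a is (1, f) and b is (f, 1) on the two components of U. *)
pose U := fix_cplx (fun j => dual_basis_pair (cob_dual V j) (cob_dual W j)) Ds ee eDeD.
have al j : linear (fun x : V j => fix_pr (@ee j) (x, f j x)) by move=> c x y; rewrite -linearP; congr (fix_pr_fun _ _); congr pair; rewrite linearP.
have ac j l x : mklin (al l) (diff V j l x) = diff U j l (mklin (al j) x).
  apply: fixmodP.
  change (e l (diff V j l x, f l (diff V j l x)) = e l (D j l (e j (x, f j x)))).
  have [lj|lj] := eqVneq l (j + 1); last first.
    by rewrite Ds // !diff_shape // linear0.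
  have [ji|ji] := eqVneq j i.
    by subst j l; rewrite !ei1 ei /= mor_comm.
  rewrite V_diff0 // linear0; have -> : e j (x, f j x) = (0, (e j (x, f j x)).2).
    by rewrite /e /= (negPf ji); case: ifP.
  by rewrite [D j l _](_ : _ = 0) //; congr pair; rewrite /= !linear0.
pose a : cmor V U := @CMor _ _ V U (fun j => mklin (al j)) ac.
have bl j : linear (fun u : U j => f j (fval u).1 + (fval u).2).
  by move=> c x y; rewrite /= linearP scalerDr addrACA.
have bc j l u : mklin (bl l) (diff U j l u) = diff W j l (mklin (bl j) u).
  change (f l (e l (D j l (fval u))).1 + (e l (D j l (fval u))).2 = diff W j l (f j (fval u).1 + (fval u).2)).
  have [lj|lj] := eqVneq l (j + 1); last first.
    by rewrite Ds // linear0 diff_shape // linear0 addr0.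
  have [ji|ji] := eqVneq j i.
    subst j l; rewrite ei1 /= linear0 add0r -(fvalP u) ei /=.
    by rewrite addr0.
  rewrite W_diff0 ?ii' // -(fvalP u).
  have -> : D j l (e j (fval u)) = 0.
    by congr pair; rewrite /= (negPf ji); case: ifP; rewrite /= !linear0.
  by rewrite linear0 /= linear0 addr0.
pose b : cmor U W := @CMor _ _ U W (fun j => mklin (bl j)) bc.
have fdi j x : j != i -> j != i + 1 -> f j x = 0.
  by move=> h1 h2; rewrite (V_out h1 h2 x) linear0.
have ba : cmor_comp b a = f.
  apply: cmorP => j x.
  change (f j (e j (x, f j x)).1 + (e j (x, f j x)).2 = f j x).
  have [ej|ji] := eqVneq j i; first by subst j; rewrite ei addr0.
  have [ej|ji1] := eqVneq j (i + 1); first by subst j; rewrite ei1 /= linear0 add0r.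
  by rewrite eo //; apply: etrans (addr0 _) _; rewrite !fdi.
case: (fac U a b ba) => [[r ra]|[q bq]].
  have Pl : linear (fun y : W (i + 1) => r (i + 1) (fix_pr (@ee (i + 1)) (0, y))).
    by move=> c x y; rewrite -!linearP; congr (r _ (fix_pr _ _)); congr pair; rewrite /= scaler0 addr0.
  have Pf x : mklin Pl (f (i + 1) x) = x.
    apply: etrans (congr1 (fun u : cmor V V => u (i + 1) x) ra).
    by congr (r _ _); apply: fixmodP; rewrite /= (negPf (succ_ne i)) eqxx.
  have [g [g1 g0]] := two_term_mor (mklin Pl).
  apply: nm; exists g; apply: cmorP => j x.
  have [ej|ji] := eqVneq j i; first by subst j; apply: etrans (g0 _) _; rewrite -mor_comm Pf sd.
  have [ej|ji1] := eqVneq j (i + 1); first by subst j; apply: etrans (g1 _) _; rewrite Pf.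
  by rewrite (V_out ji ji1 x) !linear0.
have Ql : linear (fun y : W i => (fval (q i y)).1 : V i) by move=> c x y; rewrite linearP.
have fQ y : f i (mklin Ql y) = y.
  apply: etrans (congr1 (fun u : cmor W W => u i y) bq).
  change (f i (fval (q i y)).1 = f i (fval (q i y)).1 + (fval (q i y)).2).
  by rewrite -(fvalP (q i y)) ei /= addr0.
move: t td dt W_out; rewrite ii' => t' td' dt' W_out'.
have [g [g1 g0]] := two_term_mor (diff V i (i + 1) \o (mklin Ql \o t')).
apply: ne; exists g; apply: cmorP => j x.
have [ej|ji] := eqVneq j i.
  subst j; apply: etrans (congr1 (f i) (g0 x)) _.
  by apply: etrans (fQ x); congr (f i _); apply: etrans (sd _) _; congr (mklin Ql _); apply: td'.
have [ej|ji1] := eqVneq j (i + 1).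
  subst j; apply: etrans (congr1 (f (i + 1)) (g1 x)) _.
  by apply: etrans (mor_comm f _ _) _; rewrite [f i _]fQ dt'.
by rewrite (W_out' _ ji ji1 x) !linear0.
Qed.
End SameDegree.

(** Since W has no nonzero differential out of degree i, f vanishes outside
degree i, and U is V i as a stalk complex. *)
Lemma other_degree_reducible : i' != i -> ~ @irreducible (acat LP) V W f.
Proof.
move=> nii [nm ne fac].
have el j : linear (fun x : V j => if j == i then x else 0).
  by move=> c x y; case: ifP => _; rewrite // scaler0 addr0.
pose e j : {linear V j -> V j} := mklin (el j).
have ei j x : j = i -> e j x = x by move=> ji; subst j; rewrite /e /= eqxx.
have eo j x : j != i -> e j x = 0 by rewrite /e /= => /negPf->.
have ee j x : e j (e j x) = e j x.
  by have [ji|ji] := eqVneq j i; [rewrite !(ei j)|rewrite !(eo j) ?linear0].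
have eD j l x : e l (diff V j l x) = 0.
  have [ji|ji] := eqVneq j i; last by rewrite V_diff0 // linear0.
  have [lj|lj] := eqVneq l (j + 1); last by rewrite diff_shape // linear0.
  by rewrite eo // lj ji succ_ne.
have eDeD j l r x : e r (diff V l r (e l (diff V j l (e j x)))) = 0.
  by rewrite eD.
have f0 j x : j != i -> f j x = 0.
  move=> ji; have [ej|ji1] := eqVneq j (i + 1); last by rewrite (V_out ji ji1 x) linear0.
  by subst j; rewrite -(ds x) mor_comm W_diff0 // eq_sym.
pose U := fix_cplx (cob_dual V) (@diff_shape _ _ V) ee eDeD.
have ac j l x : fix_pr (@ee l) (diff V j l x) = diff U j l (fix_pr (@ee j) x).
  by apply: fixmodP; exact: etrans (eD _ _ _) (esym (eD _ _ _)).
pose a : cmor V U := @CMor _ _ V U (fun j => fix_pr (@ee j)) ac.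
have bc j l u : f l (fval (diff U j l u)) = diff W j l (f j (fval u)).
  apply: etrans (_ : f l (e l (diff V j l (fval u))) = _) _ => //.
  rewrite eD linear0; have [ji|ji] := eqVneq j i; last by rewrite f0 // linear0.
  by rewrite W_diff0 // ji eq_sym.
pose b : cmor U W := @CMor _ _ U W (fun j => f j \o fix_in (e j)) bc.
have ba : cmor_comp b a = f.
  apply: cmorP => j x; change (f j (e j x) = f j x).
  by have [ji|ji] := eqVneq j i; [rewrite ei|rewrite !f0].
case: (fac U a b ba) => [[r ra]|[q bq]].
  have V1 (x : V (i + 1)) : x = 0.
    apply: esym; apply: etrans (congr1 (fun u : cmor V V => u (i + 1) x) ra).
    apply: esym; apply: etrans (linear0 (r (i + 1))); congr (r _ _).
    by apply: fixmodP; apply: eo; apply: succ_ne.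
  apply: V0; apply: cmorP => j x; suff -> : x = 0 by rewrite !linear0.
  have [ej|ji] := eqVneq j i; first by subst j; rewrite -(sd x) (V1 (diff V i (i + 1) x)) linear0.
  have [ej|ji1] := eqVneq j (i + 1); first by subst j; apply: V1.
  exact: V_out.
have W1 (y : W i') : y = 0.
  by apply: esym; apply: etrans (congr1 (fun u : cmor W W => u i' y) bq); apply/esym/f0.
apply: W0; apply: cmorP => j x; suff -> : x = 0 by rewrite !linear0.
have [ej|ji] := eqVneq j i'; first by subst j; apply: W1.
have [ej|ji1] := eqVneq j (i' + 1); first by subst j; rewrite -(dt x) (W1 (t x)) linear0.
exact: W_out.
Qed.
End NoIrreducible.

(** * Periodic complexes can be knitted *)

Section Transfer.
Variables (k : fieldType) (L : lincat k).

Lemma ras_liso (E X Z : L) (g : lhom E X) (f : lhom X Z) :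
  liso f -> ras L g -> ras L (f ** g).
Proof.
move=> [f' [f'f ff']] [ns lift]; split.
  move=> [s /= fs]; apply: ns; exists (s ** f); rewrite /=.
  have -> : g ** (s ** f) = f' ** (f ** g ** s) ** f by rewrite !lcompA f'f lcomp1f.
  by rewrite fs lcompf1.
move=> W h nh; have [|h' /= e] := lift W (f' ** h).
  move=> [s /= hs]; apply: nh; exists (s ** f'); rewrite /=.
  have -> : h ** (s ** f') = f ** (f' ** h ** s) ** f' by rewrite !lcompA ff' lcomp1f.
  by rewrite hs lcompf1.
by exists h'; rewrite /= -lcompA e lcompA ff' lcomp1f.
Qed.
End Transfer.

Lemma las_liso (k : fieldType) (L : lincat k) (E X Z : L) (g : lhom X E) (f : lhom Z X) :
  liso f -> las L g -> las L (g ** f).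
Proof.
move=> [f' [f'f ff']]; apply: (@ras_liso k (opL L) E X Z g f).
by exists f'; split.
Qed.

Section PeriodicExact.
Variables (k : fieldType) (A : falgType k) (nu m : nat).
Hypothesis hnu : sgldim A nu.
Notation LP := (perL A m).
Notation LB := (bndL A).
Let spl := @perL_splits k A m.
Notation dsS := (fun X Y Z f g => degreewise_split f g : Prop).
Notation EP := (@exc k LP dsS).

(** The contractible cover of a projective object splits. *)
Lemma per_proj P : @projective_obj EP P <-> contractible (P : cplx A 'Z_m).
Proof.
split=> [pP|cP]; last exact: contractible_proj.
have cp1 : cmor_comp (disk_cover_map P) (cmor_id _) = disk_cover_map P by apply: cmorP.
have [X [f s]] := disk_cover_deflation cp1.
have [h' ch'] := pP _ _ _ f (disk_cover_map P) s (cmor_id P).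
exact: contractible_retract ch' (disk_cover_contractible P).
Qed.

Lemma per_inj J : @injective_obj EP J <-> contractible (J : cplx A 'Z_m).
Proof.
split=> [iJ|cJ]; last exact: contractible_inj.
have jc1 : cmor_comp (cmor_id _) (disk_hull_map J) = disk_hull_map J by apply: cmorP.
have [Z [g s]] := disk_hull_inflation jc1.
have [h' ch'] := iJ _ _ _ (disk_hull_map J) g s (cmor_id J).
exact: contractible_retract ch' (disk_hull_contractible J).
Qed.

Lemma per_noirr V W (f : @lhom k LP V W) : lindec LP V -> lindec LP W ->
  @injective_obj EP V -> @projective_obj EP W -> ~ @irreducible (acat LP) V W f.
Proof.
move=> iV iW /per_inj cV /per_proj cW.
have idV u := @indec_idem _ _ spl V u iV; have idW u := @indec_idem _ _ spl W u iW.
have V0 := indec_nonzero iV; have W0 := indec_nonzero iW.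
have [i [s [V_out sd ds]]] := contractible_indec cV idV V0.
have [i' [t [W_out td dt]]] := contractible_indec cW idW W0.
have [e|ne] := eqVneq i' i; first exact: (same_degree_reducible V_out sd ds W_out td dt e).
exact: (other_degree_reducible V_out sd ds V0 W0 W_out dt ne).
Qed.

(** Compression carries contractions along, so that a complex N with F N
isomorphic to Z is not contractible either. *)
Lemma compr_noncontractible Z : lindec LP Z -> ~ contractible (Z : cplx A 'Z_m) ->
  exists2 N : LB, lindec LB N /\ ~ contractible (N : bcplx A) &
  exists f : @lhom k LP (compr_ob m N) Z, liso f.
Proof.
move=> iZ nZ; have [N iN [f [g [gf fg]]]] := compr_dense hnu iZ; exists N; last by exists f, g.
by split=> // /(compr_contractible m) cN; apply: nZ; apply: contractible_retract fg cN.
Qed.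

Theorem periodic_exactness : exactness (dsS : sesT LP).
Proof.
split.
- by move=> X Y Z f g; apply: ses_comp0.
- by move=> X Y Z f g; apply: ses_mono.
- by move=> X Y Z f g; apply: ses_epi.
- by move=> X Y Z f g; apply: ses_ker.
- by move=> X Y Z f g; apply: ses_coker.
- by move=> X Y Z f g; apply: ses_push.
- by move=> X Y Z f g; apply: ses_pull.
- move=> Z; exists (disk_cover Z), (disk_cover_map Z); split; last by move=> E g p'; apply: disk_cover_deflation.
  by apply/per_proj; apply: disk_cover_contractible.
- move=> Z; exists (disk_hull Z), (disk_hull_map Z); split; last by move=> E g p'; apply: disk_hull_inflation.
  by apply/per_inj; apply: disk_hull_contractible.
- move=> Z iZ nZ; have [|N [iN nN] [f lf]] := compr_noncontractible iZ; first by move/per_proj.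
  have [E [g rg]] := bnd_ras hnu iN nN.
  have rF := (@ras_liso k LP (compr_ob m E) (compr_ob m N) Z (compr m g) f lf (compr_ras m hnu iN rg)).
  by exists (compr_ob m E), ((f : @lhom k LP _ _) ** (compr m g : @lhom k LP _ _)).
- move=> X iX nX; have [|N [iN nN] [f [f' [f'f ff']]]] := compr_noncontractible iX; first by move/per_inj.
  have [E [g lg]] := bnd_las hnu iN nN.
  exists (compr_ob m E), ((compr m g : @lhom k LP _ _) ** f'); apply: (@las_liso k LP (compr_ob m E) (compr_ob m N) X (compr m g) f' _ (compr_las m hnu iN lg)).
  by exists f.
exact: per_noirr.
Qed.

Theorem Cper_knittable : knittable (Cper A m).
Proof. by rewrite CperE; apply: (exactness_knittable spl); apply: periodic_exactness. Qed.

End PeriodicExact.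

(** * Compression of almost split sequences *)

Section CompressSes.
Variables (k : fieldType) (A : falgType k) (m : nat).
Variables (X Y : bcplx A) (h : forall i, {linear X i -> Y i}).

Program Definition dsum_map_fun (i : 'Z_m) (x : dsum X i) : dsum Y i :=
  @DSum _ _ _ _ (fun j => h j (x j)) _ _.
Next Obligation.
by move=> i [x [a [b ab]] x2] /=; exists a, b => j /ab ->; rewrite linear0.
Qed.
Next Obligation. by move=> i x j nj /=; rewrite fam_res // linear0. Qed.
Fact dsum_map_subproof i : linear (@dsum_map_fun i).
Proof. by move=> c x y; apply: dsumP => j /=; rewrite linearP. Qed.
Definition dsum_map i : {linear dsum X i -> dsum Y i} := mklin (@dsum_map_subproof i).
End CompressSes.

Lemma compr_ses (k : fieldType) (A : falgType k) m (X Y Z : Cb A)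
    (f : homset X Y) (g : homset Y Z) :
  degreewise_split f g -> degreewise_split (compr m f) (compr m g).
Proof.
move=> s; have [t [r [gt rf fr]]] := ses_twist s; move=> i; split.
- by move=> x y e; apply: dsumP => j; rewrite -(rf j (x j)) -(rf j (y j)); have := congr1 (fun z : dsum Y i => r j (z j)) e.
- move=> y; split=> [gy|[x ->]]; last first.
    by apply: dsumP => j; apply: (congr1 (fun u : cmor X Z => u j (x j)) (ses_comp0 s)).
  exists (dsum_map r i y); apply: dsumP => j; rewrite /= fr.
  by have -> : g j (y j) = 0 by [apply: (congr1 (fun z : dsum Z i => z j) gy)]; rewrite linear0 subr0.
by exists (@dsum_map k A m Z Y t i) => z; apply: dsumP => j; apply: gt.
Qed.

Section AlmostSplit.
Variables (k : fieldType) (A : falgType k) (nu m : nat).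
Hypothesis hnu : sgldim A nu.
Notation LP := (perL A m).
Notation LB := (bndL A).
Let splP := @perL_splits k A m.
Let splB := @bndL_splits k A.
Notation dsS := (fun X Y Z f g => degreewise_split f g : Prop).
Notation F X := (compr_ob m X : cplx A 'Z_m).

Lemma Cb_asE X Y Z f g :
  @almost_split (Cb A) X Y Z f g = @almost_split (@exc k LB dsS) X Y Z f g.
Proof. by move: f g; rewrite /Cb /Cb_cat (cmor_eqF (@bcob A)). Qed.

Lemma Cper_asE X Y Z f g :
  @almost_split (Cper A m) X Y Z f g = @almost_split (@exc k LP dsS) X Y Z f g.
Proof. by move: f g; rewrite /Cper /Cper_cat (cmor_eqF id). Qed.

Lemma compr_preserves (X Y Z : LB) (f : @lhom k LB X Y) (g : @lhom k LB Y Z) :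
  @almost_split (@exc k LB dsS) X Y Z f g ->
  @almost_split (@exc k LP dsS) (F X) (F Y) (F Z) (compr m f) (compr m g).
Proof.
move=> [s [lf mf rg mg]]; have sF : degreewise_split (compr m (f : @homset (Cb A) X Y)) (compr m (g : @homset (Cb A) Y Z)) := compr_ses s.
have iZ := ras_indec rg.
have iX : lindec LB X := (op_indec X).1 (@ras_indec k (opL LB) Y X f lf).
have lF := compr_las m hnu iX lf; have rF := compr_ras m hnu iZ rg.
have exP := periodic_exactness m hnu.
have iFZ := ras_indec rF.
have iFX := @ras_indec k (opL LP) (F Y) (F X) (compr m f) lF.
split=> //; split=> //; first exact: (ses_lmin splP exP sF lF.1 iFZ).
move=> u gu.
have [v []] := @ses_lmin k (opL LP) _ (op_splits splP) (op_exactness exP) _ _ _ (compr m g) (compr m f) sF rF.1 iFX u gu.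
by exists v.
Qed.

(** Splittings, factorizations and inverses in the periodic category have
components on the sheet 0, which do the same for f and g. *)
Lemma compr_reflects (X Y Z : LB) (f : @lhom k LB X Y) (g : @lhom k LB Y Z) :
  degreewise_split f g ->
  @almost_split (@exc k LP dsS) (F X) (F Y) (F Z) (compr m f) (compr m g) ->
  @almost_split (@exc k LB dsS) X Y Z f g.
Proof.
move=> s [_ [[nf lf] mf [ng rg] mg]]; split=> //; split.
- split; first by move=> sf; apply: nf; apply/compr_smono.
  move=> W h nh.
  have [|h' e] := lf (F W) (compr m h); first by move/compr_smono.
  exists (sheet0_part (h' : cmor (F Y) (F W))); apply: etrans (esym (sheet0_part_compr f _)) _.
  rewrite [cmor_comp _ _]e; apply: sheet0_part_comprE.
- move=> u uf; apply: compr_liso; apply: mf; apply: cmorP => i x; apply: dsumP => j.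
  exact: (congr1 (fun h : cmor X Y => h j (x j)) uf).
- split; first by move=> sg; apply: ng; apply/compr_sepi.
  move=> W h nh.
  have [|h' e] := rg (F W) (compr m h); first by move/compr_sepi.
  exists (sheet0_part (h' : cmor (F W) (F Y))); apply: etrans (esym (sheet0_part_compl g _)) _.
  rewrite [cmor_comp _ _]e; apply: sheet0_part_comprE.
move=> u gu; apply: compr_liso; apply: mg; apply: cmorP => i x; apply: dsumP => j.
exact: (congr1 (fun h : cmor Y Z => h j (x j)) gu).
Qed.

Theorem almost_split_compr (X Y Z : Cb A) (f : homset X Y) (g : homset Y Z) : ses f g ->
  (almost_split f g <-> almost_split (compr m f) (compr m g)).
Proof.
move=> s; rewrite Cb_asE Cper_asE; split; first exact: compr_preserves.
exact: compr_reflects.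
Qed.
End AlmostSplit.

(** * The additive function *)

Section Dimension.
Variables (k : fieldType) (A : falgType k) (e : A).
Implicit Types M N : lmodType A.

Lemma scalar_commute M c (x : M) : e *: (c%:A *: x) = c%:A *: (e *: x).
Proof. by rewrite !scalerA mulr_algr mulr_algl. Qed.

(** A k-linear isomorphism of k^d with the fixed space of e in M, in a form which
needs no module structure over k on M. *)
Definition edim M d := exists phi : 'rV[k]_d -> M,
  [/\ forall c u v, phi (c *: u + v) = c%:A *: phi u + phi v,
      forall u, e *: phi u = phi u
    & forall x, e *: x = x -> exists! u, x = phi u].

Lemma edimP M d : edim M d <-> exists b : 'I_d -> M,
    (forall j, e *: b j = b j) /\
    (forall x : M, e *: x = x ->
       exists! c : 'rV[k]_d, x = \sum_(j < d) (c 0 j)%:A *: b j).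
Proof.
split=> [[phi [phiP ephi phiU]]|[b [eb bU]]]; last first.
  exists (fun u => \sum_(j < d) (u 0 j)%:A *: b j); split=> [c u v|u|//].
    rewrite scaler_sumr -big_split; apply: eq_bigr => j _ /=.
    rewrite !mxE [c%:A *: _]scalerA -scalerDl; congr (_ *: _).
    by rewrite mulr_algl scalerA -scalerDl.
  rewrite scaler_sumr; apply: eq_bigr => j _.
  by rewrite scalar_commute eb.
exists (fun j => phi (delta_mx 0 j)); split=> // x /phiU[u [xu uu]].
have phi0 : phi 0 = 0.
  by apply: (addIr (phi 0)); have := phiP 1 0 0; rewrite !scale1r !addr0 add0r => <-.
have phi_sum (c : 'rV[k]_d) : \sum_(j < d) (c 0 j)%:A *: phi (delta_mx 0 j) = phi c.
  rewrite [in RHS](row_sum_delta c).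
  elim/big_rec2: _ => [//|j x1 x2 _ ->]; by rewrite phiP.
by exists u; split=> [|c]; rewrite phi_sum //; apply: uu.
Qed.

(** Coordinates with respect to a dual basis and to a basis of A over k embed M
in a row space over k; the fixed space of e becomes a subspace there. *)
Lemma edim_ex M : dual_basis M -> exists d, edim M d.
Proof.
move=> [J [a [b ab]]].
pose W := {ffun J -> A} : vectType k.
pose co x : W := [ffun j => b j x].
pose n := \dim {:W}; pose F x : 'rV[k]_n := \row_t coord (vbasis {:W}) t (co x).
have coP c x y : co (c%:A *: x + y) = c *: co x + co y.
  by apply/ffunP => j; rewrite !ffunE linearP /GRing.scale /= mulr_algl.
have FP c x y : F (c%:A *: x + y) = c *: F x + F y.
  by apply/rowP => t; rewrite !mxE coP linearP.
have F_inj x y : F x = F y -> x = y.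
  move=> /rowP Fxy; have exy : co x = co y.
    rewrite (coord_vbasis (memvf (co x))) (coord_vbasis (memvf (co y))).
    by apply: eq_bigr => t _; have := Fxy t; rewrite !mxE => ->.
  rewrite (ab x) (ab y); apply: eq_bigr => j _.
  by have := congr1 (fun h : W => h j) exy; rewrite !ffunE => ->.
have F0 : F 0 = 0 by have := FP (-1) 0 0; rewrite scaler0 addr0 scaleN1r addNr.
pose S v := exists x, e *: x = x /\ F x = v.
have clS : lin_closed S.
  split; first by exists 0; rewrite scaler0.
  move=> c _ _ [x [ex <-]] [y [ey <-]]; exists (c%:A *: x + y); split=> //.
  by rewrite scalerDr ey scalar_commute ex.
have [r [x [Sx gen]]] := subspace_rV clS.
pose B := \matrix_(i < r) x i.
have SB v : S v <-> (v <= B)%MS.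
  split=> [/gen[c ->]|/submxP[D ->]].
    by apply/submxP; exists (\row_i c i); rewrite mulmx_sum_row; apply: eq_bigr => i _; rewrite mxE rowK.
  by rewrite mulmx_sum_row; apply: lin_closed_sum => // i; rewrite rowK.
have ex u : exists x, e *: x = x /\ F x = u *m row_base B.
  by apply/SB; apply: submx_trans (submxMl _ _) _; rewrite eq_row_base.
pose phi u := sval (cid (ex u)); have phiP u : e *: phi u = phi u /\ F (phi u) = u *m row_base B.
  exact: svalP (cid (ex u)).
exists (\rank B), phi; split=> [c u v|u|y ey].
- by apply: F_inj; rewrite FP !(phiP _).2 mulmxDl scalemxAl.
- exact: (phiP u).1.
have : (F y <= row_base B)%MS by rewrite eq_row_base; apply/SB; exists y.
case/submxP => u Fy; exists u; split; first by apply: F_inj; rewrite (phiP u).2.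
move=> u' yu; apply: (row_free_inj (row_base_free B)).
by rewrite -Fy yu (phiP u').2.
Qed.

Lemma edim_le M d d' : edim M d -> edim M d' -> (d <= d')%N.
Proof.
move=> [phi [phiP ephi phiU]] [phi' [phiP' ephi' phiU']].
have ex u : exists u', phi u = phi' u' by have [u' [h _]] := phiU' _ (ephi u); exists u'.
pose psi u := sval (cid (ex u)); have psiP u : phi u = phi' (psi u) := svalP (cid (ex u)).
have inj' u v : phi' u = phi' v -> u = v.
  by have [w [_ uw]] := phiU' _ (ephi' u); move=> h; rewrite -(uw u) // -(uw v).
have psil : linear psi by move=> c u v; apply: inj'; rewrite phiP' -!psiP phiP.
have psi_inj u : psi u = 0 -> u = 0.
  move=> pu; have [w [_ uw]] := phiU _ (ephi u); rewrite -(uw u) // -(uw 0) //.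
  have p0 : psi 0 = 0 := linear0 (mklin psil).
  by rewrite !psiP pu p0.
have : row_free (lin1_mx (mklin psil)).
  by apply: inj_row_free => v; rewrite mul_rV_lin1 => /psi_inj.
by move/eqP <-; apply: rank_leq_col.
Qed.

Lemma dim_atE M d : edim M d -> dim_at e M = d.
Proof.
move=> dM; apply: xget_unique => [|d' /edimP dM']; first exact/edimP.
by apply/eqP; rewrite eqn_leq !(@edim_le M).
Qed.

Lemma edim_iso M N (f : {linear M -> N}) (g : {linear N -> M}) d :
  cancel f g -> cancel g f -> edim M d -> edim N d.
Proof.
move=> fg gf [phi [phiP ephi phiU]]; exists (f \o phi); split=> [c u v|u|y ey] /=.
- by rewrite phiP linearP.
- by rewrite -linearZ ephi.
have [|u [gy uu]] := phiU (g y); first by rewrite -linearZ ey.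
exists u; split=> [|v yv]; first by rewrite -gy gf.
by apply: uu; rewrite yv fg.
Qed.

Lemma edim_sum M n (N : 'I_n -> lmodType A) (q : forall j, {linear N j -> M})
    (p : forall j, {linear M -> N j}) (d : 'I_n -> nat) :
  (forall j x, p j (q j x) = x) -> (forall j l x, j != l -> p l (q j x) = 0) ->
  (forall x, x = \sum_j q j (p j x)) -> (forall j, edim (N j) (d j)) ->
  edim M (\sum_j d j)%N.
Proof.
move=> pq ort tot dN; have [phi phiP] : exists phi : forall j, 'rV[k]_(d j) -> N j, forall j,
    [/\ forall c u v, phi j (c *: u + v) = c%:A *: phi j u + phi j v,
      forall u, e *: phi j u = phi j u
    & forall x, e *: x = x -> exists! u, x = phi j u].
  by exists (fun j => sval (cid (dN j))) => j; exact: svalP (cid (dN j)).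
have pphi (u : 'rV[k]_(\sum_j d j)) l :
    p l (\sum_j q j (phi j (submxrow u j))) = phi l (submxrow u l).
  rewrite linear_sum (bigD1 l) //= pq big1 ?addr0 // => j jl; exact: ort.
exists (fun u => \sum_j q j (phi j (submxrow u j))); split=> [c u v|u|x ex].
- rewrite scaler_sumr -big_split; apply: eq_bigr => j _ /=.
  have -> : submxrow (c *: u + v) j = c *: submxrow u j + submxrow v j.
    by apply/rowP => t; rewrite !mxE.
  by have [-> _ _] := phiP j; rewrite linearP.
- rewrite scaler_sumr; apply: eq_bigr => j _; rewrite -linearZ.
  by have [_ -> _] := phiP j.
have exj j : exists! u, p j x = phi j u.
  by have [_ _] := phiP j; apply; rewrite -linearZ ex.
have [u uP] : exists u : forall j, 'rV[k]_(d j), forall j, unique (fun u => p j x = phi j u) (u j).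
  by exists (fun j => sval (cid (exj j))) => j; exact: svalP (cid (exj j)).
exists (\mxrow_j u j); split=> [|v xv].
  by rewrite [LHS]tot; apply: eq_bigr => j _; rewrite mxrowK -(uP j).1.
apply/mxrowP => j; rewrite mxrowK; apply: (uP j).2.
by rewrite xv pphi.
Qed.

Lemma edim_split (X M Z : lmodType A) (f : {linear X -> M}) (g : {linear M -> Z})
    (t : {linear Z -> M}) (r : {linear M -> X}) a b :
  (forall z, g (t z) = z) -> (forall x, r (f x) = x) ->
  (forall y, f (r y) = y - t (g y)) ->
  edim X a -> edim Z b -> edim M (a + b).
Proof.
move=> gt rf fr [phi [phiP ephi phiU]] [psi [psiP epsi psiU]].
have rt z : r (t z) = 0 by rewrite -(rf (r _)) fr gt subrr linear0.
have gf x : g (f x) = 0.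
  have : t (g (f x)) = 0 by have := fr (f x); rewrite rf => /eqP; rewrite eq_sym subr_eq addrC -subr_eq subrr => /eqP.
  by move=> h; rewrite -(gt (g _)) h linear0.
exists (fun u => f (phi (lsubmx u)) + t (psi (rsubmx u))); split=> [c u v|u|y ey].
- by rewrite !linearP phiP psiP !linearP scalerDr addrACA.
- by rewrite scalerDr -!linearZ ephi epsi.
have [|u [yu uu]] := phiU (r y); first by rewrite -linearZ ey.
have [|v [yv vv]] := psiU (g y); first by rewrite -linearZ ey.
exists (row_mx u v); split=> [|w yw].
  by rewrite row_mxKl row_mxKr -yu -yv fr subrK.
rewrite -[w]hsubmxK; congr row_mx; [apply: uu|apply: vv].
  by rewrite yw linearD rf rt addr0.
by rewrite yw linearD gf gt add0r.
Qed.
End Dimension.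

Lemma cper_big (k : fieldType) (A : falgType k) m (X Y : cplx A 'Z_m) n
    (f : 'I_n -> cmor X Y) i x :
  (\big[@cmor_add _ _ X Y/cmor_zero X Y]_(j < n) f j) i x = \sum_(j < n) f j i x.
Proof. by elim/big_rec2: _ => [//|j u v _ <-]. Qed.

Theorem dim_at_additive (k : fieldType) (A : falgType k) (e : A) m (i : 'Z_m) :
  additive_function (fun X : Cper A m => dim_at e (X i)).
Proof.
have edim_ob (X : Cper A m) : exists d, edim e (X i) d by apply: edim_ex; apply: cob_dual.
split=> [X Y [f [g [gf fg]]]|X n Y Z [E [f [g [[s _] [q [p [pq ort tot]]] _]]]]].
  have [d dX] := edim_ob X; rewrite (dim_atE dX).
  by rewrite (dim_atE (edim_iso (f := f i) (g := g i) (gf i) (fg i) dX)).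
pose d (W : Cper A m) := sval (cid (edim_ob W)).
have dP W : edim e ((W : Cper A m) i) (d W) := svalP (cid (edim_ob W)).
have dE : edim e (E i) (\sum_(j < n) d (Y j))%N.
  apply: (@edim_sum _ _ _ _ _ (fun j => Y j i) (fun j => q j i) (fun j => p j i)) => //.
  - by move=> j x; apply: pq.
  - by move=> j l x /ort; apply.
  - by move=> x; rewrite -[LHS](tot i x) cper_big.
have [t [r [gt rf fr]]] := ses_twist s.
have dE2 := edim_split (gt i) (rf i) (fr i) (dP X) (dP Z).
rewrite (dim_atE (dP X)) (dim_atE (dP Z)); under eq_bigr do rewrite (dim_atE (dP _)).
by rewrite -(dim_atE dE) (dim_atE dE2).
Qed.

Theorem theorem4p1 (k : fieldType) (A : falgType k) (nu : nat)
    (hnu : sgldim A nu) (m : nat) (hm : (2 <= m)%N) :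
  (forall (X Y Z : Cb A) (f : homset X Y) (g : homset Y Z), ses f g ->
     (almost_split f g <-> almost_split (compr m f) (compr m g)))
  /\
  (knittable (Cper A m) /\
   forall (e : A) (i : 'Z_m), (e * e = e)%R ->
     additive_function (fun X : Cper A m => dim_at e (X i))).
Proof.
split; first by move=> X Y Z f g; apply: (almost_split_compr m hnu).
by split=> [|e i _]; [apply: Cper_knittable hnu|apply: dim_at_additive].
Qed.
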